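(* Let $I$ be a nonempty set and let $(U_i)_{i\in I}$ and $(V_i)_{i\in I}$ be families such that each $U_i$ is an open nonempty subset of a normed space $X_i$ and each $V_i$ is an open subset, star-shaped with center $0$, of a normed space $Y_i$. Let $(Z_i)_{i\in I}$ be another family of normed spaces, and let $\mathcal W\subseteq\overline{\mathbb R}^{\bigsqcup_{i\in I}U_i}$ contain an adjusting weight $\omega$ for $(V_i)_{i\in I}$. For each $i\in I$ let $\beta_i\in\mathcal{FC}^\infty(U_i\times V_i,Z_i)$ be a map with $\beta_i(U_i\times\{0\})=\{0\}$. Assume further that $$(\forall f\in\mathcal W,\ \ell\in\mathbb N^* )(\exists g\in\mathcal W_{\max})(\forall i\in I)\quad \|\beta_i\|_{1_{U_i\times V_i},\ell}\,|f_i|\le |g_i|.$$ Then for each $k\in\overline{\mathbb N}$ the map $$\beta_*:\mathcal C_{\mathcal W}^{\omega_\partial,k}(U_i,V_i)_{i\in I}\to\mathcal C_{\mathcal W}^{k}(U_i,Z_i)_{i\in I}:\ (\gamma_i)_{i\in I}\mapsto(\beta_i\circ(\mathrm{id}_{U_i},\gamma_i))_{i\in I}$$ is defined (i.e. takes its values in the indicated space) and smooth.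
   Context: Conventions. $\mathbb N=\{0,1,2,\dots\}$, $\mathbb N^*=\mathbb N\setminus\{0\}$, $\overline{\mathbb N}=\mathbb N\cup\{\infty\}$, $\overline{\mathbb R}=\mathbb R\cup\{\infty\}$ with $|\infty|=\infty$ and $0\cdot\infty=0$. All spaces are over a fixed $\mathbb K\in\{\mathbb R,\mathbb C\}$. $B_Y(0,r)$ is the open ball of radius $r$ around $0$ in $Y$. Products of normed spaces carry the maximum norm. Weighted functions. For normed spaces $X,Y$, $U\subseteq X$ open nonempty and $k\in\overline{\mathbb N}$, $\mathcal{FC}^k(U,Y)$ is the set of $k$-times continuously Fréchet differentiable maps ($\mathcal{FC}^0$: continuous maps), and $D^{(\ell)}\phi:U\to \mathrm L^\ell(X,Y)$ is the $\ell$-th Fréchet derivative, with values in the continuous $\ell$-linear maps with operator norm ($D^{(0)}\phi=\phi$). For $f:U\to\overline{\mathbb R}$ put $\|\phi\|_{f,\ell}=\sup_{x\in U}|f(x)|\,\|D^{(\ell)}\phi(x)\|_{op}\in[0,\infty]$. $1_U$ is the constant function $1$. For nonempty $\mathcal W\subseteq\overline{\mathbb R}^U$, $\mathcal C^k_{\mathcal W}(U,Y)=\{\gamma\in\mathcal{FC}^k(U,Y):\|\gamma\|_{f,\ell}<\infty\ \forall f\in\mathcal W,\ell\in\mathbb N,\ell\le k\}$, with the locally convex topology given by these seminorms. Weighted restricted products. Given open nonempty $U_i\subseteq X_i$, normed spaces $Y_i$ ($i\in I$) and nonempty $\mathcal W\subseteq\overline{\mathbb R}^{\bigsqcup_i U_i}$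 (functions on the disjoint union), put $f_i=f|_{U_i}$ and $\mathcal W_i=\{f_i:f\in\mathcal W\}$. Then $\mathcal C^k_{\mathcal W}(U_i,Y_i)_{i\in I}$ is the space of all $(\phi_i)_i\in\prod_i\mathcal C^k_{\mathcal W_i}(U_i,Y_i)$ with $\|(\phi_i)_i\|_{f,\ell}:=\sup_{i\in I}\|\phi_i\|_{f_i,\ell}<\infty$ for all $f\in\mathcal W$, $\ell\in\mathbb N$, $\ell\le k$, with the locally convex topology defined by these seminorms. $\mathcal W_{\max}$ is the set of all $g:\bigsqcup_iU_i\to\overline{\mathbb R}$ such that $\|\cdot\|_{g,0}$ is a continuous seminorm on $\mathcal C^0_{\mathcal W}(U_i,E_i)_{i\in I}$ for every family $(E_i)_{i\in I}$ of normed spaces. Adjusting weights. $\omega:\bigsqcup_iU_i\to\mathbb R$ is an adjusting weight for $(V_i)_i$ ($V_i$ star-shaped with center $0$) if for each $i$, with $r_i=\mathrm{dist}(\{0\},\partial V_i)\in\,]0,\infty]$ (and $1/\infty=0$), $\sup_{x\in U_i}|\omega_i(x)|<\infty$ and $\inf_{x\in U_i}|\omega_i(x)|\ge\max(1/r_i,1)$. For nowhere vanishing $\omega:\bigsqcup_iU_i\to\mathbb R$, $\mathcal C^{\omega_\partial,k}_{\mathcal W}(U_i,V_i)_{i\in I}$ is the set of $(\gamma_i)_i\in\mathcal C^k_{\mathcal W}(U_i,Y_i)_{i\in I}$ for which there is $r>0$ with $\gamma_i(x)+B_{Y_i}(0,r/|\omega(x)|)\subseteq V_i$ for all $i\in I$,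 $x\in U_i$ (an open subset here since $\omega\in\mathcal W$). Differentiability. A map $f:U\to Y$ from an open subset of a locally convex space $X$ to a locally convex space $Y$ is $\mathcal C^1$ if the directional derivatives $df(u;x)=\lim_{t\to0}t^{-1}(f(u+tx)-f(u))$ ($t\in\mathbb K\setminus\{0\}$) exist and $df:U\times X\to Y$ is continuous; it is $\mathcal C^k$ if it is $\mathcal C^1$ and $df$ is $\mathcal C^{k-1}$; smooth means $\mathcal C^k$ for all $k\in\mathbb N$. *)

(* Defs.v *)
From Stdlib Require List.
From HB Require Import structures.
From mathcomp Require Import all_boot all_order all_algebra.
From mathcomp Require Import complex.
From mathcomp Require Import all_classical all_reals all_analysis.

Set Implicit Arguments.
Unset Strict Implicit.
Unset Printing Implicit Defensive.

Import Order.TTheory GRing.Theory Num.Theory.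
Import numFieldNormedType.Exports.

Local Open Scope classical_set_scope.
Local Open Scope ring_scope.

(* The base field is R or R[i]. Norms in a [normedModType K] take their values
   in K, also when K = R[i]; [sreal] and [ofreal] convert between the real
   elements of K and R, and all suprema of norms are taken in R or \bar R
   through [nrm]. *)
Record scalarField (R : realType) := ScalarField {
  scalar_field :> numFieldType;
  sreal : scalar_field -> R;
  ofreal : R -> scalar_field;
  ofrealD : {morph ofreal : a b / a + b};
  ofrealM : {morph ofreal : a b / a * b};
  ofrealK : cancel ofreal sreal;
  le_ofreal : {mono ofreal : a b / a <= b};
  srealK : forall a, 0 <= a -> ofreal (sreal a) = a }.

Section Scalars.
Variable R : realType.

Definition real_scalars : scalarField R :=
  @ScalarField R R id id (fun _ _ => erefl) (fun _ _ => erefl)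
    (fun _ => erefl) (fun _ _ => erefl) (fun _ _ => erefl).

Let complexK (a : R[i]%C) : 0 <= a -> ((complex.Re a)%:C)%C = a.
Proof. by move=> a0; rewrite RRe_real// ger0_real. Qed.

Definition complex_scalars : scalarField R :=
  @ScalarField R R[i]%C (@complex.Re R) (fun a => (a%:C)%C)
    (rmorphD (real_complex R)) (rmorphM (real_complex R))
    (fun _ => erefl) (@lecR R) complexK.

Variable K : scalarField R.

Lemma ofreal_inj : injective (@ofreal R K).
Proof. exact: can_inj (@ofrealK R K). Qed.

Lemma ofreal0 : ofreal K 0 = 0.
Proof. by apply: (@addrI _ (ofreal K 0)); rewrite -ofrealD !addr0. Qed.

Lemma ofreal1 : ofreal K 1 = 1.
Proof.
have o0 : ofreal K 1 != 0 by rewrite -ofreal0 (inj_eq ofreal_inj) oner_neq0.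
by apply: (mulfI o0); rewrite -ofrealM !mulr1.
Qed.

Lemma sreal0 : sreal (0 : K) = 0.
Proof. by rewrite -ofreal0 ofrealK. Qed.

Lemma lt_ofreal (a b : R) : (ofreal K a < ofreal K b) = (a < b).
Proof. by rewrite !lt_neqAle le_ofreal (inj_eq ofreal_inj). Qed.

Lemma sreal_norm_ge0 (a : K) : 0 <= sreal `|a|.
Proof. by rewrite -(le_ofreal K) ofreal0 srealK. Qed.

End Scalars.

Section Nrm.
Variables (R : realType) (K : scalarField R) (V : normedModType K).

Definition nrm (x : V) : R := sreal `|x|.

Lemma normE (x : V) : `|x| = ofreal K (nrm x).
Proof. by rewrite srealK. Qed.

Lemma nrm_ge0 (x : V) : 0 <= nrm x.
Proof. by rewrite -(le_ofreal K) -normE ofreal0. Qed.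

Lemma nrmD (x y : V) : nrm (x + y) <= nrm x + nrm y.
Proof. by rewrite -(le_ofreal K) ofrealD -!normE ler_normD. Qed.

Lemma nrmZ (a : K) (x : V) : nrm (a *: x) = sreal `|a| * nrm x.
Proof. by apply: (@ofreal_inj _ K); rewrite ofrealM srealK// -!normE normrZ. Qed.

Lemma nrm0 : nrm (0 : V) = 0.
Proof. by rewrite /nrm normr0 sreal0. Qed.

Lemma nrm0_eq0 (x : V) : nrm x = 0 -> x = 0.
Proof. by move=> x0; apply/normr0_eq0; rewrite normE x0 ofreal0. Qed.

End Nrm.

Section BoundedLinear.
Variables (R : realType) (K : scalarField R) (X Y : normedModType K).

Definition continuous_linear : {pred X -> Y} :=
  fun A => `[< linear A /\ continuous A >].

Record bounded_linear := BoundedLinear {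
  blfun :> X -> Y;
  _ : blfun \in continuous_linear }.

HB.instance Definition _ := [isSub for blfun].
HB.instance Definition _ := [Choice of bounded_linear by <:].

Lemma continuous_linear_submod : submod_closed continuous_linear.
Proof.
split.
  apply/asboolP; split=> [a x y|]; last exact: cst_continuous.
  by rewrite /= scaler0 addr0.
move=> a A B /asboolP[lA cA] /asboolP[lB cB]; apply/asboolP; split.
  move=> b x y; rewrite !fctE lA lB !scalerDr !scalerA (mulrC a b).
  by rewrite addrACA.
move=> x; apply: cvgD; last exact: cB.
by apply: cvgZr; exact: cA.
Qed.

HB.instance Definition _ :=
  GRing.isSubmodClosed.Build K (X -> Y) continuous_linear
    (GRing.submod_closed_semi continuous_linear_submod).
HB.instance Definition _ :=
  [SubChoice_isSubLmodule of bounded_linear by <:].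

Lemma blfunP (A : bounded_linear) : linear A /\ continuous A.
Proof. by case: A => A /= /asboolP. Qed.

HB.instance Definition _ (A : bounded_linear) :=
  GRing.isLinear.Build K X Y *:%R A (blfunP A).1.

Lemma blfun_inj (A B : bounded_linear) : (forall x, A x = B x) -> A = B.
Proof. by move=> AB; apply/val_inj/funext. Qed.

Lemma blfunD (A B : bounded_linear) x : (A + B) x = A x + B x.
Proof. by []. Qed.

Lemma blfunZ (a : K) (A : bounded_linear) x : (a *: A) x = a *: A x.
Proof. by []. Qed.

Lemma blfun_bound (A : bounded_linear) :
  exists2 M : R, 0 <= M & forall x, nrm (A x) <= M * nrm x.
Proof.
have /linear_bounded_continuous :=
  (blfunP A).2 : continuous (A : {linear X -> Y}).
move=> /linear_boundedP /pinfty_ex_gt0 [M M0 AM].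
exists (sreal M).
  by rewrite -(le_ofreal K) ofreal0 srealK ltW.
move=> x; rewrite -(le_ofreal K) ofrealM srealK ?(ltW M0)//.
by rewrite -(normE x) -(normE (A x)); exact: AM.
Qed.

Definition blnorm (A : bounded_linear) : R :=
  sup [set nrm (A x) | x in [set x | nrm x <= 1]].

Lemma blnorm_has_sup (A : bounded_linear) :
  has_sup [set nrm (A x) | x in [set x | nrm x <= 1]].
Proof.
split; first by exists (nrm (A 0)), 0 => //=; rewrite nrm0.
have [M M0 AM] := blfun_bound A; exists M => _ [x /= x1 <-].
by rewrite (le_trans (AM x))// ler_piMr.
Qed.

Lemma blnorm_ge0 (A : bounded_linear) : 0 <= blnorm A.
Proof.
apply: (@le_trans _ _ (nrm (A 0))); first exact: nrm_ge0.
by apply: sup_upper_bound; [exact: blnorm_has_sup|exists 0; rewrite /= ?nrm0].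
Qed.

Lemma blnorm_le (A : bounded_linear) x : nrm (A x) <= blnorm A * nrm x.
Proof.
have [x0|x0] := eqVneq (nrm x) 0.
  by rewrite (nrm0_eq0 x0) (linear0 A) !nrm0 mulr0 lexx.
have xgt0 : 0 < nrm x by rewrite lt_neqAle eq_sym x0 nrm_ge0.
have c0 : 0 <= ofreal K (nrm x)^-1.
  by rewrite -(ofreal0 K) le_ofreal invr_ge0 ltW.
rewrite -ler_pdivrMr// mulrC.
rewrite -[X in X * _](ofrealK K) -[X in sreal X * _]ger0_norm// -nrmZ -linearZ.
apply: sup_upper_bound; first exact: blnorm_has_sup.
by exists (ofreal K (nrm x)^-1 *: x) => //=;
  rewrite nrmZ ger0_norm// ofrealK mulVf.
Qed.

Lemma blnorm_leP (A : bounded_linear) (M : R) :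
  (forall x, nrm x <= 1 -> nrm (A x) <= M) -> blnorm A <= M.
Proof.
move=> AM; apply: ge_sup; first exact: (blnorm_has_sup A).1.
by move=> _ [x /= x1 <-]; exact: AM.
Qed.

Let norm (A : bounded_linear) : K := ofreal K (blnorm A).

Let ler_blnormD (A B : bounded_linear) : norm (A + B) <= norm A + norm B.
Proof.
rewrite /norm -ofrealD le_ofreal; apply: blnorm_leP => x x1.
rewrite (le_trans (nrmD _ _))// lerD// (le_trans (blnorm_le _ _))//.
  by rewrite ler_piMr// blnorm_ge0.
by rewrite ler_piMr// blnorm_ge0.
Qed.

Let blnormZ_le (a : K) (A : bounded_linear) :
  blnorm (a *: A) <= sreal `|a| * blnorm A.
Proof.
apply: blnorm_leP => x x1; rewrite nrmZ ler_wpM2l ?sreal_norm_ge0//.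
by rewrite (le_trans (blnorm_le _ _))// ler_piMr// blnorm_ge0.
Qed.

Let blnormZ (a : K) (A : bounded_linear) : norm (a *: A) = `|a| * norm A.
Proof.
rewrite /norm -[X in X * _]srealK// -ofrealM; congr ofreal.
apply/eqP; rewrite eq_le blnormZ_le/=.
have [->|a0] := eqVneq a 0; first by rewrite normr0 sreal0 mul0r blnorm_ge0.
have := blnormZ_le a^-1 (a *: A).
rewrite scalerA mulVf// scale1r => /(ler_wpM2l (sreal_norm_ge0 a)).
move=> /le_trans; apply; rewrite mulrA.
suff -> : sreal `|a| * sreal `|a^-1| = 1 by rewrite mul1r.
apply: (@ofreal_inj _ K); rewrite ofrealM !srealK// -normrM mulfV//.
by rewrite normr1 ofreal1.
Qed.

Let blnorm0_eq0 (A : bounded_linear) : norm A = 0 -> A = 0.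
Proof.
rewrite /norm -(ofreal0 K) => /(@ofreal_inj _ K) A0.
apply: blfun_inj => x; apply: nrm0_eq0; apply/le_anti.
by rewrite nrm_ge0 (le_trans (blnorm_le A x))// A0 mul0r.
Qed.

HB.instance Definition _ :=
  Lmodule_isNormed.Build K bounded_linear ler_blnormD blnormZ blnorm0_eq0.

Lemma nrm_blnorm (A : bounded_linear) : nrm A = blnorm A.
Proof. by rewrite /nrm -[LHS]/(sreal (norm A)) ofrealK. Qed.

End BoundedLinear.

Section FrechetDerivatives.
Variables (R : realType) (K : scalarField R) (X : normedModType K).

(* 0 when [phi] is not differentiable at [x]. *)
Definition fderiv (Y : normedModType K) (phi : X -> Y) (x : X) :
    bounded_linear X Y :=
  insubd (0 : bounded_linear X Y) ('d phi x : X -> Y).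

(* D^(l) phi (x) as an l-linear map of the tuple [h]:
   D^(l+1) phi (x) (h_0, ..., h_l) = (D^(l) (D phi) (x) (h_1, ..., h_l)) (h_0),
   with D phi : X -> L(X, Y), that is, under the isometric identification of
   L^l(X, L(X, Y)) with L^(l+1)(X, Y). *)
Fixpoint iter_fderiv (l : nat) :
    forall Y : normedModType K, (X -> Y) -> X -> l.-tuple X -> Y :=
  match l with
  | 0 => fun Y phi x _ => phi x
  | l'.+1 => fun Y phi x h =>
      (iter_fderiv (fderiv phi) x (behead_tuple h) : bounded_linear X Y)
        (thead h)
  end.

Fixpoint FCn (U : set X) (n : nat) :
    forall Y : normedModType K, (X -> Y) -> Prop :=
  match n with
  | 0 => fun Y phi => {within U, continuous phi}
  | m.+1 => fun Y phi =>
      (forall x, U x -> differentiable phi x) /\ FCn U m (fderiv phi)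
  end.

(* [None] is the order infinity. *)
Definition le_order (l : nat) (k : option nat) : bool :=
  if k is Some m then (l <= m)%N else true.

Definition FC (U : set X) (k : option nat)
    (Y : normedModType K) (phi : X -> Y) : Prop :=
  forall l, le_order l k -> FCn U l phi.

Definition opnorm (Y : normedModType K) (l : nat) (A : l.-tuple X -> Y) :
    \bar R :=
  ereal_sup [set (nrm (A h))%:E
            | h in [set h : l.-tuple X | forall i, nrm (tnth h i) <= 1]].

(* Maps on a subset U of X (and weights on U) are total functions on X of which
   only the values on U are used; U is open below, so derivatives on U do not
   depend on the values off U either. In \bar R, 0 * +oo = 0. *)
Definition wnorm (U : set X) (f : X -> \bar R) (l : nat)
    (Y : normedModType K) (phi : X -> Y) : \bar R :=
  ereal_sup [set (`|f x| * opnorm (iter_fderiv phi x : l.-tuple X -> Y))%E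
            | x in U].

Definition weighted (U : set X) (W : set (X -> \bar R)) (k : option nat)
    (Y : normedModType K) (phi : X -> Y) : Prop :=
  FC U k phi /\
  forall f, W f -> forall l, le_order l k -> (wnorm U f l phi < +oo)%E.

Lemma fderivE (Y : normedModType K) (phi : X -> Y) x :
  differentiable phi x -> fderiv phi x = 'd phi x :> (X -> Y).
Proof.
move=> dphi; rewrite /fderiv val_insubd ifT//.
by apply/asboolP; split; [exact: linearP|exact: diff_continuous].
Qed.

Lemma near_eq_diff (Y : normedModType K) (f g : X -> Y) x :
  {near x, f =1 g} -> differentiable f x ->
  differentiable g x /\ 'd g x = 'd f x :> (X -> Y).
Proof.
move=> fg df.
have fgx : f x = g x := nbhs_singleton fg.
have cdf : continuous ('d f x) by exact: diff_continuous.
have gE : g \o shift x = cst (g x) + 'd f x +o_ 0 id.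
  apply/eqaddoP => e e0.
  have /diff_locally/eqaddoP/(_ e e0) := df.
  have fg0 : \forall h \near (0 : X), f (h + x) = g (h + x).
    by move: fg; rewrite (near_shift 0) subr0.
  apply: filterS2 fg0 => h /= fgh; rewrite !fctE/= fgh fgx; exact: id.
have dgE := diff_unique cdf gE.
split; last exact: dgE.
by apply/diff_locallyP; rewrite dgE; split; [exact: cdf|exact: gE].
Qed.

Lemma fderiv_lin (Y : normedModType K) (U : set X) (a : K)
    (f g u : X -> Y) : open U ->
  (forall x, U x -> u x = a *: f x + g x) ->
  forall x, U x -> differentiable f x -> differentiable g x ->
  differentiable u x /\ fderiv u x = a *: fderiv f x + fderiv g x.
Proof.
move=> oU uE x Ux df dg.
have dZ := differentiableZ a df; have dD := differentiableD dZ dg.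
have [du duE] : differentiable u x /\ 'd u x = 'd (a *: f + g) x :> (X -> Y).
  apply: (near_eq_diff _ dD).
  by apply: filterS (open_nbhs_nbhs (conj oU Ux)) => y Uy; rewrite uE.
split=> //; apply: blfun_inj => h.
rewrite (fderivE du) duE (diffD dZ dg) (diffZ a df) /=.
by rewrite -(fderivE df) -(fderivE dg).
Qed.

Lemma FCn_lin (U : set X) (a : K) l (Y : normedModType K) (f g u : X -> Y) :
  open U -> (forall x, U x -> u x = a *: f x + g x) ->
  FCn U l f -> FCn U l g -> FCn U l u.
Proof.
move=> oU; elim: l Y f g u => [|l IHl] Y f g u uE /=.
  rewrite !continuous_open_subspace// => cf cg x /[!inE] Ux.
  apply: (@cvg_trans _ ((a *: f + g) @ x)).
    apply: near_eq_cvg.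
    by apply: filterS (open_nbhs_nbhs (conj oU Ux)) => y Uy; rewrite uE.
  rewrite uE//; apply: cvgD; last by apply: cg; rewrite inE.
  by apply: cvgZr; apply: cf; rewrite inE.
move=> [df cf] [dg cg]; have duE := fderiv_lin oU uE.
split=> [x Ux|]; first by have [] := duE x Ux (df x Ux) (dg x Ux).
apply: IHl cf cg => x Ux.
by have [] := duE x Ux (df x Ux) (dg x Ux).
Qed.

Lemma iter_fderiv_lin (U : set X) (a : K) l (Y : normedModType K)
    (f g u : X -> Y) :
  open U -> (forall x, U x -> u x = a *: f x + g x) ->
  FCn U l f -> FCn U l g ->
  forall x, U x -> forall h : l.-tuple X,
    iter_fderiv u x h = a *: iter_fderiv f x h + iter_fderiv g x h.
Proof.
move=> oU; elim: l Y f g u => [|l IHl] Y f g u uE /=.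
  by move=> _ _ x Ux _; exact: uE.
move=> [df cf] [dg cg] x Ux h; have duE := fderiv_lin oU uE.
rewrite -blfunZ -blfunD.
apply: (congr1 (fun A : bounded_linear X Y => A (thead h))).
apply: IHl cf cg x Ux (behead_tuple h) => y Uy.
by have [] := duE y Uy (df y Uy) (dg y Uy).
Qed.

Lemma opnorm_ge0 (Y : normedModType K) (l : nat) (A : l.-tuple X -> Y) :
  (0 <= opnorm A)%E.
Proof.
apply: (@le_trans _ _ (nrm (A [tuple of nseq l 0]))%:E).
  by rewrite lee_fin nrm_ge0.
apply: ereal_sup_ubound; exists [tuple of nseq l 0] => //= i.
by rewrite tnth_nseq nrm0.
Qed.

Lemma wnorm_lin (U : set X) (f : X -> \bar R) (a : K) l (Y : normedModType K)
    (phi psi u : X -> Y) :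
  open U -> (forall x, U x -> u x = a *: phi x + psi x) ->
  FCn U l phi -> FCn U l psi ->
  (wnorm U f l u <=
    (sreal `|a|)%:E * wnorm U f l phi + wnorm U f l psi)%E.
Proof.
move=> oU uE cphi cpsi; apply: ge_ereal_sup => _ [x Ux <-].
have a0 := sreal_norm_ge0 a.
apply: (@le_trans _ _ ((sreal `|a|)%:E *
  (`|f x| * opnorm (iter_fderiv phi x : l.-tuple X -> Y)) +
  `|f x| * opnorm (iter_fderiv psi x : l.-tuple X -> Y))%E); last first.
  apply: leeD.
    by apply: lee_wpmul2l; rewrite ?lee_fin//; apply: ereal_sup_ubound; exists x.
  by apply: ereal_sup_ubound; exists x.
rewrite muleCA -ge0_muleDr ?mule_ge0 ?opnorm_ge0 ?lee_fin//.
apply: lee_wpmul2l => //; apply: ge_ereal_sup => _ [h h1 <-].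
rewrite (iter_fderiv_lin oU uE cphi cpsi Ux).
apply: (@le_trans _ _ (sreal `|a| * nrm (iter_fderiv phi x h) +
    nrm (iter_fderiv psi x h))%:E).
  by rewrite lee_fin -nrmZ nrmD.
rewrite EFinD EFinM; apply: leeD.
  by apply: lee_wpmul2l; rewrite ?lee_fin//; apply: ereal_sup_ubound; exists h.
by apply: ereal_sup_ubound; exists h.
Qed.

Lemma wnorm_ge0 (U : set X) (f : X -> \bar R) l (Y : normedModType K)
    (phi : X -> Y) : U !=set0 -> (0 <= wnorm U f l phi)%E.
Proof.
move=> [x Ux].
apply: (@le_trans _ _
    (`|f x| * opnorm (iter_fderiv phi x : l.-tuple X -> Y))%E).
  by rewrite mule_ge0 ?opnorm_ge0.
by apply: ereal_sup_ubound; exists x.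
Qed.

Lemma fderiv0 (Y : normedModType K) : fderiv (cst (0 : Y)) = cst (0 : bounded_linear X Y).
Proof.
by apply/funext => x; apply: blfun_inj => h; rewrite fderivE// diff_cst.
Qed.

Lemma FCn0 (U : set X) l (Y : normedModType K) : FCn U l (cst (0 : Y)).
Proof.
elim: l Y => [|l IHl] Y /=; first exact/continuous_subspaceT/cst_continuous.
by split=> [x _|]; [exact: differentiable_cst|rewrite fderiv0].
Qed.

Lemma iter_fderiv0 l (Y : normedModType K) x (h : l.-tuple X) :
  iter_fderiv (cst (0 : Y)) x h = 0.
Proof. by elim: l Y h => [//|l IHl] Y h /=; rewrite fderiv0 IHl. Qed.

Lemma wnorm0 (U : set X) (f : X -> \bar R) l (Y : normedModType K) :
  (wnorm U f l (cst (0 : Y)%R) <= 0)%E.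
Proof.
apply: ge_ereal_sup => _ [x Ux <-].
suff -> : opnorm (iter_fderiv (cst (0 : Y)) x : l.-tuple X -> Y) = 0%E.
  by rewrite mule0.
apply/le_anti; rewrite opnorm_ge0 andbT.
by apply: ge_ereal_sup => _ [h _ <-]; rewrite iter_fderiv0 nrm0.
Qed.

End FrechetDerivatives.

Record open_domain (T : topologicalType) := OpenDomain {
  dom :> set T;
  dom_open : open dom;
  dom_neq0 : dom !=set0 }.

Section SeminormTopology.
Variables (R : realType) (K : scalarField R) (E : lmodType K).
Variables (J : Type) (q : J -> E -> R).
Hypothesis q_ge0 : forall j x, 0 <= q j x.
Hypothesis q0 : forall j, q j 0 = 0.
Hypothesis q_lin : forall j a x y, q j (a *: x + y) <= sreal `|a| * q j x + q j y.

Definition sball (x : E) (js : seq J) (e : R) : set E :=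
  [set y | forall j, List.In j js -> q j (y - x) < e].

(* The neighbourhoods of [x] for the topology defined by the seminorms q j:
   they contain a ball for finitely many of them. *)
Definition snbhs (x : E) : set_system E :=
  [set A | exists js e, 0 < e /\ sball x js e `<=` A].

Let sreal1 : sreal `|1 : K| = 1.
Proof. by rewrite normr1 -ofreal1 ofrealK. Qed.

Lemma snorm_leD j x y : q j (x + y) <= q j x + q j y.
Proof. by have := q_lin j 1 x y; rewrite scale1r sreal1 mul1r. Qed.

Lemma snorm_leZ j a x : q j (a *: x) <= sreal `|a| * q j x.
Proof. by have := q_lin j a x 0; rewrite q0 !addr0. Qed.

Lemma snorm_dist j x y z : q j (x - z) <= q j (x - y) + q j (y - z).
Proof. by rewrite (le_trans _ (snorm_leD _ _ _))// addrA subrK. Qed.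

Lemma sball_center x js e : 0 < e -> sball x js e x.
Proof. by move=> e0 j _; rewrite subrr q0. Qed.

Lemma sball_nbhs x js e : 0 < e -> snbhs x (sball x js e).
Proof. by move=> e0; exists js, e; split. Qed.

Lemma sball_open x js e y : sball x js e y -> snbhs y (sball x js e).
Proof.
move=> xy.
suff [d [d0 dxy]] : exists d, 0 < d /\
    forall j, List.In j js -> q j (y - x) + d <= e.
  exists js, d; split=> // z yz j jjs.
  rewrite (le_lt_trans (snorm_dist j z y x))// addrC.
  by rewrite (lt_le_trans _ (dxy j jjs))// ltrD2l yz.
elim: js xy => [|j js IHjs] xy; first by exists 1.
have [|d [d0 dxy]] := IHjs; first by move=> i ijs; apply: xy; right.
have jxy : q j (y - x) < e by apply: xy; left.
exists (Num.min d (e - q j (y - x))); split.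
  by rewrite lt_min d0 subr_gt0.
move=> i [<-|ijs]; first by rewrite -lerBrDl ge_min lexx orbT.
by rewrite (le_trans _ (dxy i ijs))// lerD2l ge_min lexx.
Qed.

Lemma snbhs_filter x : ProperFilter (snbhs x).
Proof.
split; last split.
- by move=> [js [e [e0 /(_ x)]]]; apply; exact: sball_center.
- by exists [::], 1; split=> // ?.
- move=> A B [js [e [e0 eA]]] [js' [e' [e'0 eB]]].
  exists (js ++ js'), (Num.min e e'); split; first by rewrite lt_min e0.
  move=> y xy; split; [apply: eA|apply: eB] => j jjs.
    rewrite (lt_le_trans (xy j _)) ?ge_min ?lexx//.
    by apply/List.in_or_app; left.
  rewrite (lt_le_trans (xy j _)) ?ge_min ?lexx ?orbT//.
  by apply/List.in_or_app; right.
- by move=> A B AB [js [e [e0 eA]]]; exists js, e; split=> // y /eA /AB.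
Qed.

Lemma snbhs_singleton x (A : set E) : snbhs x A -> A x.
Proof. by move=> [js [e [e0]]]; apply; exact: sball_center. Qed.

Lemma snbhs_nbhs x (A : set E) : snbhs x A -> snbhs x (snbhs^~ A).
Proof.
move=> [js [e [e0 eA]]]; exists js, e; split=> // y /sball_open.
by move=> [js' [e' [e'0 e'A]]]; exists js', e'; split=> // z /e'A /eA.
Qed.

Lemma snbhs_add (x y : E) (A : set E) : snbhs (x + y) A ->
  exists B C, [/\ snbhs x B, snbhs y C &
    forall x' y', B x' -> C y' -> A (x' + y')].
Proof.
move=> [js [e [e0 eA]]].
have e20 : 0 < e / 2 by rewrite divr_gt0.
exists (sball x js (e / 2)), (sball y js (e / 2)).
split; [exact: sball_nbhs|exact: sball_nbhs|].
move=> x' y' xx' yy'; apply: eA => j jjs.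
rewrite opprD addrACA (le_lt_trans (snorm_leD _ _ _))//.
by rewrite [ltRHS]splitr ltrD ?xx' ?yy'.
Qed.

Lemma snorm_bound (x : E) (js : seq J) :
  exists Q, 0 < Q /\ forall j, List.In j js -> q j x <= Q.
Proof.
elim: js => [|j js [Q [Q0 xQ]]]; first by exists 1.
exists (Q + q j x); split; first by rewrite ltr_wpDr.
by move=> i [<-|/xQ]; [rewrite lerDr ltW|move=> /le_trans; apply; rewrite lerDl].
Qed.

Lemma snbhs_scale (a : K) (x : E) (A : set E) : snbhs (a *: x) A ->
  exists d B, [/\ 0 < d, snbhs x B &
    forall (b : K) y, sreal `|a - b| < d -> B y -> A (b *: y)].
Proof.
move=> [js [e [e0 eA]]].
have [Q [Q0 xQ]] := snorm_bound x js.
pose M := sreal `|a| + 1.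
have M0 : 0 < M by rewrite ltr_wpDl ?sreal_norm_ge0.
exists (Num.min 1 (e / 2 / Q)), (sball x js (e / 2 / M)); split.
- by rewrite lt_min ltr01 !divr_gt0.
- by apply: sball_nbhs; rewrite !divr_gt0.
move=> b y; rewrite lt_min => /andP[ab1 abe] xy; apply: eA => j jjs.
have -> : b *: y - a *: x = b *: (y - x) + (b - a) *: x.
  by rewrite scalerBr scalerBl addrA subrK.
rewrite (le_lt_trans (snorm_leD _ _ _))// [ltRHS]splitr ler_ltD//.
  rewrite (le_trans (snorm_leZ _ _ _))//.
  apply: (@le_trans _ _ (M * (e / 2 / M))); last by rewrite mulrC divfK ?gt_eqF.
  apply: ler_pM => //; [exact: sreal_norm_ge0| |exact/ltW/xy].
  rewrite /M -(le_ofreal K) ofrealD !srealK// (le_trans (_ : _ <= `|a| + `|a - b|))//.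
    by rewrite -{1}(subKr a b) ler_normB.
  by rewrite lerD2l -[leLHS]srealK// le_ofreal ltW.
rewrite (le_lt_trans (snorm_leZ _ _ _))// distrC.
rewrite (@le_lt_trans _ _ (sreal `|a - b| * Q))//.
  by rewrite ler_wpM2l ?sreal_norm_ge0 ?xQ.
by rewrite -ltr_pdivlMr.
Qed.

Local Open Scope convex_scope.

Lemma sball_convex x js e : convex_set (sball x js e : set (convex_lmodType E)).
Proof.
apply/convex_setW => y z; rewrite !inE => xy xz l l0 l1; rewrite inE => j jjs.
have -> : (y <| l |> z) - x =
    l%:num *: (y - x) + (1 - l%:num) *: (z - x) :> E.
  rewrite /conv/= !scalerBr addrACA -opprD -scalerDl.
  by rewrite (addrC l%:num) subrK scale1r.
have h1 : 0 < sreal l%:num.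
  by rewrite -(lt_ofreal K) ofreal0 srealK// ltW.
have h2 : 0 < sreal (1 - l%:num).
  by rewrite -(lt_ofreal K) ofreal0 srealK ?subr_gt0// subr_ge0 ltW.
have h : sreal l%:num + sreal (1 - l%:num) = 1.
  apply: (@ofreal_inj _ K); rewrite ofrealD !srealK ?subr_ge0 ?(ltW l1) ?(ltW l0)//.
  by rewrite addrC subrK ofreal1.
rewrite (le_lt_trans (snorm_leD _ _ _))// -[ltRHS]mul1r -h mulrDl ltrD//.
  rewrite (le_lt_trans (snorm_leZ _ _ _))// ger0_norm ?(ltW l0)// ltr_pM2l//.
  exact: xy.
rewrite (le_lt_trans (snorm_leZ _ _ _))// ger0_norm ?subr_ge0 ?(ltW l1)//.
by rewrite ltr_pM2l//; exact: xz.
Qed.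

End SeminormTopology.

Section WeightedProduct.
Variables (R : realType) (K : scalarField R) (I : Type).
Variable X : I -> normedModType K.

(* A function on the disjoint union of the U i is an i-indexed family. *)
Definition wpnorm (Y : I -> normedModType K) (U : forall i, set (X i))
    (f : forall i, X i -> \bar R) (l : nat) (phi : forall i, X i -> Y i) :
    \bar R :=
  ereal_sup [set wnorm (U i) (f i) l (phi i) | i in [set: I]].

(* An alias carrying the pointwise vector space structure. *)
Definition map_family (Y : I -> normedModType K) := forall i, X i -> Y i.

Section MapFamily.
Variable Y : I -> normedModType K.
Local Notation F := (map_family Y).

HB.instance Definition _ := gen_eqMixin F.
HB.instance Definition _ := gen_choiceMixin F.

Let add (f g : F) : F := fun i x => f i x + g i x.
Let zero : F := fun i x => 0.
Let opp (f : F) : F := fun i x => - f i x.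
Let scale (a : K) (f : F) : F := fun i x => a *: f i x.

Let eqF (f g : F) : (forall i x, f i x = g i x) -> f = g.
Proof. by move=> fg; apply: functional_extensionality_dep => i; apply/funext. Qed.

Let addA : associative add.
Proof. by move=> f g h; apply: eqF => i x; exact: addrA. Qed.
Let addC : commutative add.
Proof. by move=> f g; apply: eqF => i x; exact: addrC. Qed.
Let add0 : left_id zero add.
Proof. by move=> f; apply: eqF => i x; exact: add0r. Qed.
Let addN : left_inverse zero opp add.
Proof. by move=> f; apply: eqF => i x; exact: addNr. Qed.

HB.instance Definition _ := GRing.isZmodule.Build F addA addC add0 addN.

Let scaleA a b (f : F) : scale a (scale b f) = scale (a * b) f.
Proof. by apply: eqF => i x; exact: scalerA. Qed.
Let scale1 : left_id 1 scale.
Proof. by move=> f; apply: eqF => i x; exact: scale1r. Qed.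
Let scaleDr : right_distributive scale +%R.
Proof. by move=> a f g; apply: eqF => i x; exact: scalerDr. Qed.
Let scaleDl (f : F) : {morph scale^~ f : a b / a + b}.
Proof. by move=> a b; apply: eqF => i x; exact: scalerDl. Qed.

HB.instance Definition _ :=
  GRing.Zmodule_isLmodule.Build K F scaleA scale1 scaleDr scaleDl.

End MapFamily.

Variable U : forall i, open_domain (X i).
Variable W : set (forall i, X i -> \bar R).
Variable k : option nat.
Variable Y : I -> normedModType K.

Definition in_wprod (phi : forall i, X i -> Y i) : Prop :=
  (forall i, weighted (U i) [set f i | f in W] k (phi i)) /\
  forall f, W f -> forall l, le_order l k -> (wpnorm U f l phi < +oo)%E.

Definition wprod_pred : {pred map_family Y} :=
  fun phi => `[< in_wprod phi /\ forall i x, ~ dom (U i) x -> phi i x = 0 >].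

(* The points of the weighted restricted product: families of maps on the U i,
   each map being represented by its extension by 0 to X i, which makes the
   representation unique. *)
Record wprod := WProd {
  wfun :> forall i, X i -> Y i;
  _ : (wfun : map_family Y) \in wprod_pred }.

HB.instance Definition _ := [isSub of wprod for (wfun : wprod -> map_family Y)].
HB.instance Definition _ := [Choice of wprod by <:].

Let wpnorm_lin (f : forall i, X i -> \bar R) (a : K) l (phi psi : map_family Y) :
  (forall i, FCn (U i) l (phi i)) -> (forall i, FCn (U i) l (psi i)) ->
  (wpnorm U f l (a *: phi + psi)%R <=
    (sreal `|a|)%:E * wpnorm U f l phi + wpnorm U f l psi)%E.
Proof.
move=> cphi cpsi; apply: ge_ereal_sup => _ [i _ <-].
apply: (le_trans (wnorm_lin (f i) (dom_open (U i)) (fun _ _ => erefl)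
  (cphi i) (cpsi i))).
apply: leeD; last by apply: ereal_sup_ubound; exists i.
apply: lee_wpmul2l; first by rewrite lee_fin sreal_norm_ge0.
by apply: ereal_sup_ubound; exists i.
Qed.

Lemma wprod_submod : submod_closed wprod_pred.
Proof.
have fin (b : K) (x y : \bar R) :
    (x < +oo -> y < +oo -> (sreal `|b|)%:E * x + y < +oo)%E.
  move=> xoo yoo; apply: lte_add_pinfty => //.
  case: x xoo => [r| |]//= _; first by rewrite -EFinM ltry.
  have := sreal_norm_ge0 b; rewrite le_eqVlt => /predU1P[<-|b0].
    by rewrite mul0e.
  by rewrite gt0_muleNy.
split.
  apply/asboolP; split=> //; split.
    move=> i; split; first by move=> l _; exact: FCn0.
    by move=> f _ l _; exact: le_lt_trans (wnorm0 _ _ _ _) (ltry _).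
  move=> f _ l _; apply: (@le_lt_trans _ _ 0%E) => //.
  by apply: ge_ereal_sup => _ [i _ <-]; exact: wnorm0.
move=> a phi psi /asboolP[[cphi nphi] sphi] /asboolP[[cpsi npsi] spsi].
apply/asboolP; split; last first.
  by move=> i x Uix; rewrite /= -[LHS]/(a *: phi i x + psi i x) sphi// spsi//
    scaler0 addr0.
split=> [i|f Wf l lk].
  have [fphi wphi] := cphi i; have [fpsi wpsi] := cpsi i.
  split=> [l lk|f Wf l lk].
    exact: (FCn_lin (dom_open (U i)) (fun _ _ => erefl) (fphi l lk) (fpsi l lk)).
  apply: (le_lt_trans (wnorm_lin f (dom_open (U i)) (fun _ _ => erefl)
    (fphi l lk) (fpsi l lk))).
  by apply: fin; [exact: wphi|exact: wpsi].
apply: le_lt_trans.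
  by apply: wpnorm_lin => i; [exact: (cphi i).1|exact: (cpsi i).1].
by apply: fin; [exact: nphi|exact: npsi].
Qed.

HB.instance Definition _ :=
  GRing.isSubmodClosed.Build K (map_family Y) wprod_pred
    (GRing.submod_closed_semi wprod_submod).
HB.instance Definition _ := [SubChoice_isSubLmodule of wprod by <:].

Definition wprod_index : Type :=
  {fl : (forall i, X i -> \bar R) * nat | W fl.1 /\ le_order fl.2 k}.

Definition wprod_seminorm (j : wprod_index) (phi : wprod) : R :=
  fine (wpnorm U (sval j).1 (sval j).2 phi).

Lemma wprodP (phi : wprod) : in_wprod phi.
Proof. by case: phi => phi /= /asboolP[]. Qed.

Lemma wprod_out (phi : wprod) i x : ~ dom (U i) x -> phi i x = 0.
Proof. by case: phi => phi /= /asboolP[_]; exact. Qed.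

Let wpnorm_cases : (forall f l (phi : wprod), 0 <= wpnorm U f l phi)%E \/
  (forall f l (phi : wprod), wpnorm U f l phi = -oo%E).
Proof.
have [[i0]|nI] := pselect (inhabited I).
  left=> f l phi.
  apply: (le_trans (wnorm_ge0 (f i0) l (phi i0) (dom_neq0 (U i0)))).
  by apply: ereal_sup_ubound; exists i0.
right=> f l phi.
rewrite /wpnorm (_ : [set _ | _ in _] = set0) ?ereal_sup0//.
by rewrite -subset0 => y [i _ _]; exact: (nI (inhabits i)).
Qed.

Let wpnorm_lty (j : wprod_index) (phi : wprod) :
  (wpnorm U (sval j).1 (sval j).2 phi < +oo)%E.
Proof. by case: j => -[f l] /= [Wf lk]; have [_] := wprodP phi; exact. Qed.

Lemma wprod_seminorm_ge0 j phi : 0 <= wprod_seminorm j phi.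
Proof.
rewrite /wprod_seminorm; have [p|->//] := wpnorm_cases.
by rewrite fine_ge0.
Qed.

Lemma wprod_seminorm0 j : wprod_seminorm j 0 = 0.
Proof.
rewrite /wprod_seminorm; have [p|->//] := wpnorm_cases.
suff -> : (wpnorm U (sval j).1 (sval j).2 (0%R : wprod) = 0)%E by [].
apply/le_anti; rewrite p andbT.
by apply: ge_ereal_sup => _ [i _ <-]; exact: wnorm0.
Qed.

Lemma wprod_seminorm_lin j (a : K) (phi psi : wprod) :
  wprod_seminorm j (a *: phi + psi) <=
  sreal `|a| * wprod_seminorm j phi + wprod_seminorm j psi.
Proof.
rewrite /wprod_seminorm; have [p|p] := wpnorm_cases; last first.
  by rewrite !p /= mulr0 addr0.
have fn x : wpnorm U (sval j).1 (sval j).2 (wfun x) \is a fin_num.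
  by rewrite ge0_fin_numE ?wpnorm_lty.
rewrite -lee_fin EFinD EFinM !fineK ?fn//.
apply: wpnorm_lin => i.
  by apply: ((wprodP phi).1 i).1; have [] := svalP j.
by apply: ((wprodP psi).1 i).1; have [] := svalP j.
Qed.

HB.instance Definition _ := hasNbhs.Build wprod (snbhs wprod_seminorm).
HB.instance Definition _ := Nbhs_isNbhsTopological.Build wprod
  (snbhs_filter wprod_seminorm0)
  (@snbhs_singleton _ _ _ _ _ wprod_seminorm0)
  (@snbhs_nbhs _ _ _ _ _ wprod_seminorm_lin).

Let wprod_add_continuous : continuous (fun x : wprod * wprod => x.1 + x.2).
Proof.
move=> [x y] A /= /(snbhs_add wprod_seminorm_lin)[B [C [xB yC BC]]].
by exists (B, C) => // -[x' y'] [/= Bx' Cy']; exact: BC.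
Qed.

Let wprod_scale_continuous : continuous (fun z : K^o * wprod => z.1 *: z.2).
Proof.
move=> [a x] A /=.
move=> /(snbhs_scale wprod_seminorm_ge0 wprod_seminorm0 wprod_seminorm_lin)[d [B [d0 xB dB]]].
have od0 : 0 < ofreal K d by rewrite -(ofreal0 K) lt_ofreal.
exists (ball (a : K^o) (ofreal K d), B); first by split=> //; exact: nbhsx_ballx.
move=> [b y] [/= ab By]; apply: dB => //.
by rewrite -(lt_ofreal K) srealK.
Qed.

Let wprod_locally_convex : exists2 B : set_system wprod,
  (forall b, b \in B -> convex_set b) & basis B.
Proof.
exists [set b | exists x js e, b = sball wprod_seminorm x js e].
  by move=> b; rewrite inE => -[x [js [e ->]]]; apply: sball_convex;
     [exact: wprod_seminorm0|exact: wprod_seminorm_lin].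
split.
  move=> b [x [js [e ->]]]; rewrite openE => y; rewrite /interior => xy.
  by apply: sball_open => //; exact: wprod_seminorm_lin.
move=> x A [js [e [e0 eA]]]; exists (sball wprod_seminorm x js e) => //=.
split; first by exists x, js, e.
by apply: sball_center => //; exact: wprod_seminorm0.
Qed.

(* This factory only declares the uniform structure. *)
HB.instance Definition _ := PreTopologicalLmod_isTvs.Build K wprod
  wprod_add_continuous wprod_scale_continuous wprod_locally_convex.
HB.instance Definition _ :=
  PreTopologicalNmodule_isTopologicalNmodule.Build wprod wprod_add_continuous.
HB.instance Definition _ :=
  TopologicalNmodule_isTopologicalLmodule.Build K wprod wprod_scale_continuous.
HB.instance Definition _ := Uniform_isTvs.Build K wprod wprod_locally_convex.

End WeightedProduct.

Section Differentiability.
Variables (R : realType) (K : scalarField R).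

(* Off O the values of f are irrelevant, since O is open in [smooth_on]. *)
Fixpoint Cn_on (n : nat) : forall E F : tvsType K, set E -> (E -> F) -> Prop :=
  match n with
  | 0 => fun E F O f => {within O, continuous f}
  | m.+1 => fun E F O f => exists df : E * E -> F,
      [/\ forall u x, O u ->
            (fun t : K => t^-1 *: (f (u + t *: x) - f u)) @ 0^' --> df (u, x),
          {within O `*` [set: E], continuous df} &
          @Cn_on m (E * E)%type F (O `*` [set: E]) df]
  end.

Definition smooth_on (E F : tvsType K) (O : set E) (f : E -> F) : Prop :=
  open O /\ forall n, Cn_on n O f.

Definition continuous_seminorm (E : tvsType K) (p : E -> \bar R) : Prop :=
  exists q : E -> R,
    [/\ forall x, p x = (q x)%:E,
        forall x y, q (x + y) <= q x + q y,
        forall (a : K) x, q (a *: x) = sreal `|a| * q x &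
        continuous q].

End Differentiability.

Section Weights.
Variables (R : realType) (K : scalarField R) (I : Type).
Variables (X : I -> normedModType K) (U : forall i, open_domain (X i)).

(* Weights have values in R u {+oo}, which \bar R exceeds by -oo. *)
Definition is_weight (f : forall i, X i -> \bar R) : Prop :=
  forall i x, dom (U i) x -> f i x != -oo%E.

Definition Wmax (W : set (forall i, X i -> \bar R)) :
    set (forall i, X i -> \bar R) :=
  [set g | is_weight g /\
    forall E : I -> normedModType K,
      continuous_seminorm
        (fun phi : wprod U W (Some 0%N) E => wpnorm U g 0 phi)].

Variable Y : I -> normedModType K.

Definition star_shaped0 (V : normedModType K) (A : set V) : Prop :=
  A 0 /\ forall y (t : R), A y -> 0 <= t <= 1 -> A (ofreal K t *: y).

Definition boundary_dist (V : normedModType K) (A : set V) : \bar R :=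
  ereal_inf [set (nrm y)%:E | y in closure A `\` interior A].

Definition adjusting_weight (V : forall i, set (Y i))
    (omega : forall i, X i -> R) : Prop :=
  forall i,
    (exists M : R, forall x, dom (U i) x -> `|omega i x| <= M) /\
    (maxe (boundary_dist (V i))^-1 1 <=
      ereal_inf [set (`|omega i x|)%:E | x in dom (U i)])%E.

Definition wprod_boundary (W : set (forall i, X i -> \bar R)) (k : option nat)
    (V : forall i, set (Y i)) (omega : forall i, X i -> R) :
    set (wprod U W k Y) :=
  [set gamma | exists2 r : R, 0 < r &
    forall i x, dom (U i) x -> forall y : Y i,
      nrm y < r / `|omega i x| -> V i (gamma i x + y)].

End Weights.

(* Main.v *)
(* The C^k seminorms of beta_* are reduced to a pointwise estimate in a single
   normed space.  With |phi|_l(x) the sum of the norms of D^j phi (x), j <= l,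
   the chain rule D(F o G) = (DF o G) DG and induction on l give
     |F o G - F o G0|_l(x) <= C * S * (1 + |DG| + |DG0|)^l * |G - G0|_l(x),
   where S bounds the derivatives of F of orders 1, ..., l+1 on the segment from
   G0(x) to G(x); no completeness is needed, as the case l = 0 is the mean value
   inequality.  Likewise, the first-order Taylor remainder in direction H is
   O(t^2) with a factor |H|_l(x); there the symmetry of D^2 F identifies
   D_x (DF(G) H) with the directional derivative of D_x (F o G).  For
   G = (id, gamma) and a weight f the factor |f| S is at most |g| for some g in
   Wmax, and |g| |H|_l is controlled by finitely many seminorms of H; the powers
   are bounded because |omega| >= 1 and omega is a weight.  This yields that
   beta_* is defined (take gamma0 = 0), continuous, and differentiable with
   derivative (gamma, eta) |-> (d_2 beta)_* (gamma, eta).  The symbol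
   (x, (y, y1)) |-> D beta (x, y) (0, y1) on U x (V x Y) satisfies the same
   hypotheses on bounded sets, so smoothness follows by induction. *)

(* A weight g in [Wmax] controls only values, by finitely many weights of W, though for maps into
   arbitrary normed spaces. Derivatives of H are reached by applying this to DH, whose target is
   again a normed space. Since |g| can be paired with one such factor only, each estimate is linear
   in the jet at x of a single map, H or G - G0, and every other factor is bounded outright by a
   constant rho. In the Taylor remainder one of the two factors H is therefore given up to rho.

   Where |g_i(x)| is infinite there is no bound S. There the finiteness of the seminorms makes the
   jet of H vanish at x, the segment shrinks to a point, and any S will do.

   The derivative of the operator lives on E x E, the next one on the fourfold product, and so on.
   The induction therefore allows any parameter space E that maps linearly and continuously into
   families of maps, so that these products need not be identified with weighted products. *)
Require Import Defs.
From mathcomp Require Import all_boot all_order all_algebra.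
From mathcomp Require Import ring.
From mathcomp Require Import all_classical all_reals all_analysis.

Import Order.TTheory GRing.Theory Num.Theory.
Import numFieldNormedType.Exports.

Set Implicit Arguments.
Unset Strict Implicit.
Unset Printing Implicit Defensive.

Local Open Scope classical_set_scope.
Local Open Scope ring_scope.

(** * Norms and Frechet derivatives *)

Section Norms.
Variables (R : realType) (K : scalarField R).

Lemma sreal_norm_ofreal (s : R) : 0 <= s -> sreal `|ofreal K s| = s.
Proof. by move=> s0; rewrite ger0_norm ?ofrealK// -(ofreal0 K) le_ofreal. Qed.

Lemma nrmN (V : normedModType K) (x : V) : nrm (- x) = nrm x.
Proof. by rewrite /nrm normrN. Qed.

Lemma nrmB (V : normedModType K) (x y : V) : nrm (x - y) <= nrm x + nrm y.
Proof. by rewrite -(nrmN y) nrmD. Qed.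

Lemma nrm_distC (V : normedModType K) (x y : V) : nrm (x - y) = nrm (y - x).
Proof. by rewrite -nrmN opprB. Qed.

Lemma nrm_pair (V1 V2 : normedModType K) (x : V1) (y : V2) :
  nrm ((x, y) : (V1 * V2)%type) = Num.max (nrm x) (nrm y).
Proof.
rewrite /nrm prod_normE /= !normE.
have [xy|yx] := leP (nrm x) (nrm y).
  by rewrite max_r ?le_ofreal// !ofrealK max_r.
by rewrite max_l ?le_ofreal ?(ltW yx)// !ofrealK max_l// ltW.
Qed.

Lemma near0P (V : normedModType K) (P : V -> Prop) :
  (\forall h \near (0 : V), P h) <->
  exists2 d : R, 0 < d & forall h, nrm h < d -> P h.
Proof.
split.
  move=> /nbhs_norm0P [d /= d0 dP]; exists (sreal d).
    by rewrite -(lt_ofreal K) ofreal0 srealK// ltW.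
  move=> h hd; apply: dP => /=.
  by rewrite normE -[ltRHS]srealK ?(ltW d0)// lt_ofreal.
move=> [d d0 dP]; apply/nbhs_norm0P; exists (ofreal K d) => /=.
  by rewrite -(ofreal0 K) lt_ofreal.
by move=> h /=; rewrite normE lt_ofreal; exact: dP.
Qed.

Lemma nearP_nrm (V : normedModType K) (x : V) (P : V -> Prop) :
  (\forall y \near x, P y) <->
  exists2 d : R, 0 < d & forall h, nrm h < d -> P (x + h).
Proof.
rewrite (near_shift 0) subr0.
split=> [/near0P[d d0 dP]|[d d0 dP]].
  by exists d => // h /dP /=; rewrite addrC.
by apply/near0P; exists d => // h /dP /=; rewrite addrC.
Qed.

End Norms.

Section Frechet.
Variables (R : realType) (K : scalarField R).

(** The norms of the spaces lie in K; with [nrm] every estimate of a remainder is an inequality of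
    real numbers. *)
Definition has_fderiv (X Y : normedModType K) (f : X -> Y) (x : X)
    (L : bounded_linear X Y) :=
  forall e : R, 0 < e -> exists2 d : R, 0 < d &
    forall h, nrm h < d -> nrm (f (x + h) - f x - L h) <= e * nrm h.

Lemma has_fderivP (X Y : normedModType K) (f : X -> Y) x L :
  has_fderiv f x L <-> differentiable f x /\ fderiv f x = L.
Proof.
split=> [H|[df <-] e e0].
  have [lL cL] := blfunP L.
  pose L' : {linear X -> Y} := L.
  have fE : f \o shift x = cst (f x) + L' +o_ 0 id.
    apply/eqaddoP => e e0.
    have e'0 : 0 < sreal e by rewrite -(lt_ofreal K) ofreal0 srealK// ltW.
    have [d d0 dP] := H _ e'0.
    apply/near0P; exists d => // h /dP.
    rewrite -(le_ofreal K) ofrealM srealK ?(ltW e0)// -!normE !fctE/=.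
    by rewrite (addrC h x) opprD addrA.
  have dgE := diff_unique (cL : continuous L') fE.
  have df : differentiable f x.
    by apply/diff_locallyP; rewrite dgE; split; [exact: cL|exact: fE].
  split=> //; apply: blfun_inj => h; rewrite fderivE// dgE.
  by [].
have e'0 : 0 < ofreal K e by rewrite -(ofreal0 K) lt_ofreal.
have /diff_locally/eqaddoP/(_ _ e'0)/near0P[d d0 dP] := df.
exists d => // h /dP; rewrite !fctE/= !normE -ofrealM le_ofreal fderivE//.
by rewrite (addrC h x) opprD addrA.
Qed.

Lemma differentiable_has_fderiv (X Y : normedModType K) (f : X -> Y) x :
  differentiable f x -> has_fderiv f x (fderiv f x).
Proof. by move=> df; apply/has_fderivP. Qed.

Lemma nrm_blfun_le (X Y : normedModType K) (A : bounded_linear X Y) x :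
  nrm (A x) <= nrm A * nrm x.
Proof. by rewrite nrm_blnorm blnorm_le. Qed.

Lemma nrm_le_bound (X Y : normedModType K) (A : bounded_linear X Y) (M : R) :
  0 <= M -> (forall x, nrm (A x) <= M * nrm x) -> nrm A <= M.
Proof.
move=> M0 AM; rewrite nrm_blnorm; apply: blnorm_leP => x x1.
by rewrite (le_trans (AM x))// ler_piMr.
Qed.

Definition mkbl (X Y : normedModType K) (f : X -> Y) : bounded_linear X Y :=
  insubd (0 : bounded_linear X Y) f.

Lemma mkblE (X Y : normedModType K) (f : X -> Y) (M : R) : linear f ->
  (forall x, nrm (f x) <= M * nrm x) -> mkbl f = f :> (X -> Y).
Proof.
move=> lf fM; rewrite /mkbl val_insubd ifT//; apply/asboolP; split=> // x.
(* M may have any sign; N is positive and can divide the radius. *)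
pose N := `|M| + 1.
have N0 : 0 < N by rewrite ltr_wpDl.
have fN y : nrm (f y) <= N * nrm y.
  rewrite (le_trans (fM y))// ler_wpM2r ?nrm_ge0//.
  by rewrite (le_trans (ler_norm _))// lerDl.
have fB (a b : X) : f (a - b) = f a - f b.
  by rewrite addrC -scaleN1r lf scaleN1r addrC.
apply/cvgrPdist_le => e e0.
have e'0 : 0 < sreal e by rewrite -(lt_ofreal K) ofreal0 srealK// ltW.
apply/nearP_nrm; exists (sreal e / N); first by rewrite divr_gt0.
move=> h hd; rewrite -fB opprD addNKr normE -[leRHS]srealK ?(ltW e0)// le_ofreal.
by rewrite (le_trans (fN _))// nrmN mulrC -ler_pdivlMr// ltW.
Qed.

Lemma blD (X Y : normedModType K) (A : bounded_linear X Y) x y :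
  A (x + y) = A x + A y.
Proof. exact: linearD. Qed.

Lemma blZ (X Y : normedModType K) (A : bounded_linear X Y) a x :
  A (a *: x) = a *: A x.
Proof. exact: linearZ. Qed.

End Frechet.

(** * Mean value inequality *)

Section MeanValue.
Variables (R : realType) (K : scalarField R).

Lemma ofrealN (a : R) : ofreal K (- a) = - ofreal K a.
Proof. by apply: (@addIr _ (ofreal K a)); rewrite -ofrealD !addNr ofreal0. Qed.

Lemma nrmZr (V : normedModType K) (s : R) (x : V) :
  nrm (ofreal K s *: x) = `|s| * nrm x.
Proof.
rewrite nrmZ; congr (_ * _).
have [s0|s0] := leP 0 s; first by rewrite sreal_norm_ofreal// ger0_norm.
by rewrite -normrN -ofrealN sreal_norm_ofreal ?oppr_ge0 ?ltW// ltr0_norm.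
Qed.

(** Continuous induction: the times t at which psi has moved by at most (M + e) t have a supremum,
    which is attained and could be exceeded if it were below 1. *)
Lemma mvt_curve (Z : normedModType K) (psi : R -> Z) (M : R) :
  (forall t, 0 <= t <= 1 -> forall e, 0 < e -> exists2 d, 0 < d &
     forall s, `|s - t| < d -> nrm (psi s - psi t) <= (M + e) * `|s - t|) ->
  nrm (psi 1 - psi 0) <= M.
Proof.
move=> H; apply/ler_addgt0Pr => e e0.
pose S : set R := [set t | 0 <= t <= 1 /\ nrm (psi t - psi 0) <= (M + e) * t].
have S0 : S 0 by rewrite /S /= lexx ler01 subrr nrm0 mulr0.
have uS : ubound S 1 by move=> t [/andP[]].
have hS : has_sup S by split; [exists 0|exists 1].
have c0 : 0 <= sup S by exact: (sup_upper_bound hS).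
have c1 : sup S <= 1 by apply: ge_sup => //; exists 0.
set c := sup S in c0 c1.
have c01 : 0 <= c <= 1 by rewrite c0 c1.
have [d d0 dP] := H c c01 _ e0.
(* Some s in S lies within d to the left of c, and the local bound at c bridges the gap from s to
   c. *)
have Sc : S c.
  have [s Ss cs] := sup_adherent d0 hS.
  have sc : s <= c by exact: (sup_upper_bound hS).
  split=> //; rewrite (_ : psi c - psi 0 = (psi s - psi 0) - (psi s - psi c)).
    have sc' : `|s - c| = c - s by rewrite distrC ger0_norm ?subr_ge0.
    have psc := dP s; rewrite sc' ltrBlDr -ltrBlDl in psc.
    rewrite (le_trans (nrmB _ _))// (le_trans (lerD Ss.2 (psc cs)))//.
    by rewrite -mulrDr (addrC s) subrK.
  by rewrite opprB [RHS]addrC addrA subrK.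
have [c_lt1|c_ge1] := ltP c 1; last first.
  have cE : c = 1 by apply/le_anti/andP.
  by move: Sc.2; rewrite cE mulr1.
(* The same local bound carries the estimate from c to a point s beyond it. *)
pose s := Num.min 1 (c + d / 2).
have cs : c < s by rewrite lt_min c_lt1 ltrDl divr_gt0.
have sd : `|s - c| < d.
  rewrite gtr0_norm ?subr_gt0// ltrBlDl (@le_lt_trans _ _ (c + d / 2))//.
    by rewrite ge_min lexx orbT.
  by rewrite ltrD2l ltr_pdivrMr// ltr_pMr// ltr1n.
suff Ss : S s by have := sup_upper_bound hS Ss; rewrite leNgt cs.
split; first by rewrite (ltW (le_lt_trans c0 cs)) ge_min lexx.
rewrite (_ : psi s - psi 0 = (psi s - psi c) + (psi c - psi 0)); last first.
  by rewrite addrA subrK.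
rewrite (le_trans (nrmD _ _))// -[s in leRHS](subrK c) mulrDr lerD ?Sc.2//.
by rewrite (le_trans (dP _ sd))// gtr0_norm ?subr_gt0.
Qed.

Lemma mvt_segment (X Y : normedModType K) (F : X -> Y)
    (L : R -> bounded_linear X Y) (a v : X) (M : R) :
  (forall t, 0 <= t <= 1 -> has_fderiv F (a + ofreal K t *: v) (L t)) ->
  (forall t, 0 <= t <= 1 -> nrm (L t v) <= M) ->
  nrm (F (a + v) - F a) <= M.
Proof.
move=> FL LM.
have := @mvt_curve Y (fun t => F (a + ofreal K t *: v)) M.
rewrite /= ofreal0 ofreal1 scale0r scale1r addr0; apply => t t01 e e0.
pose N := nrm v + 1.
have N0 : 0 < N by rewrite ltr_wpDl ?nrm_ge0.
have [d d0 dP] := FL t t01 _ (divr_gt0 e0 N0).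
exists (d / N); first by rewrite divr_gt0.
move=> s st.
have sE : a + ofreal K s *: v =
    a + ofreal K t *: v + ofreal K (s - t) *: v.
  by rewrite -addrA -scalerDl -ofrealD (addrC t) subrK.
have hd : nrm (ofreal K (s - t) *: v) < d.
  rewrite nrmZr (@le_lt_trans _ _ (`|s - t| * N))//.
    by rewrite ler_wpM2l// lerDl.
  by rewrite -ltr_pdivlMr.
have := dP _ hd; rewrite -sE linearZ nrmZr => dP'.
rewrite -[X in nrm X](subrK (ofreal K (s - t) *: L t v)).
rewrite (le_trans (nrmD _ _))// mulrDl addrC lerD//.
  by rewrite nrmZr mulrC ler_wpM2r// LM.
rewrite (le_trans dP')// mulrCA [leRHS]mulrC ler_wpM2l//.
by rewrite mulrAC ler_pdivrMr// ler_wpM2l ?(ltW e0)// lerDl.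
Qed.

Lemma has_fderivD (X Y : normedModType K) (f g : X -> Y) x L L' :
  has_fderiv f x L -> has_fderiv g x L' ->
  has_fderiv (fun y => f y + g y) x (L + L').
Proof.
move=> /has_fderivP[df <-] /has_fderivP[dg <-].
have uE y : setT y -> f y + g y = 1 *: f y + g y by rewrite scale1r.
apply/has_fderivP; have := fderiv_lin openT uE (I : setT x) df dg.
by rewrite scale1r.
Qed.

Lemma has_fderivZ (X Y : normedModType K) (f : X -> Y) a x L :
  has_fderiv f x L -> has_fderiv (fun y => a *: f y) x (a *: L).
Proof.
move=> /has_fderivP[df <-]; apply/has_fderivP.
have uE y : setT y -> a *: f y = a *: f y + cst (0 : Y) y by rewrite addr0.
have := fderiv_lin openT uE (I : setT x) df (differentiable_cst (0 : Y) x).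
by rewrite fderiv0 /= addr0.
Qed.

Lemma has_fderivB (X Y : normedModType K) (f g : X -> Y) x L L' :
  has_fderiv f x L -> has_fderiv g x L' ->
  has_fderiv (fun y => f y - g y) x (L - L').
Proof.
move=> fL gL; rewrite -scaleN1r.
rewrite (_ : (fun y => f y - g y) = (fun y => f y + -1 *: g y)); last first.
  by apply/funext => y; rewrite scaleN1r.
exact/has_fderivD/has_fderivZ.
Qed.

Lemma has_fderiv_linear (X Y : normedModType K) (L : bounded_linear X Y) x :
  has_fderiv L x L.
Proof.
move=> e e0; exists 1 => // h _.
by rewrite linearD (addrC (L x)) addrK subrr nrm0 mulr_ge0 ?nrm_ge0 ?ltW.
Qed.

Lemma has_fderiv_shift (X Y : normedModType K) (f : X -> Y) x a L :
  has_fderiv f (x + a) L -> has_fderiv (fun y => f (y + a)) x L.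
Proof.
move=> fL e /fL[d d0 dP]; exists d => // h /dP.
by rewrite (addrAC x).
Qed.

(** The derivative of F - DF(a) is DF(a + t v) - DF(a), which a second mean value inequality bounds
    by M |v|. Applying the inequality twice gives the constant 1 instead of 1/2. *)
Lemma taylor2 (X Y : normedModType K) (F : X -> Y) (a v : X) (M : R) :
  (forall t, 0 <= t <= 1 -> differentiable F (a + ofreal K t *: v)) ->
  (forall t, 0 <= t <= 1 -> differentiable (fderiv F) (a + ofreal K t *: v)) ->
  (forall t, 0 <= t <= 1 -> nrm (fderiv (fderiv F) (a + ofreal K t *: v)) <= M) ->
  nrm (F (a + v) - F a - fderiv F a v) <= M * nrm v ^+ 2.
Proof.
move=> dF ddF FM.
pose L0 := fderiv F a.
rewrite (_ : _ - _ = (F (a + v) - L0 (a + v)) - (F a - L0 a)); last first.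
  rewrite (linearD L0) opprB addrA (addrAC (F (a + v)) _ (L0 a)) opprD addrA.
  by rewrite addrK addrAC.
apply: (@mvt_segment _ _ (fun y => F y - L0 y)
    (fun t => fderiv F (a + ofreal K t *: v) - L0)).
  move=> t t01; apply: has_fderivB; last exact: has_fderiv_linear.
  exact/differentiable_has_fderiv/dF.
move=> t t01; have /andP[t0 t1] := t01.
rewrite (le_trans (nrm_blfun_le _ _))// expr2 mulrA ler_wpM2r ?nrm_ge0//.
have M0 : 0 <= M by rewrite (le_trans (nrm_ge0 _) (FM t t01)).
apply: (@mvt_segment _ _ (fderiv F) (fun s => fderiv (fderiv F)
    (a + ofreal K s *: (ofreal K t *: v)))) => s /andP[s0 s1].
  apply: differentiable_has_fderiv.
  rewrite scalerA -ofrealM; apply: ddF.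
  by rewrite mulr_ge0//= mulr_ile1.
rewrite (le_trans (nrm_blfun_le _ _))// ler_pM ?nrm_ge0//.
  by rewrite scalerA -ofrealM FM// mulr_ge0//= mulr_ile1.
by rewrite nrmZr ger0_norm// ler_piMl ?nrm_ge0.
Qed.

End MeanValue.

(** * Symmetry of the second derivative *)

Section Schwarz.
Variables (R : realType) (K : scalarField R) (X Y : normedModType K).
Variables (F : X -> Y) (a : X) (D2 : bounded_linear X (bounded_linear X Y)).
Hypothesis dF : \forall y \near a, differentiable F y.
Hypothesis ddF : has_fderiv (fderiv F) a D2.

(** The second difference is the increment over s u of y |-> F(y + s v) - F(y). Subtracting the
    linear map D2(s v) makes the derivative of this function o(s), because DF is differentiable at
    a, and the mean value inequality turns this into o(s^2). *)
Let second_difference (u v : X) (e : R) : 0 < e -> exists2 d : R, 0 < d &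
  forall s : R, 0 < s -> s < d ->
  nrm (F (a + ofreal K s *: u + ofreal K s *: v) - F (a + ofreal K s *: u)
       - (F (a + ofreal K s *: v) - F a)
       - ofreal K s *: (D2 (ofreal K s *: v) u)) <= e * s ^+ 2.
Proof.
move=> e0; have /nearP_nrm[d1 d10 dP1] := dF.
(* N is what remains of (s (Nu + Nv) + s Nu) (s Nu) without s^2, plus 1 to be positive. *)
pose Nu := nrm u; pose Nv := nrm v; pose N := (Nu + Nv + Nu) * Nu + 1.
have Nu0 : 0 <= Nu := nrm_ge0 _.
have Nv0 : 0 <= Nv := nrm_ge0 _.
have N0 : 0 < N by rewrite ltr_wpDl// mulr_ge0// !addr_ge0.
have [d2 d20 dP2] := ddF (divr_gt0 e0 N0).
pose d := Num.min d1 d2.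
have d_gt0 : 0 < d by rewrite lt_min d10.
have M0 : 0 < Nu + Nv + 1 by rewrite ltr_wpDl// addr_ge0.
exists (d / (Nu + Nv + 1)); first by rewrite divr_gt0.
move=> s s0; rewrite ltr_pdivlMr// => sd.
have sN : s * (Nu + Nv) < d.
  by rewrite (le_lt_trans _ sd)// ler_wpM2l ?(ltW s0)// lerDl.
have hu t : 0 <= t <= 1 -> nrm (ofreal K t *: (ofreal K s *: u)) <= s * Nu.
  move=> /andP[t0 t1]; rewrite !nrmZr !ger0_norm ?(ltW s0)//.
  by rewrite ler_piMl// mulr_ge0// ltW.
have huv t : 0 <= t <= 1 ->
    nrm (ofreal K t *: (ofreal K s *: u) + ofreal K s *: v) <= s * (Nu + Nv).
  move=> t01; rewrite (le_trans (nrmD _ _))// mulrDr lerD// ?hu//.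
  by rewrite nrmZr ger0_norm ?(ltW s0).
have uvd t : 0 <= t <= 1 ->
    nrm (ofreal K t *: (ofreal K s *: u) + ofreal K s *: v) < d.
  by move=> t01; rewrite (le_lt_trans (huv t t01)).
have ud t : 0 <= t <= 1 -> nrm (ofreal K t *: (ofreal K s *: u)) < d.
  move=> t01; rewrite (le_lt_trans (hu t t01))// (le_lt_trans _ sN)//.
  by rewrite ler_wpM2l ?(ltW s0)// lerDl.
pose L0 := D2 (ofreal K s *: v).
pose G y := F (y + ofreal K s *: v) - F y - L0 y.
rewrite (_ : _ - _ - _ = G (a + ofreal K s *: u) - G a); last first.
  rewrite /G blD (blZ L0).
  have rearr (A B C D S : Y) : A - B - C - S = A - B - (D + S) - (C - D).
    rewrite -[RHS]addrA -opprD (addrC D S) addrACA subrr addr0 opprD addrA.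
    by rewrite addrAC.
  exact: rearr.
apply: (@mvt_segment _ _ _ _ G (fun t =>
  fderiv F (a + ofreal K t *: (ofreal K s *: u) + ofreal K s *: v) -
  fderiv F (a + ofreal K t *: (ofreal K s *: u)) - L0)).
  move=> t t01; apply: has_fderivB; last exact: has_fderiv_linear.
  apply: has_fderivB.
    apply: has_fderiv_shift; apply: differentiable_has_fderiv.
    rewrite -addrA; apply: dP1.
    by rewrite (lt_le_trans (uvd t t01))// ge_min lexx.
  apply: differentiable_has_fderiv; apply: dP1.
  by rewrite (lt_le_trans (ud t t01))// ge_min lexx.
move=> t t01; rewrite (le_trans (nrm_blfun_le _ _))//.
have h1 := dP2 (ofreal K t *: (ofreal K s *: u) + ofreal K s *: v).
have h2 := dP2 (ofreal K t *: (ofreal K s *: u)).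
rewrite -(addrA a).
set w := ofreal K t *: _ in h1 h2 *; set z := ofreal K s *: v in h1 *.
(* The derivative of G is a difference of two first-order remainders of DF at a, for the increments
   w + z and w. *)
have -> : fderiv F (a + (w + z)) - fderiv F (a + w) - L0 =
    (fderiv F (a + (w + z)) - fderiv F a - D2 (w + z)) -
    (fderiv F (a + w) - fderiv F a - D2 w).
  have rearr (A B C D E : bounded_linear X Y) :
      A - B - D = (A - C - (E + D)) - (B - C - E).
    have sub2 (p q r : bounded_linear X Y) : (p - r) - (q - r) = p - q.
      by rewrite opprB addrA subrK.
    by rewrite (opprD E) addrA (addrAC _ (- D)) !sub2.
  by rewrite (blD D2); exact: rearr.
have w_d : nrm w < d2 by rewrite (lt_le_trans (ud t t01))// ge_min lexx orbT.
have wz_d : nrm (w + z) < d2.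
  by rewrite (lt_le_trans (uvd t t01))// ge_min lexx orbT.
rewrite nrmZr gtr0_norm// -/Nu expr2.
apply: (@le_trans _ _ (e / N * (s * (Nu + Nv) + s * Nu) * (s * Nu))).
  apply: ler_wpM2r; first by rewrite mulr_ge0// ltW.
  rewrite (le_trans (nrmB _ _))// mulrDr lerD//.
    rewrite (le_trans (h1 wz_d))// ler_wpM2l ?huv//.
    by rewrite divr_ge0// ltW.
  rewrite (le_trans (h2 w_d))// ler_wpM2l ?hu//.
  by rewrite divr_ge0// ltW.
have -> : e / N * (s * (Nu + Nv) + s * Nu) * (s * Nu) =
    e * (s * s) * (((Nu + Nv + Nu) * Nu) / N) by move: N^-1 => iN; ring.
by rewrite ler_piMr ?mulr_ge0 ?ltW// ltr_pdivrMr// mul1r ltrDl.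
Qed.

(** The second difference is symmetric in u and v, and it approximates both s^2 D2 v u and s^2 D2 u
    v up to (e / 2) s^2. Dividing by s^2 leaves an arbitrary e. *)
Lemma schwarz (u v : X) : D2 u v = D2 v u.
Proof.
apply/subr0_eq/(nrm0_eq0 (V := Y))/le_anti; rewrite nrm_ge0 andbT.
apply/ler_addgt0Pr => e e0; rewrite add0r.
have e20 : 0 < e / 2 by rewrite divr_gt0.
have [d1 d10 dP1] := second_difference u v e20.
have [d2 d20 dP2] := second_difference v u e20.
pose s := Num.min d1 d2 / 2.
have m0 : 0 < Num.min d1 d2 by rewrite lt_min d10.
have s0 : 0 < s by rewrite divr_gt0.
have sm : s < Num.min d1 d2 by rewrite ltr_pdivrMr// ltr_pMr// ltr1n.
have h1 := dP1 s s0 (lt_le_trans sm _); rewrite ge_min lexx in h1.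
have h2 := dP2 s s0 (lt_le_trans sm _); rewrite ge_min lexx orbT in h2.
have {h1 h2} := lerD (h1 isT) (h2 isT).
rewrite (addrAC a (ofreal K s *: v)).
have swap (A B C D : Y) : A - C - (B - D) = A - B - (C - D).
  by rewrite !opprB !addrA (addrAC A (- C) D) (addrAC A (- B) D) addrAC.
rewrite swap; set W := F _ - F _ - (F _ - F _).
rewrite !blZ !blfunZ !scalerA -!ofrealM -expr2 -mulrDl -splitr => h.
have {h} := le_trans (nrmB _ _) h.
rewrite opprB [X in nrm X]addrC addrA subrK -scalerBr nrmZr ger0_norm ?sqr_ge0//.
by rewrite mulrC ler_pM2r ?exprn_gt0.
Qed.

End Schwarz.

(** * Jet norms and bilinear maps *)

Section JetNorm.
Variables (R : realType) (K : scalarField R) (X : normedModType K).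

Lemma FCn_S (U : set X) l (Y : normedModType K) (f : X -> Y) :
  open U -> FCn U l.+1 f -> FCn U l f.
Proof.
move=> oU; elim: l Y f => [|l IHl] Y f /=.
  move=> [df _]; rewrite continuous_open_subspace// => x /[!inE] Ux.
  exact/differentiable_continuous/df.
by move=> [df cf]; split=> //; exact: IHl.
Qed.

Lemma FCn_0 (U : set X) l (Y : normedModType K) (f : X -> Y) :
  open U -> FCn U l f -> FCn U 0 f.
Proof. by move=> oU; elim: l => // l IHl /FCn_S-/(_ oU). Qed.

Lemma FCn_le (U : set X) m n (Y : normedModType K) (f : X -> Y) :
  open U -> (n <= m)%N -> FCn U m f -> FCn U n f.
Proof.
move=> oU /subnK <-; elim: (m - n)%N => // k IHk /FCn_S-/(_ oU).
exact: IHk.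
Qed.

Lemma FCn_eq (U : set X) l (Y : normedModType K) (f g : X -> Y) :
  open U -> (forall x, U x -> g x = f x) -> FCn U l f -> FCn U l g.
Proof.
move=> oU gf cf; apply: (@FCn_lin _ _ _ U 1 l Y f (cst 0) g) => //.
  by move=> x Ux; rewrite scale1r addr0 gf.
exact: FCn0.
Qed.

Lemma FCn_add (U : set X) l (Y : normedModType K) (f g : X -> Y) :
  open U -> FCn U l f -> FCn U l g -> FCn U l (fun x => f x + g x).
Proof.
move=> oU; apply: (@FCn_lin _ _ _ U 1 l Y f g) => // x _.
by rewrite scale1r.
Qed.

Lemma FCn_scale (U : set X) l (Y : normedModType K) a (f : X -> Y) :
  open U -> FCn U l f -> FCn U l (fun x => a *: f x).
Proof.
move=> oU cf; apply: (@FCn_lin _ _ _ U a l Y f (cst 0)) (FCn0 _ _ _) => //.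
by move=> x _; rewrite addr0.
Qed.

Lemma FCn_sub (U : set X) l (Y : normedModType K) (f g : X -> Y) :
  open U -> FCn U l f -> FCn U l g -> FCn U l (fun x => f x - g x).
Proof.
move=> oU cf cg; apply: (@FCn_lin _ _ _ U (-1) l Y g f) => // x _.
by rewrite scaleN1r addrC.
Qed.

Lemma FCn_step (U : set X) l (Y : normedModType K) (f : X -> Y)
    (D : X -> bounded_linear X Y) :
  open U -> (forall x, U x -> has_fderiv f x (D x)) ->
  FCn U l D -> FCn U l.+1 f.
Proof.
move=> oU fD cD; split=> [x /fD/has_fderivP[]//|].
by apply: FCn_eq cD => // x /fD/has_fderivP[].
Qed.

Lemma FCn_cst (U : set X) l (Y : normedModType K) (c : Y) :
  open U -> FCn U l (cst c).
Proof.
move=> oU; case: l => [|l]; first exact/continuous_subspaceT/cst_continuous.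
apply: (@FCn_step _ _ _ _ (cst 0)) => // [x _|]; last exact: FCn0.
by move=> e e0; exists 1 => // h _; rewrite subrr subr0 nrm0 mulr_ge0 ?nrm_ge0 ?ltW.
Qed.

Lemma FCn_bl (U : set X) l (Y : normedModType K) (L : bounded_linear X Y) :
  open U -> FCn U l L.
Proof.
move=> oU; apply: FCn_S => //.
apply: (@FCn_step _ _ _ _ (cst L)) (FCn_cst _ _ _) => // x _.
exact: has_fderiv_linear.
Qed.

Fixpoint sn (l : nat) : forall Y : normedModType K, (X -> Y) -> X -> R :=
  match l with
  | 0 => fun Y f x => nrm (f x)
  | m.+1 => fun Y f x => nrm (f x) + sn m (fderiv f) x
  end.

(** The chain rule sees an inner map only through its derivatives of order at least 1. For the graph
    x |-> (x, gamma x) these can be bounded, whereas x itself may be unbounded on U. *)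
Definition dsn (l : nat) (Y : normedModType K) (f : X -> Y) (x : X) : R :=
  if l is m.+1 then sn m (fderiv f) x else 0.

Lemma sn_ge0 l (Y : normedModType K) (f : X -> Y) x : 0 <= sn l f x.
Proof. by elim: l Y f => [|l IHl] Y f /=; rewrite ?addr_ge0 ?nrm_ge0. Qed.

Lemma dsn_ge0 l (Y : normedModType K) (f : X -> Y) x : 0 <= dsn l f x.
Proof. by case: l => //= l; exact: sn_ge0. Qed.

Lemma sn_dsn l (Y : normedModType K) (f : X -> Y) x :
  sn l f x = nrm (f x) + dsn l f x.
Proof. by case: l => //=; rewrite addr0. Qed.

Lemma nrm_le_sn l (Y : normedModType K) (f : X -> Y) x : nrm (f x) <= sn l f x.
Proof. by rewrite sn_dsn lerDl dsn_ge0. Qed.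

Lemma dsn_le_sn l (Y : normedModType K) (f : X -> Y) x : dsn l f x <= sn l f x.
Proof. by rewrite sn_dsn lerDr nrm_ge0. Qed.

Lemma sn_leS l (Y : normedModType K) (f : X -> Y) x : sn l f x <= sn l.+1 f x.
Proof.
elim: l Y f => [|l IHl] Y f; first by rewrite /= lerDl nrm_ge0.
by rewrite /= lerD2l; exact: IHl.
Qed.

Lemma sn_le_deriv l (Y : normedModType K) (f : X -> Y) x :
  sn l (fderiv f) x <= sn l.+1 f x.
Proof. by rewrite /= lerDr nrm_ge0. Qed.

Section OnOpen.
Variables (U : set X) (oU : open U).

Lemma sn_lin (a : K) l (Y : normedModType K) (f g u : X -> Y) :
  (forall x, U x -> u x = a *: f x + g x) ->
  FCn U l f -> FCn U l g -> forall x, U x ->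
  sn l u x <= sreal `|a| * sn l f x + sn l g x.
Proof.
elim: l Y f g u => [|l IHl] Y f g u uE /=.
  by move=> _ _ x Ux; rewrite uE// -nrmZ nrmD.
move=> [df cf] [dg cg] x Ux; have duE := fderiv_lin oU uE.
rewrite mulrDr addrACA lerD//; first by rewrite uE// -nrmZ nrmD.
apply: IHl => // y Uy.
by have [] := duE y Uy (df y Uy) (dg y Uy).
Qed.

Lemma sn_cst0 l (Y : normedModType K) x : sn l (cst (0 : Y)) x = 0.
Proof. by elim: l Y => [|l IHl] Y /=; rewrite ?fderiv0 ?IHl nrm0 ?addr0. Qed.

Lemma sn_le_eq l (Y : normedModType K) (f g : X -> Y) :
  (forall x, U x -> g x = f x) -> FCn U l f -> forall x, U x ->
  sn l g x <= sn l f x.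
Proof.
move=> gf cf x Ux.
have gE y : U y -> g y = 1 *: f y + cst (0 : Y) y.
  by move=> Uy; rewrite scale1r addr0 gf.
have := sn_lin gE cf (FCn0 _ _ _) Ux.
by rewrite sn_cst0 addr0 normr1 -(ofreal1 K) ofrealK mul1r.
Qed.

Lemma sn_add l (Y : normedModType K) (f g : X -> Y) :
  FCn U l f -> FCn U l g -> forall x, U x ->
  sn l (fun y => f y + g y) x <= sn l f x + sn l g x.
Proof.
move=> cf cg x Ux.
have uE y : U y -> f y + g y = 1 *: f y + g y by rewrite scale1r.
have := sn_lin uE cf cg Ux.
by rewrite normr1 -(ofreal1 K) ofrealK mul1r.
Qed.

Lemma sn_sub l (Y : normedModType K) (f g : X -> Y) :
  FCn U l f -> FCn U l g -> forall x, U x ->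
  sn l (fun y => f y - g y) x <= sn l f x + sn l g x.
Proof.
move=> cf cg x Ux.
have uE y : U y -> f y - g y = -1 *: g y + f y by rewrite scaleN1r addrC.
have := sn_lin uE cg cf Ux.
by rewrite normrN normr1 -(ofreal1 K) ofrealK mul1r addrC.
Qed.

Lemma sn_scale (a : K) l (Y : normedModType K) (f : X -> Y) :
  FCn U l f -> forall x, U x ->
  sn l (fun y => a *: f y) x <= sreal `|a| * sn l f x.
Proof.
move=> cf x Ux.
have uE y : U y -> a *: f y = a *: f y + cst (0 : Y) y by rewrite addr0.
by have := sn_lin uE cf (FCn0 _ _ _) Ux; rewrite sn_cst0 addr0.
Qed.

Lemma sn_le_step l (Y : normedModType K) (f : X -> Y)
    (D : X -> bounded_linear X Y) :
  (forall x, U x -> has_fderiv f x (D x)) -> FCn U l D ->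
  forall x, U x -> sn l.+1 f x <= nrm (f x) + sn l D x.
Proof.
move=> fD cD x Ux; rewrite /= lerD2l; apply: sn_le_eq => // y.
by move=> /fD/has_fderivP[].
Qed.

End OnOpen.

Lemma fderiv_bl (Y : normedModType K) (L : bounded_linear X Y) :
  fderiv L = cst L.
Proof.
by apply/funext => x; have /has_fderivP[] := @has_fderiv_linear _ _ _ _ L x.
Qed.

Lemma fderiv_cst (Y : normedModType K) (c : Y) :
  fderiv (cst c : X -> Y) = cst 0.
Proof.
apply/funext => x; have /has_fderivP[] // : has_fderiv (cst c : X -> Y) x 0.
by move=> e e0; exists 1 => // h _; rewrite subrr subr0 nrm0 mulr_ge0 ?nrm_ge0 ?ltW.
Qed.

Lemma sn_cst l (Y : normedModType K) (c : Y) x : sn l (cst c : X -> Y) x = nrm c.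
Proof. by case: l => //= l; rewrite fderiv_cst sn_cst0 addr0. Qed.

Lemma dsn_bl l (Y : normedModType K) (L : bounded_linear X Y) x :
  dsn l L x <= nrm L.
Proof. by case: l => [|l] /=; rewrite ?nrm_ge0// fderiv_bl sn_cst. Qed.

End JetNorm.

(** * Bounded bilinear maps: product rule and Leibniz estimate *)

Section Bilinear.
Variables (R : realType) (K : scalarField R).

(** With a bound C in place of an operator norm, the bilinear maps [bil1] and [bil2] of the product
    rule inherit the same C, so that inductions on the order do not change it. *)
Record bilin (E1 E2 E3 : normedModType K) (b : E1 -> E2 -> E3) (C : R) : Prop :=
  Bilin { bilin_ge0 : 0 <= C;
    bilinl : forall e2, linear (b^~ e2);
    bilinr : forall e1, linear (b e1);
    bilin_le : forall e1 e2, nrm (b e1 e2) <= C * nrm e1 * nrm e2 }.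

Lemma continuous_atP (X Y : normedModType K) (f : X -> Y) x :
  {for x, continuous f} <-> forall e : R, 0 < e -> exists2 d : R, 0 < d &
    forall h, nrm h < d -> nrm (f (x + h) - f x) <= e.
Proof.
split=> [/cvgrPdist_le cf e e0|cf].
  have e'0 : 0 < ofreal K e by rewrite -(ofreal0 K) lt_ofreal.
  have /nearP_nrm[d d0 dP] := cf _ e'0.
  by exists d => // h /dP; rewrite normE le_ofreal nrm_distC.
apply/cvgrPdist_le => e e0.
have e'0 : 0 < sreal e by rewrite -(lt_ofreal K) ofreal0 srealK// ltW.
have [d d0 dP] := cf _ e'0; apply/nearP_nrm; exists d => // h /dP.
by rewrite normE -[X in _ -> _ <= X]srealK ?(ltW e0)// le_ofreal nrm_distC.
Qed.

Section BilinTheory.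
Variables (E1 E2 E3 : normedModType K) (b : E1 -> E2 -> E3) (C : R).
Hypothesis bC : bilin b C.

Lemma bilinDl e e' e2 : b (e + e') e2 = b e e2 + b e' e2.
Proof. by have := bilinl bC e2 1 e e'; rewrite !scale1r. Qed.

Lemma bilinDr e1 e e' : b e1 (e + e') = b e1 e + b e1 e'.
Proof. by have := bilinr bC e1 1 e e'; rewrite !scale1r. Qed.

Lemma bilinBl e e' e2 : b (e - e') e2 = b e e2 - b e' e2.
Proof.
have := bilinl bC e2 (-1) e' e; rewrite !scaleN1r => H.
by rewrite (addrC e) H addrC.
Qed.

Lemma bilinBr e1 e e' : b e1 (e - e') = b e1 e - b e1 e'.
Proof.
have := bilinr bC e1 (-1) e' e; rewrite !scaleN1r => H.
by rewrite (addrC e) H addrC.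
Qed.

Variable X : normedModType K.

Definition bil1 (A : bounded_linear X E1) (e2 : E2) : bounded_linear X E3 :=
  mkbl (fun h => b (A h) e2).

Definition bil2 (e1 : E1) (B : bounded_linear X E2) : bounded_linear X E3 :=
  mkbl (fun h => b e1 (B h)).

Lemma bil1E A e2 h : bil1 A e2 h = b (A h) e2.
Proof.
rewrite /bil1 (@mkblE _ _ _ _ _ (C * nrm A * nrm e2))//.
  by move=> a x y; rewrite blD blZ (bilinl bC).
move=> x; rewrite (le_trans (bilin_le bC _ _))// [leRHS]mulrAC ler_wpM2r ?nrm_ge0//.
by rewrite -[leRHS]mulrA ler_wpM2l ?(bilin_ge0 bC)// nrm_blfun_le.
Qed.

Lemma bil2E e1 B h : bil2 e1 B h = b e1 (B h).
Proof.
rewrite /bil2 (@mkblE _ _ _ _ _ (C * nrm e1 * nrm B))//.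
  by move=> a x y; rewrite blD blZ (bilinr bC).
move=> x; rewrite (le_trans (bilin_le bC _ _))// -[leRHS]mulrA.
by rewrite ler_wpM2l ?nrm_blfun_le// mulr_ge0 ?(bilin_ge0 bC) ?nrm_ge0.
Qed.

Lemma bilin_bil1 : bilin bil1 C.
Proof.
split; first exact: bilin_ge0 bC.
- move=> e2 a A A'; apply: blfun_inj => h.
  by rewrite blfunD blfunZ !bil1E blfunD blfunZ (bilinl bC).
- move=> A a e e'; apply: blfun_inj => h.
  by rewrite blfunD blfunZ !bil1E (bilinr bC).
move=> A e; apply: nrm_le_bound => [|h].
  by rewrite !mulr_ge0 ?nrm_ge0 ?(bilin_ge0 bC).
rewrite bil1E (le_trans (bilin_le bC _ _))// [leRHS]mulrAC ler_wpM2r ?nrm_ge0//.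
by rewrite -[leRHS]mulrA ler_wpM2l ?(bilin_ge0 bC)// nrm_blfun_le.
Qed.

Lemma bilin_bil2 : bilin bil2 C.
Proof.
split; first exact: bilin_ge0 bC.
- move=> B a e e'; apply: blfun_inj => h.
  by rewrite blfunD blfunZ !bil2E (bilinl bC).
- move=> e1 a A A'; apply: blfun_inj => h.
  by rewrite blfunD blfunZ !bil2E blfunD blfunZ (bilinr bC).
move=> e B; apply: nrm_le_bound => [|h].
  by rewrite !mulr_ge0 ?nrm_ge0 ?(bilin_ge0 bC).
rewrite bil2E (le_trans (bilin_le bC _ _))// -[leRHS]mulrA.
by rewrite ler_wpM2l ?nrm_blfun_le// mulr_ge0 ?(bilin_ge0 bC) ?nrm_ge0.
Qed.

Lemma has_fderiv_bilin (A : X -> E1) (B : X -> E2) x LA LB :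
  has_fderiv A x LA -> has_fderiv B x LB ->
  has_fderiv (fun y => b (A y) (B y)) x (bil1 LA (B x) + bil2 (A x) LB).
Proof.
move=> HA HB e e0.
have C0 := bilin_ge0 bC.
pose a := nrm (A x); pose c := nrm (B x).
pose la := nrm LA + 1; pose lb := nrm LB + 1.
have [a0 c0] : 0 <= a /\ 0 <= c by rewrite !nrm_ge0.
have [la0 lb0] : 0 < la /\ 0 < lb by rewrite !ltr_wpDl ?nrm_ge0.
pose N := C * (a + c + la * lb) + 1.
have N0 : 0 < N.
  by rewrite ltr_wpDl// mulr_ge0// !addr_ge0// mulr_ge0 ?ltW.
pose e' := Num.min 1 (e / N).
have e'0 : 0 < e' by rewrite lt_min ltr01 divr_gt0.
have e'1 : e' <= 1 by rewrite ge_min lexx.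
have e'N : e' <= e / N by rewrite ge_min lexx orbT.
have [d1 d10 dA] := HA _ e'0; have [d2 d20 dB] := HB _ e'0.
exists (Num.min d1 (Num.min d2 (e / N))).
  by rewrite !lt_min d10 d20 divr_gt0.
move=> h; rewrite !lt_min => /and3P[hd1 hd2 hN].
have {dA hd1}hA := dA h hd1; have {dB hd2}hB := dB h hd2.
set DA := A (x + h) - A x in hA; set DB := B (x + h) - B x in hB.
have DAn : nrm DA <= la * nrm h.
  rewrite -[DA](subrK (LA h)) (le_trans (nrmD _ _))// /la addrC mulrDl.
  by rewrite lerD ?nrm_blfun_le// (le_trans hA)// ler_wpM2r ?nrm_ge0.
have DBn : nrm DB <= lb * nrm h.
  rewrite -[DB](subrK (LB h)) (le_trans (nrmD _ _))// /lb addrC mulrDl.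
  by rewrite lerD ?nrm_blfun_le// (le_trans hB)// ler_wpM2r ?nrm_ge0.
rewrite blfunD bil1E bil2E.
(* The first two terms on the right contain the remainders of A and B and are at most a multiple of
   e' |h|; the last is quadratic in h. N collects the three coefficients, with la and lb bounding
   the increments of A and B for e' <= 1. *)
have expand u w : b (A x + u) (B x + w) - b (A x) (B x) -
    (b (LA h) (B x) + b (A x) (LB h)) =
    b (u - LA h) (B x) + b (A x) (w - LB h) + b u w.
  rewrite bilinBl bilinBr bilinDl !bilinDr -(addrA (b (A x) (B x))).
  rewrite (addrC (b (A x) (B x))) addrK.
  by rewrite addrA (addrC (b (A x) w)) [LHS]addrAC opprD addrACA.
have := expand DA DB; rewrite /DA /DB (addrC (A x)) (addrC (B x)) !subrK => ->.
rewrite -/DA -/DB.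
rewrite (le_trans (nrmD _ _))//.
apply: (@le_trans _ _ ((C * (e' * nrm h) * c + C * a * (e' * nrm h)) +
  C * (la * nrm h) * (lb * nrm h))).
  rewrite lerD//; last first.
    by rewrite (le_trans (bilin_le bC _ _))// ler_pM ?ler_wpM2l ?mulr_ge0 ?nrm_ge0.
  rewrite (le_trans (nrmD _ _))// lerD// (le_trans (bilin_le bC _ _))//.
    by rewrite ler_wpM2r ?ler_wpM2l.
  by rewrite ler_wpM2l ?mulr_ge0.
have h0 := nrm_ge0 h.
apply: (@le_trans _ _ (C * (a + c + la * lb) * (e / N) * nrm h)); last first.
  rewrite ler_wpM2r// mulrCA ler_piMr ?ltW// ltr_pdivrMr// mul1r ltrDl//.
rewrite (_ : _ + _ = (C * (a + c) * e' + C * (la * lb) * nrm h) * nrm h);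
  last by ring.
rewrite ler_wpM2r// (mulrDr C (a + c)) [leRHS]mulrDl lerD// ler_wpM2l ?(ltW hN)//.
  by rewrite mulr_ge0 ?addr_ge0.
by apply: mulr_ge0 => //; apply: mulr_ge0; exact: ltW.
Qed.

Lemma continuous_at_bilin (A : X -> E1) (B : X -> E2) x :
  {for x, continuous A} -> {for x, continuous B} ->
  {for x, continuous (fun y => b (A y) (B y))}.
Proof.
move=> /continuous_atP HA /continuous_atP HB; apply/continuous_atP => e e0.
have C0 := bilin_ge0 bC.
pose a := nrm (A x); pose c := nrm (B x).
have [a0 c0] : 0 <= a /\ 0 <= c by rewrite !nrm_ge0.
pose N := C * (a + c + 1) + 1.
have N0 : 0 < N by rewrite ltr_wpDl// mulr_ge0// !addr_ge0.
pose e' := Num.min 1 (e / N).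
have e'0 : 0 < e' by rewrite lt_min ltr01 divr_gt0.
have e'1 : e' <= 1 by rewrite ge_min lexx.
have e'N : e' <= e / N by rewrite ge_min lexx orbT.
have [d1 d10 dA] := HA _ e'0; have [d2 d20 dB] := HB _ e'0.
exists (Num.min d1 d2); first by rewrite lt_min d10.
move=> h; rewrite lt_min => /andP[/dA hA /dB hB].
have expand u w : b (A x + u) (B x + w) - b (A x) (B x) =
    b (A x) w + b u (B x) + b u w.
  rewrite bilinDl !bilinDr -(addrA (b (A x) (B x))) (addrC (b (A x) (B x))).
  by rewrite addrK addrA.
have := expand (A (x + h) - A x) (B (x + h) - B x).
rewrite (addrC (A x)) (addrC (B x)) !subrK => ->.
have e'p := ltW e'0.
apply: (@le_trans _ _ (C * a * e' + C * e' * c + C * e' * e')).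
  rewrite (le_trans (nrmD _ _))// lerD//.
    rewrite (le_trans (nrmD _ _))// lerD// (le_trans (bilin_le bC _ _))//.
      by rewrite ler_wpM2l// mulr_ge0.
    by rewrite ler_wpM2r// ler_wpM2l.
  by rewrite (le_trans (bilin_le bC _ _))// ler_pM ?mulr_ge0 ?nrm_ge0// ler_wpM2l.
apply: (@le_trans _ _ (C * (a + c + 1) * e')).
  rewrite (_ : _ + _ = C * (a + c + e') * e'); last by ring.
  by rewrite ler_wpM2r// ler_wpM2l// lerD2l.
apply: (@le_trans _ _ (C * (a + c + 1) * (e / N))).
  by rewrite ler_wpM2l// mulr_ge0// !addr_ge0.
by rewrite mulrCA ler_piMr ?ltW// ltr_pdivrMr// mul1r ltrDl.
Qed.

End BilinTheory.

Lemma FCn_bilin (X : normedModType K) (U : set X) l (E1 E2 E3 : normedModType K)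
    (b : E1 -> E2 -> E3) (C : R) (A : X -> E1) (B : X -> E2) :
  bilin b C -> open U -> FCn U l A -> FCn U l B ->
  FCn U l (fun x => b (A x) (B x)).
Proof.
move=> bC oU; elim: l E1 E2 E3 b bC A B => [|l IHl] E1 E2 E3 b bC A B.
  rewrite /= !continuous_open_subspace// => cA cB x xU.
  have cAx : {for x, continuous A} by exact: cA.
  have cBx : {for x, continuous B} by exact: cB.
  exact: (continuous_at_bilin bC cAx cBx).
move=> cA cB; have cA' := FCn_S oU cA; have cB' := FCn_S oU cB.
case: cA cB => [dA cdA] [dB cdB].
apply: (@FCn_step _ _ _ _ _ _ _
  (fun x => bil1 b (fderiv A x) (B x) + bil2 b (A x) (fderiv B x))) => //.
  move=> x Ux; apply: (has_fderiv_bilin bC); apply: differentiable_has_fderiv.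
    exact: dA.
  exact: dB.
apply: FCn_add => //.
  exact: (IHl _ _ _ _ (bilin_bil1 bC _)).
exact: (IHl _ _ _ _ (bilin_bil2 bC _)).
Qed.

(** Each order contributes three terms, the value and the two terms of the product rule, each at
    most the bound of the preceding order. Hence 3^l. *)
Lemma sn_bilin (X : normedModType K) (U : set X) l (E1 E2 E3 : normedModType K)
    (b : E1 -> E2 -> E3) (C : R) (A : X -> E1) (B : X -> E2) :
  bilin b C -> open U -> FCn U l A -> FCn U l B -> forall x, U x ->
  sn l (fun x => b (A x) (B x)) x <= C * 3 ^+ l * sn l A x * sn l B x.
Proof.
move=> bC oU; elim: l E1 E2 E3 b bC A B => [|l IHl] E1 E2 E3 b bC A B.
  by move=> cA cB x Ux /=; rewrite expr0 mulr1; exact: bilin_le.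
move=> cA cB x Ux; have cA' := FCn_S oU cA; have cB' := FCn_S oU cB.
have sA := sn_leS l A x; have sB := sn_leS l B x.
have dsA := sn_le_deriv l A x; have dsB := sn_le_deriv l B x.
have nA := nrm_le_sn l.+1 A x; have nB := nrm_le_sn l.+1 B x.
case: cA cB => [dA cdA] [dB cdB].
have C0 := bilin_ge0 bC.
pose a := sn l.+1 A x; pose c := sn l.+1 B x.
have [a0 c0] : 0 <= a /\ 0 <= c by rewrite !sn_ge0.
have c1 := FCn_bilin (bilin_bil1 bC X) oU cdA cB'.
have c2 := FCn_bilin (bilin_bil2 bC X) oU cA' cdB.
apply: le_trans.
  apply: (@sn_le_step _ _ _ U oU _ _ _
    (fun x => bil1 b (fderiv A x) (B x) + bil2 b (A x) (fderiv B x))) => //.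
    move=> y Uy; apply: (has_fderiv_bilin bC); apply: differentiable_has_fderiv.
      exact: dA.
    exact: dB.
  exact: FCn_add.
apply: (@le_trans _ _ (C * 3 ^+ l * a * c +
    (C * 3 ^+ l * a * c + C * 3 ^+ l * a * c))).
  have p3 : 1 <= 3 ^+ l :> R by rewrite exprn_ege1// ler1n.
  apply: lerD.
    rewrite (le_trans (bilin_le bC _ _))// ler_pM ?mulr_ge0 ?nrm_ge0//.
    rewrite ler_pM ?nrm_ge0// ler_peMr//.
  rewrite (le_trans (sn_add oU c1 c2 Ux))// lerD//.
    rewrite (le_trans (IHl _ _ _ _ (bilin_bil1 bC X) _ _ cdA cB' _ Ux))//.
    by rewrite !ler_pM ?mulr_ge0 ?sn_ge0 ?exprn_ge0.
  rewrite (le_trans (IHl _ _ _ _ (bilin_bil2 bC X) _ _ cA' cdB _ Ux))//.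
  by rewrite !ler_pM ?mulr_ge0 ?sn_ge0 ?exprn_ge0.
rewrite exprS -/a -/c [leLHS](_ : _ = C * (3 * 3 ^+ l) * a * c)//.
by move: (3 ^+ l) => p; ring.
Qed.

End Bilinear.

(** * Composition *)

Section Composition.
Variables (R : realType) (K : scalarField R).

Lemma dsn_leS (X Y : normedModType K) l (f : X -> Y) x :
  dsn l f x <= dsn l.+1 f x.
Proof. by case: l => [|l]; [exact: sn_ge0|exact: sn_leS]. Qed.

Lemma dsn_lin (X Y : normedModType K) (U : set X) (a : K) l (f g u : X -> Y) :
  open U -> (forall x, U x -> u x = a *: f x + g x) ->
  FCn U l f -> FCn U l g -> forall x, U x ->
  dsn l u x <= sreal `|a| * dsn l f x + dsn l g x.
Proof.
move=> oU uE; case: l => [|l] /=; first by rewrite mulr0 addr0.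
move=> [df cf] [dg cg] x Ux; have duE := fderiv_lin oU uE.
apply: (sn_lin oU) => // y Uy.
by have [] := duE y Uy (df y Uy) (dg y Uy).
Qed.

Lemma has_fderiv_eq (X Y : normedModType K) (f : X -> Y) x L L' :
  L = L' -> has_fderiv f x L -> has_fderiv f x L'.
Proof. by move=> ->. Qed.

Lemma blfunN (X Y : normedModType K) (A : bounded_linear X Y) x :
  (- A) x = - A x.
Proof. by []. Qed.

Definition blapp (X Y : normedModType K) (A : bounded_linear X Y) (x : X) : Y :=
  A x.

Lemma bilin_app (X Y : normedModType K) : bilin (@blapp X Y) 1.
Proof.
split => //.
  by move=> x a y z; rewrite /blapp blD blZ.
by move=> A x; rewrite mul1r; exact: nrm_blfun_le.
Qed.

Definition blcomp (X Y Z : normedModType K) (A : bounded_linear Y Z)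
  (B : bounded_linear X Y) : bounded_linear X Z := bil2 (@blapp Y Z) A B.

Lemma blcompE (X Y Z : normedModType K) (A : bounded_linear Y Z)
  (B : bounded_linear X Y) h : blcomp A B h = A (B h).
Proof. by rewrite /blcomp (bil2E (bilin_app Y Z)). Qed.

Lemma bilin_comp (X Y Z : normedModType K) : bilin (@blcomp X Y Z) 1.
Proof. exact: bilin_bil2 (bilin_app Y Z) X. Qed.

Lemma has_fderiv_comp (X Y Z : normedModType K) (F : Y -> Z) (G : X -> Y) x LF LG :
  has_fderiv F (G x) LF -> has_fderiv G x LG ->
  has_fderiv (fun y => F (G y)) x (blcomp LF LG).
Proof.
move=> /has_fderivP[dF <-] /has_fderivP[dG <-]; apply/has_fderivP.
split; first exact: differentiable_comp.
apply: blfun_inj => h; rewrite fderivE; last exact: differentiable_comp.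
by rewrite (diff_comp dG dF) blcompE (fderivE dF) (fderivE dG).
Qed.

Lemma FCn_post (X Y Z : normedModType K) (U : set X) l (L : bounded_linear Y Z)
    (f : X -> Y) : open U -> FCn U l f -> FCn U l (fun x => L (f x)).
Proof.
by move=> oU; apply: (FCn_bilin (bilin_app Y Z)) => //; exact: FCn_cst.
Qed.

Lemma sn_post (X Y Z : normedModType K) (U : set X) l (L : bounded_linear Y Z)
    (f : X -> Y) : open U -> FCn U l f -> forall x, U x ->
  sn l (fun x => L (f x)) x <= 3 ^+ l * nrm L * sn l f x.
Proof.
move=> oU cf x Ux.
have := sn_bilin (bilin_app Y Z) oU (FCn_cst _ L oU) cf Ux.
by rewrite mul1r sn_cst.
Qed.

Section Fixed.
Variables (X T : normedModType K) (U : set X) (O : set T).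
Hypotheses (oU : open U) (oO : open O).

Lemma FCn_comp l (Z : normedModType K) (F : T -> Z) (G : X -> T) :
  (forall x, U x -> O (G x)) -> FCn O l F -> FCn U l G ->
  FCn U l (fun x => F (G x)).
Proof.
move=> GO; elim: l Z F => [|l IHl] Z F.
  rewrite /= !continuous_open_subspace// => cF cG x /[!inE] Ux.
  apply: continuous_comp; first by apply: cG; rewrite inE.
  by apply: cF; rewrite inE; exact: GO.
move=> [dF cF] cG; have cG' := FCn_S oU cG; case: cG => [dG cdG].
apply: (@FCn_step _ _ _ _ _ _ _
  (fun x => blcomp (fderiv F (G x)) (fderiv G x))) => //.
  move=> x Ux; apply: has_fderiv_comp; apply: differentiable_has_fderiv.
    exact/dF/GO.
  exact: dG.
apply: (FCn_bilin (bilin_comp _ _ _)) => //.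
exact: IHl.
Qed.

Fixpoint comp_const (l : nat) : R :=
  if l is m.+1 then 1 + 3 ^+ m * comp_const m else 1.

Lemma comp_const_ge1 l : 1 <= comp_const l.
Proof.
elim: l => //= l IHl; rewrite lerDl mulr_ge0 ?exprn_ge0//.
exact: le_trans IHl.
Qed.

(** In D(F o G) = (DF o G) DG the first factor falls under the induction hypothesis, the Leibniz
    estimate costs 3^l, and |DG|_l, which is [dsn l.+1 G], is at most rho. Since rho >= 1, the value
    term can be given the same power of rho. The recursion of [comp_const] records these two
    contributions. *)
Lemma sn_comp l (Z : normedModType K) (F : T -> Z) (G : X -> T) x (rho : R) :
  (forall x, U x -> O (G x)) -> FCn O l F -> FCn U l G -> U x ->
  1 <= rho -> dsn l G x <= rho ->
  sn l (fun x => F (G x)) x <= comp_const l * sn l F (G x) * rho ^+ l.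
Proof.
move=> GO cF cG Ux rho1.
elim: l Z F cF cG => [|l IHl] Z F cF cG; first by rewrite /= mul1r expr0 mulr1.
move=> Grho; have Grho' := le_trans (dsn_leS l G x) Grho.
have rho0 : 0 <= rho := le_trans ler01 rho1.
have sF := sn_le_deriv l F (G x).
have nF := nrm_le_sn l.+1 F (G x).
have cG' := FCn_S oU cG; case: cG cF => [dG cdG] [dF cF].
have cdFG : FCn U l (fun x => fderiv F (G x)) by exact: FCn_comp.
have c0 := le_trans ler01 (comp_const_ge1 l).
apply: le_trans.
  apply: (@sn_le_step _ _ _ U oU _ _ _
    (fun x => blcomp (fderiv F (G x)) (fderiv G x))) => //.
    move=> y Uy; apply: has_fderiv_comp; apply: differentiable_has_fderiv.
      exact/dF/GO.
    exact: dG.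
  exact: (FCn_bilin (bilin_comp _ _ _)).
pose s := sn l.+1 F (G x); have s0 : 0 <= s := sn_ge0 _ _ _.
apply: (@le_trans _ _ (s * rho ^+ l.+1 +
    3 ^+ l * (comp_const l * s * rho ^+ l) * rho)).
  apply: lerD; first by rewrite (le_trans nF)// ler_peMr// exprn_ege1.
  rewrite (le_trans (sn_bilin (bilin_comp _ _ _) oU cdFG cdG Ux))// mul1r.
  rewrite !ler_pM ?mulr_ge0 ?exprn_ge0 ?sn_ge0//.
  rewrite (le_trans (IHl _ _ cF cG' Grho'))//.
  by rewrite ler_wpM2r ?exprn_ge0// ler_wpM2l.
rewrite -/s [comp_const l.+1]/= exprS [leLHS](_ : _ =
  (1 + 3 ^+ l * comp_const l) * s * (rho * rho ^+ l))//.
by move: (3 ^+ l) (rho ^+ l) (comp_const l) => p q r; ring.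
Qed.

Fixpoint sub_const (l : nat) : R :=
  if l is m.+1 then 1 + 3 ^+ m * sub_const m + 3 ^+ m * comp_const m else 1.

Lemma sub_const_ge0 l : 0 <= sub_const l.
Proof.
elim: l => //= l IHl; rewrite !addr_ge0 ?mulr_ge0 ?exprn_ge0//.
exact: le_trans (comp_const_ge1 l).
Qed.

(** The derivative of the difference is (DF o G - DF o G0) DG + (DF o G0) (DG - DG0): induction on
    DF for the first term, [sn_comp] for the second. Together with the value these give the three
    summands of [sub_const]. The mean value inequality at order 0 costs one derivative of F, hence
    the order l + 1. *)
Lemma sn_comp_sub l (Z : normedModType K) (F : T -> Z) (G G0 : X -> T) x
    (rho S : R) :
  (forall x, U x -> O (G x)) -> (forall x, U x -> O (G0 x)) ->
  FCn O l.+1 F -> FCn U l G -> FCn U l G0 -> U x ->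
  1 <= rho -> dsn l G x <= rho -> dsn l G0 x <= rho ->
  (forall s, 0 <= s <= 1 -> O (G0 x + ofreal K s *: (G x - G0 x))) ->
  (forall s, 0 <= s <= 1 ->
     sn l (fderiv F) (G0 x + ofreal K s *: (G x - G0 x)) <= S) ->
  sn l (fun x => F (G x) - F (G0 x)) x <=
    sub_const l * S * rho ^+ l * sn l (fun x => G x - G0 x) x.
Proof.
move=> GO G0O cF cG cG0 Ux rho1 + + seg.
have rho0 : 0 <= rho := le_trans ler01 rho1.
have dF : forall y, O y -> differentiable F y by case: cF.
have h01 : 0 <= (0 : R) <= 1 by rewrite lexx ler01.
(* The target is free because the induction replaces F by DF. *)
have base : forall (Z' : normedModType K) (F' : T -> Z') m,
    (forall y, O y -> differentiable F' y) ->
    (forall s, 0 <= s <= 1 ->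
     sn m (fderiv F') (G0 x + ofreal K s *: (G x - G0 x)) <= S) ->
    nrm (F' (G x) - F' (G0 x)) <= S * nrm (G x - G0 x).
  move=> Z' F' m dF' FS.
  have {1}-> : G x = G0 x + (G x - G0 x) by rewrite addrC subrK.
  apply: (@mvt_segment _ _ _ _ F'
    (fun s => fderiv F' (G0 x + ofreal K s *: (G x - G0 x)))).
    by move=> t t01; apply: differentiable_has_fderiv; exact/dF'/seg.
  move=> t t01; rewrite (le_trans (nrm_blfun_le _ _))// ler_wpM2r ?nrm_ge0//.
  exact: le_trans (nrm_le_sn m _ _) (FS t t01).
elim: l Z F cF cG cG0 dF => [|l IHl] Z F cF cG cG0 dF Grho G0rho FS.
  by rewrite /= mul1r expr0 mulr1; exact: (base _ _ 0 dF).
have Grho' := le_trans (dsn_leS l G x) Grho.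
have G0rho' := le_trans (dsn_leS l G0 x) G0rho.
have cG' := FCn_S oU cG; have cG0' := FCn_S oU cG0.
have nFs := base _ _ _ dF FS.
have cFl : FCn O l.+1 (fderiv F) by case: cF.
have cFl' := FCn_S oO cFl.
have cGl := cG; have cG0l := cG0.
case: cG cG0 => [dG cdG] [dG0 cdG0].
have cdFG : FCn U l (fun x => fderiv F (G x)) by exact: FCn_comp.
have cdFG0 : FCn U l (fun x => fderiv F (G0 x)) by exact: FCn_comp.
have S0 : 0 <= S := le_trans (sn_ge0 _ _ _) (FS 0 h01).
have cB0 := sub_const_ge0 l.
have cA0 := le_trans ler01 (comp_const_ge1 l).
have cdGG0 := FCn_sub oU cG' cG0'.
pose d := sn l.+1 (fun x => G x - G0 x) x.
have d0 : 0 <= d := sn_ge0 _ _ _.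
have c1 := FCn_bilin (bilin_comp _ _ _) oU (FCn_sub oU cdFG cdFG0) cdG.
have c2 := FCn_bilin (bilin_comp _ _ _) oU cdFG0 (FCn_sub oU cdG cdG0).
apply: le_trans.
  apply: (@sn_le_step _ _ _ U oU _ _ _
    (fun x => blcomp (fderiv F (G x) - fderiv F (G0 x)) (fderiv G x) +
      blcomp (fderiv F (G0 x)) (fderiv G x - fderiv G0 x))) => //.
    move=> y Uy.
    rewrite (bilinBl (bilin_comp _ _ _)) (bilinBr (bilin_comp _ _ _)) addrA subrK.
    apply: has_fderivB; apply: has_fderiv_comp; apply: differentiable_has_fderiv.
    - exact/dF/GO.
    - exact: dG.
    - exact/dF/G0O.
    - exact: dG0.
  exact: FCn_add.
apply: (@le_trans _ _ (S * rho ^+ l.+1 * d +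
   (3 ^+ l * (sub_const l * S * rho ^+ l * d) * rho +
    3 ^+ l * (comp_const l * S * rho ^+ l) * d))).
  apply: lerD.
    rewrite (le_trans nFs)// ler_pM ?nrm_ge0//; last first.
      exact: (nrm_le_sn l.+1 (fun x => G x - G0 x)).
    by rewrite ler_peMr// exprn_ege1.
  rewrite (le_trans (sn_add oU c1 c2 Ux))// lerD//.
    have cS := FCn_sub oU cdFG cdFG0.
    rewrite (le_trans (sn_bilin (bilin_comp _ _ _) oU cS cdG Ux))// mul1r.
    apply: ler_pM;
      [by rewrite mulr_ge0 ?exprn_ge0 ?sn_ge0|exact: sn_ge0| |exact: Grho].
    apply: ler_wpM2l; first by rewrite exprn_ge0.
    apply: (le_trans (IHl _ _ cFl cG' cG0' _ Grho' G0rho' _)).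
    - by case: cFl.
    - move=> s s01; exact: le_trans (sn_le_deriv _ _ _) (FS s s01).
    by rewrite ler_wpM2l ?sn_leS// !mulr_ge0 ?exprn_ge0.
  have cS := FCn_sub oU cdG cdG0.
  rewrite (le_trans (sn_bilin (bilin_comp _ _ _) oU cdFG0 cS Ux))// mul1r.
  apply: ler_pM; [by rewrite mulr_ge0 ?exprn_ge0 ?sn_ge0|exact: sn_ge0| |].
    rewrite ler_wpM2l ?exprn_ge0//.
    rewrite (le_trans (sn_comp G0O cFl' cG0' Ux rho1 G0rho'))//.
    rewrite ler_wpM2r ?exprn_ge0// ler_wpM2l//.
    rewrite (le_trans (sn_leS _ _ _))// (le_trans _ (FS 0 h01))//.
    by rewrite ofreal0 scale0r addr0.
  apply: le_trans (sn_le_deriv _ _ _); apply: (sn_le_eq oU) Ux.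
    move=> y Uy; apply/esym.
    by have /has_fderivP[] := has_fderivB (differentiable_has_fderiv (dG y Uy))
      (differentiable_has_fderiv (dG0 y Uy)).
  by have [] := FCn_sub oU cGl cG0l.
rewrite -/d [sub_const l.+1]/= exprS.
have P0 : 0 <= 3 ^+ l * (comp_const l * S * rho ^+ l) * d.
  by rewrite !mulr_ge0 ?exprn_ge0.
(* The second term of the product rule has only rho^l; as rho >= 1 it may be raised to the common
   power. *)
apply: (@le_trans _ _ (S * (rho * rho ^+ l) * d +
   (3 ^+ l * (sub_const l * S * rho ^+ l * d) * rho +
    3 ^+ l * (comp_const l * S * rho ^+ l) * d * rho))).
  by rewrite !lerD2l ler_peMr.
rewrite [leLHS](_ : _ = (1 + 3 ^+ l * sub_const l + 3 ^+ l * comp_const l) *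
  S * (rho * rho ^+ l) * d)//.
by move: (3 ^+ l) (rho ^+ l) (comp_const l) (sub_const l) => p q r r'; ring.
Qed.

Fixpoint taylor_const (l : nat) : R :=
  if l is m.+1 then
    1 + 3 ^+ m * taylor_const m + 3 ^+ m * (sub_const m * 2 ^+ m)
  else 1.

Lemma taylor_const_ge0 l : 0 <= taylor_const l.
Proof.
elim: l => //= l IHl.
by rewrite !addr_ge0 ?mulr_ge0 ?exprn_ge0 ?sub_const_ge0.
Qed.

Lemma FCn_taylor l (Z : normedModType K) (F : T -> Z) (G H : X -> T) (t : K) :
  (forall x, U x -> O (G x)) -> (forall x, U x -> O (G x + t *: H x)) ->
  FCn O l.+1 F -> FCn U l G -> FCn U l H ->
  FCn U l (fun x => F (G x + t *: H x) - F (G x) - t *: fderiv F (G x) (H x)).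
Proof.
move=> GO GHO cF cG cH; have cF' := FCn_S oO cF; have [_ cdF] := cF.
have cGH := FCn_add oU cG (FCn_scale t oU cH).
have cFG := FCn_comp GO cF' cG; have cFGH := FCn_comp GHO cF' cGH.
have cdFG := FCn_comp GO cdF cG.
apply: FCn_sub => //; first exact: FCn_sub.
exact/FCn_scale/(FCn_bilin (bilin_app _ _)).
Qed.

(** The derivative of the remainder is the remainder of DF, composed with DG, plus t (DF(G + t H) -
    DF(G)) DH. The first term is covered by induction; in the second, [sn_comp_sub] supplies another
    factor t, and DH is bounded by rho. *)
Lemma sn_comp_taylor l (Z : normedModType K) (F : T -> Z) (G H : X -> T) x
    (t : K) (rho S : R) :
  (forall x, U x -> O (G x)) -> (forall x, U x -> O (G x + t *: H x)) ->
  FCn O l.+2 F -> FCn U l G -> FCn U l H -> U x ->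
  1 <= rho -> dsn l G x <= rho -> sn l H x <= rho -> sreal `|t| <= 1 ->
  (forall s, 0 <= s <= 1 -> O (G x + ofreal K s *: (t *: H x))) ->
  (forall s, 0 <= s <= 1 ->
     sn l.+1 (fderiv F) (G x + ofreal K s *: (t *: H x)) <= S) ->
  sn l (fun x => F (G x + t *: H x) - F (G x) - t *: fderiv F (G x) (H x)) x <=
    taylor_const l * S * sreal `|t| ^+ 2 * rho ^+ l.+1 * sn l H x.
Proof.
move=> GO GHO cF cG cH Ux rho1 + + t1 seg.
set tau := sreal `|t|; have tau0 : 0 <= tau := sreal_norm_ge0 t.
have rho0 : 0 <= rho := le_trans ler01 rho1.
have h01 : 0 <= (0 : R) <= 1 by rewrite lexx ler01.
(* Order 0 is [taylor2]; of the two factors |H x| one is replaced by rho. *)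
have base : forall (Z' : normedModType K) (F' : T -> Z') m,
    FCn O 2 F' -> nrm (H x) <= rho ->
    (forall s, 0 <= s <= 1 ->
     sn m.+1 (fderiv F') (G x + ofreal K s *: (t *: H x)) <= S) ->
    nrm (F' (G x + t *: H x) - F' (G x) - t *: fderiv F' (G x) (H x)) <=
      S * tau ^+ 2 * rho * nrm (H x).
  move=> Z' F' m [dF' [ddF' _]] Hrho FS.
  rewrite -blZ; apply: (@le_trans _ _ (S * nrm (t *: H x) ^+ 2)).
    apply: taylor2 => s s01; [exact/dF'/seg|exact/ddF'/seg|].
    apply: le_trans (FS s s01); apply: le_trans (sn_le_deriv _ _ _).
    exact: nrm_le_sn.
  have S0 : 0 <= S := le_trans (sn_ge0 _ _ _) (FS 0 h01).
  rewrite nrmZ -/tau exprMn expr2 -!mulrA !ler_wpM2l// expr2.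
  by rewrite ler_wpM2r ?nrm_ge0.
elim: l Z F cF cG cH => [|l IHl] Z F cF cG cH Grho Hrho FS.
  by rewrite [taylor_const _]/= mul1r expr1; exact: (base _ _ 0).
have Grho' := le_trans (dsn_leS l G x) Grho.
have Hrho' := le_trans (sn_leS l H x) Hrho.
have cG' := FCn_S oU cG; have cH' := FCn_S oU cH.
have cdF : FCn O l.+2 (fderiv F) by case: cF.
have nFs : nrm (F (G x + t *: H x) - F (G x) - t *: fderiv F (G x) (H x)) <=
    S * tau ^+ 2 * rho * nrm (H x).
  apply: (base _ _ l.+1) => //; last exact: le_trans (nrm_le_sn _ _ _) Hrho.
  exact: (FCn_le oO _ cF).
have cdF1 := FCn_S oO cdF; have cdF0 := FCn_S oO cdF1.
have [_ cddF] := cdF1.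
have cGH := FCn_add oU cG (FCn_scale t oU cH).
have cGH' := FCn_S oU cGH.
have cdFG := FCn_comp GO cdF0 cG'.
have cdFGH := FCn_comp GHO cdF0 cGH'.
have cddFG := FCn_comp GO cddF cG'.
have cddFGH := FCn_bilin (bilin_app _ _) oU cddFG cH'.
have cT := FCn_taylor GO GHO cdF1 cG' cH'.
have cS := FCn_sub oU cdFGH cdFG.
have S0 : 0 <= S := le_trans (sn_ge0 _ _ _) (FS 0 h01).
have cC0 := taylor_const_ge0 l.
have cB0 := sub_const_ge0 l.
have [dF ddF] : (forall y, O y -> differentiable F y) /\
  (forall y, O y -> differentiable (fderiv F) y) by case: cF => ? [].
case: cG cH => [dG cdG] [dH cdH].
have c1 := FCn_bilin (bilin_comp _ _ _) oU cT cdG.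
have c2 := FCn_bilin (bilin_comp _ _ _) oU cS cdH.
have c2t := FCn_scale t oU c2.
pose h := sn l.+1 H x; have h0 : 0 <= h := sn_ge0 _ _ _.
apply: le_trans.
  apply: (@sn_le_step _ _ _ U oU _ _ _ (fun x =>
    blcomp (fderiv F (G x + t *: H x) - fderiv F (G x) -
              t *: fderiv (fderiv F) (G x) (H x)) (fderiv G x) +
    t *: blcomp (fderiv F (G x + t *: H x) - fderiv F (G x)) (fderiv H x))) => //.
    move=> y Uy.
    have Gy := differentiable_has_fderiv (dG y Uy).
    have Hy := differentiable_has_fderiv (dH y Uy).
    have GHy := has_fderivD Gy (has_fderivZ t Hy).
    have Fy := differentiable_has_fderiv (dF _ (GO y Uy)).
    have FGHy := differentiable_has_fderiv (dF _ (GHO y Uy)).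
    have dFy := differentiable_has_fderiv (ddF _ (GO y Uy)).
    have D1 := has_fderiv_comp (G := fun z => G z + t *: H z) FGHy GHy.
    have D2 := has_fderiv_comp (G := G) Fy Gy.
    have D3 := has_fderiv_bilin (bilin_app _ _)
      (has_fderiv_comp (G := G) dFy Gy) Hy.
    have nearF : \forall z \near G y, differentiable F z.
      by apply: filterS (open_nbhs_nbhs (conj oO (GO y Uy))) => z /dF.
    apply: has_fderiv_eq (has_fderivB (has_fderivB D1 D2) (has_fderivZ t D3)).
    apply: blfun_inj => k.
    rewrite !(blfunD, blfunN, blfunZ, blcompE, bil1E (bilin_app _ _),
      bil2E (bilin_app _ _)) /blapp !(blD, blZ).
    (* Differentiating DF(G) H produces D^2 F(G) (DG k) (H), while the remainder of DF contains D^2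
       F(G) (H) (DG k). *)
    rewrite (schwarz nearF dFy (fderiv G y k)) !scalerDr scalerN.
    by rewrite (addrAC _ (t *: _)) opprD addrACA.
  exact: (FCn_add oU c1 c2t).
apply: (@le_trans _ _ (S * tau ^+ 2 * rho ^+ l.+2 * h +
   (3 ^+ l * (taylor_const l * S * tau ^+ 2 * rho ^+ l.+1 * h) * rho +
    tau * (3 ^+ l * (sub_const l * S * (2 * rho) ^+ l * (tau * h)) * rho)))).
  apply: lerD.
    apply: (le_trans nFs); apply: ler_pM; [|exact: nrm_ge0| |exact: nrm_le_sn].
      by rewrite !mulr_ge0 ?exprn_ge0.
    by rewrite ler_wpM2l ?mulr_ge0 ?exprn_ge0// exprS ler_peMr// exprn_ege1.
  apply: (le_trans (sn_add oU c1 c2t Ux)); apply: lerD.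
    apply: (le_trans (sn_bilin (bilin_comp _ _ _) oU cT cdG Ux)); rewrite mul1r.
    apply: ler_pM;
      [by rewrite mulr_ge0 ?exprn_ge0 ?sn_ge0|exact: sn_ge0| |exact: Grho].
    apply: ler_wpM2l; first by rewrite exprn_ge0.
    apply: (le_trans (IHl _ _ cdF cG' cH' Grho' Hrho' _)).
      by move=> s s01; exact: le_trans (sn_le_deriv _ _ _) (FS s s01).
    by apply: ler_wpM2l (sn_leS _ _ _); rewrite !mulr_ge0 ?exprn_ge0.
  apply: le_trans; first exact: (sn_scale oU t c2 Ux).
  apply: ler_wpM2l; first exact: tau0.
  apply: le_trans; first exact: (sn_bilin (bilin_comp _ _ _) oU cS cdH Ux).
  rewrite mul1r; apply: ler_pM;
    [by rewrite mulr_ge0 ?exprn_ge0 ?sn_ge0|exact: sn_ge0| |]; last first.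
    exact: le_trans (sn_le_deriv _ _ _) Hrho.
  apply: ler_wpM2l; first by rewrite exprn_ge0.
  (* As |t| <= 1, the derivatives of G + t H are bounded by 2 rho, which is the origin of the power
     of 2 in [taylor_const]. *)
  have rho2 : rho <= 2 * rho by rewrite ler_peMl// ler1n.
  have GHG : forall y, U y -> t *: H y = G y + t *: H y - G y.
    by move=> y _; rewrite addrC addKr.
  apply: le_trans.
    apply: (@sn_comp_sub l _ (fderiv F) (fun x => G x + t *: H x) G x (2 * rho) S
      GHO GO cdF1 cGH' cG' Ux).
    - exact: le_trans rho2.
    - have uE z : U z -> G z + t *: H z = t *: H z + G z by rewrite addrC.
      apply: (le_trans (dsn_lin oU uE cH' cG' Ux)).
      rewrite mulr_natl mulr2n lerD// -[leRHS]mul1r.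
      apply: ler_pM; [exact: tau0|exact: dsn_ge0|exact: t1|].
      exact: le_trans (dsn_le_sn _ _ _) Hrho'.
    - exact: le_trans rho2.
    - by move=> s s01; rewrite -GHG//; exact: seg.
    move=> s s01; rewrite -GHG//; apply: le_trans (FS s s01).
    exact: le_trans (sn_le_deriv _ _ _) (sn_leS _ _ _).
  apply: ler_wpM2l; first by rewrite !mulr_ge0 ?exprn_ge0 ?mulr_ge0.
  apply: (@le_trans _ _ (sn l (fun y => t *: H y) x)).
    apply: (sn_le_eq oU) Ux; last exact: FCn_scale.
    by move=> y Uy; rewrite -GHG.
  apply: (le_trans (sn_scale oU t cH' Ux)); apply: ler_wpM2l; first exact: tau0.
  exact: sn_leS.
rewrite -/h [taylor_const l.+1]/=.
have P0 : 0 <= 3 ^+ l * (sub_const l * 2 ^+ l) * S * tau ^+ 2 * rho ^+ l.+1 * h.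
  by rewrite !mulr_ge0 ?exprn_ge0.
apply: (@le_trans _ _ (S * tau ^+ 2 * rho ^+ l.+2 * h +
   (3 ^+ l * (taylor_const l * S * tau ^+ 2 * rho ^+ l.+1 * h) * rho +
   3 ^+ l * (sub_const l * 2 ^+ l) * S * tau ^+ 2 * rho ^+ l.+1 * h * rho))).
  rewrite !lerD2l; apply: le_trans (ler_peMr P0 rho1).
  rewrite le_eqVlt; apply/orP; left; apply/eqP; rewrite exprMn (exprS rho l).
  by move: (3 ^+ l) (2 ^+ l) (rho ^+ l) (sub_const l) => p p' q r'; ring.
rewrite [leLHS](_ : _ =
  (1 + 3 ^+ l * taylor_const l + 3 ^+ l * (sub_const l * 2 ^+ l)) *
  S * tau ^+ 2 * rho ^+ l.+2 * h)//.
rewrite (exprS rho l.+1).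
move: (3 ^+ l) (2 ^+ l) (rho ^+ l.+1) (taylor_const l) (sub_const l).
by move=> p p' q r r'; ring.
Qed.

End Fixed.
End Composition.

(** * Weights *)

Section Opnorm.
Variables (R : realType) (K : scalarField R) (X : normedModType K).

Fixpoint dn (l : nat) : forall Y : normedModType K, (X -> Y) -> X -> R :=
  match l with
  | 0 => fun Y f x => nrm (f x)
  | m.+1 => fun Y f x => dn m (fderiv f) x
  end.

Lemma dn_ge0 l (Y : normedModType K) (f : X -> Y) x : 0 <= dn l f x.
Proof. by elim: l Y f => [|l IHl] Y f /=; [exact: nrm_ge0|exact: IHl]. Qed.

Lemma dn_le_sn m l (Y : normedModType K) (f : X -> Y) x :
  (m <= l)%N -> dn m f x <= sn l f x.
Proof.
elim: m l Y f => [|m IHm] [|l] Y f //= ml; first by rewrite lerDl sn_ge0.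
by rewrite (le_trans (IHm l _ _ ml))// lerDr nrm_ge0.
Qed.

Lemma sn_sum l (Y : normedModType K) (f : X -> Y) x :
  sn l f x = \sum_(j < l.+1) dn j f x.
Proof.
elim: l Y f => [|l IHl] Y f; first by rewrite big_ord_recl big_ord0 addr0.
by rewrite big_ord_recl [LHS]/= IHl.
Qed.

(** A tuple of vectors of the unit ball splits into head and tail. The supremum over heads is the
    norm in [bounded_linear X Y] of the derivative evaluated at the tail, and the supremum over
    tails is the induction hypothesis for [fderiv f]. *)
Lemma opnorm_dn l (Y : normedModType K) (f : X -> Y) x :
  opnorm (iter_fderiv f x : l.-tuple X -> Y) = (dn l f x)%:E.
Proof.
elim: l Y f => [|l IHl] Y f.
  apply/le_anti/andP; split; first by apply: ge_ereal_sup => _ [h _ <-].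
  by apply: ereal_sup_ubound; exists [tuple] => //= -[].
rewrite [dn _ _ _]/= -IHl; apply/le_anti/andP; split.
  apply: ge_ereal_sup => _ [h h1 <-].
  apply: (@le_trans _ _ (nrm (iter_fderiv (fderiv f) x (behead_tuple h)))%:E).
    rewrite lee_fin [iter_fderiv _ _ _]/= (le_trans (nrm_blfun_le _ _))//.
    by rewrite ler_piMr ?nrm_ge0//; exact: h1.
  apply: ereal_sup_ubound; exists (behead_tuple h) => // i.
  by rewrite tnth_behead.
apply: ge_ereal_sup => _ [h h1 <-].
have : (0 <= opnorm (iter_fderiv f x : l.+1.-tuple X -> Y))%E.
  exact: opnorm_ge0.
case E : (opnorm _) => [r| |]// _; last by rewrite leey.
rewrite lee_fin nrm_blnorm; apply: blnorm_leP => y y1.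
rewrite -lee_fin -E; apply: ereal_sup_ubound.
exists [tuple of y :: h].
  by move=> i; case: (unliftP ord0 i) => [j|] ->; rewrite ?tnthS ?tnth0.
rewrite [iter_fderiv _ _ _]/= theadE.
by rewrite (_ : behead_tuple [tuple of y :: h] = h)//; exact: val_inj.
Qed.

End Opnorm.

Section Weights.
Variables (R : realType) (K : scalarField R) (I : Type).
Variables (X : I -> normedModType K) (U : forall i, open_domain (X i)).

(** An extended value |v| is replaced by all real numbers a below it: |v| r <= d means a r <= d for
    all of them. For |v| = oo this forces r = 0, in accordance with 0 * oo = 0. *)
Definition lowf (v : \bar R) (a : R) : Prop := 0 <= a /\ (a%:E <= `|v|)%E.

Lemma lowf_le (v : \bar R) (r d : R) : 0 <= r -> 0 <= d ->
  (forall a, lowf v a -> a * r <= d) -> (`|v| * r%:E <= d%:E)%E.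
Proof.
move=> r0 d0 H; have := abse_ge0 v; case E : `|v|%E => [s| |]//.
  rewrite lee_fin -EFinM lee_fin => s0; apply: H; split=> //.
  by rewrite E.
move=> _; have [->|rN0] := eqVneq r 0; first by rewrite mule0 lee_fin.
have r_gt0 : 0 < r by rewrite lt_neqAle eq_sym rN0.
have /H : lowf v ((d + 1) / r).
  by split; [rewrite divr_ge0// addr_ge0|rewrite E leey].
by rewrite divfK// gerDl leNgt ltr01.
Qed.

(** Unlike [wpnorm], which treats a single order, this bounds the whole jet up to order l, as the
    chain rule estimates require. *)
Definition wle (f : forall i, X i -> \bar R) (l : nat) (E : I -> normedModType K)
    (phi : forall i, X i -> E i) (M : R) : Prop :=
  forall i x a, dom (U i) x -> lowf (f i x) a -> a * sn l (phi i) x <= M.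

Lemma wpnorm_dn (f : forall i, X i -> \bar R) l (E : I -> normedModType K)
    (phi : forall i, X i -> E i) (d : R) :
  (wpnorm U f l phi <= d%:E)%E ->
  forall i x a, dom (U i) x -> lowf (f i x) a -> a * dn l (phi i) x <= d.
Proof.
move=> H i x a Ux [a0 af]; rewrite -lee_fin (le_trans _ H)//.
apply: (@le_trans _ _ (wnorm (U i) (f i) l (phi i))); last first.
  by apply: ereal_sup_ubound; exists i.
apply: (@le_trans _ _ (`|f i x| *
    opnorm (iter_fderiv (phi i) x : l.-tuple _ -> _))%E).
  by rewrite opnorm_dn EFinM lee_wpmul2r// lee_fin dn_ge0.
by apply: ereal_sup_ubound; exists x.
Qed.

Lemma wpnorm_le (f : forall i, X i -> \bar R) l (E : I -> normedModType K)
    (phi : forall i, X i -> E i) (d : R) : 0 <= d ->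
  (forall i x a, dom (U i) x -> lowf (f i x) a -> a * dn l (phi i) x <= d) ->
  (wpnorm U f l phi <= d%:E)%E.
Proof.
move=> d0 H; apply: ge_ereal_sup => _ [i _ <-].
apply: ge_ereal_sup => _ [x Ux <-]; rewrite opnorm_dn.
by apply: lowf_le => //; [exact: dn_ge0|move=> a; exact: H].
Qed.

Variable W : set (forall i, X i -> \bar R).
Variable k : option nat.

Lemma wprod_exists (E : I -> normedModType K) (phi : forall i, X i -> E i) :
  (forall i l, le_order l k -> FCn (U i) l (phi i)) ->
  (forall f, W f -> forall l, le_order l k -> exists M, wle f l phi M) ->
  exists Phi : wprod U W k E, forall i x, dom (U i) x -> Phi i x = phi i x.
Proof.
move=> cphi bphi.
pose psi : map_family X E := fun i x => if `[< dom (U i) x >] then phi i x else 0.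
have psiE i x : dom (U i) x -> psi i x = phi i x.
  by move=> Ux; rewrite /psi asboolT.
have bpsi f : W f -> forall l, le_order l k -> (wpnorm U f l psi < +oo)%E.
  move=> Wf l lk; have [M HM] := bphi f Wf l lk.
  apply: (@le_lt_trans _ _ (Num.max 0 M)%:E); last exact: ltry.
  apply: wpnorm_le => [|i x a Ux fa]; first by rewrite le_max lexx.
  rewrite le_max; apply/orP; right; apply: le_trans (HM i x a Ux fa).
  rewrite ler_wpM2l ?(proj1 fa)// (le_trans (dn_le_sn _ _ (leqnn l)))//.
  apply: (sn_le_eq (dom_open (U i))) Ux; last exact: cphi.
  exact: psiE.
have psiP : psi \in wprod_pred U W k (Y := E).
  apply/asboolP; split; last by move=> i x Ux; rewrite /psi asboolF.
  split=> // i; split=> [l lk|_ [f Wf <-] l lk].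
    by apply: FCn_eq (cphi i l lk); [exact: dom_open|exact: psiE].
  apply: le_lt_trans (bpsi f Wf l lk).
  by apply: ereal_sup_ubound; exists i.
by exists (WProd psiP) => i x Ux /=; exact: psiE.
Qed.

Hypothesis I_nonempty : inhabited I.

Lemma wprod_seminorm_dn (E : I -> normedModType K) (Phi : wprod U W k E)
    (f : forall i, X i -> \bar R) l (H : W f /\ le_order l k) :
  forall i x a, dom (U i) x -> lowf (f i x) a ->
  a * dn l (Phi i) x <=
    wprod_seminorm (exist _ (f, l) H : wprod_index W k) Phi.
Proof.
apply: wpnorm_dn; rewrite /wprod_seminorm /= fineK//.
(* An index makes the supremum nonnegative; over an empty family it would be -oo. *)
have [i0] := I_nonempty.
rewrite ge0_fin_numE; first by have [_] := wprodP Phi; apply; case: H.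
apply: (le_trans (wnorm_ge0 (f i0) l (Phi i0) (dom_neq0 (U i0)))).
by apply: ereal_sup_ubound; exists i0.
Qed.

Lemma wprod_seminorm_le (E : I -> normedModType K) (Phi : wprod U W k E)
    (j : wprod_index W k) d : 0 <= d ->
  (forall i x a, dom (U i) x -> lowf ((sval j).1 i x) a ->
    a * dn (sval j).2 (Phi i) x <= d) ->
  wprod_seminorm j Phi <= d.
Proof.
move=> d0 H; have := wpnorm_le d0 H; rewrite /wprod_seminorm.
by case: (wpnorm _ _ _ _) => [r| |]//=; rewrite ?lee_fin.
Qed.

End Weights.

(** * Weights controlled by finitely many elements of W *)

Section Dominated.
Variables (R : realType) (K : scalarField R) (I : Type).
Hypothesis I_nonempty : inhabited I.
Variables (X : I -> normedModType K) (U : forall i, open_domain (X i)).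
Variable W : set (forall i, X i -> \bar R).

(* g i x stands for the numbers 0 <= b <= |g_i(x)|, so that only real
   arithmetic is needed although weights may be infinite. *)
Definition dominated_at (l : nat) (g : forall i, X i -> R -> Prop)
    (E : I -> normedModType K) (fs : seq (forall i, X i -> \bar R)) (C : R) :=
  [/\ 0 <= C, forall f, List.In f fs -> W f &
   forall phi : forall i, X i -> E i,
    (forall i, FCn (U i) l (phi i)) ->
    (forall f, W f -> exists M, wle U f l phi M) ->
    forall M, 0 < M -> (forall f, List.In f fs -> wle U f l phi M) ->
    forall i x b, dom (U i) x -> g i x b -> b * sn l (phi i) x <= C * M].

Definition dominated (g : forall i, X i -> R -> Prop) : Prop :=
  forall E : I -> normedModType K, exists fs C, dominated_at 0 g E fs C.

Lemma wle_le (E : I -> normedModType K) f l l' (phi : forall i, X i -> E i)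
    (E' : I -> normedModType K) (psi : forall i, X i -> E' i) M :
  (forall i x, dom (U i) x -> sn l' (psi i) x <= sn l (phi i) x) ->
  wle U f l phi M -> wle U f l' psi M.
Proof.
move=> H HM i x a Ux fa; apply: le_trans (HM i x a Ux fa).
by rewrite ler_wpM2l ?(proj1 fa)// H.
Qed.

(** The derivatives of phi form a family with values in the spaces of bounded linear maps, to which
    domination applies again. This is why [dominated] ranges over all families E. *)
Lemma dominated_sn g : dominated g ->
  forall l (E : I -> normedModType K), exists fs C, dominated_at l g E fs C.
Proof.
move=> gd; elim=> [|l IHl] E; first exact: gd.
have [fs1 [C1 [C10 W1 H1]]] := gd E.
have [fs2 [C2 [C20 W2 H2]]] :=
  IHl (fun i => bounded_linear (X i) (E i) : normedModType K).
exists (fs1 ++ fs2), (C1 + C2); split; first exact: addr_ge0.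
  by move=> f ffs; case: (List.in_app_or _ _ _ ffs) => ?; [exact: W1|exact: W2].
move=> phi cphi bphi M M0 HM i x b Ux gb; rewrite /= mulrDr mulrDl lerD//.
  apply: (H1 phi _ _ M M0 _ i x b Ux gb).
  - by move=> j; apply: FCn_0 (cphi j); exact: dom_open.
  - move=> f /bphi[N HN]; exists N; apply: wle_le HN => j y _.
    exact: nrm_le_sn.
  move=> f ffs; apply: wle_le (HM f _) => [j y _|].
    exact: nrm_le_sn.
  by apply/List.in_or_app; left.
apply: (H2 (fun i => fderiv (phi i)) _ _ M M0 _ i x b Ux gb).
- by move=> j; case: (cphi j).
- move=> f /bphi[N HN]; exists N; apply: wle_le HN => j y _.
  exact: sn_le_deriv.
move=> f ffs; apply: wle_le (HM f _) => [j y _|].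
  exact: sn_le_deriv.
by apply/List.in_or_app; right.
Qed.

(** The union plays the role of max(|g1|, |g2|). *)
Lemma dominatedU g1 g2 : dominated g1 -> dominated g2 ->
  dominated (fun i x b => g1 i x b \/ g2 i x b).
Proof.
move=> d1 d2 E.
have [fs1 [C1 [C10 W1 H1]]] := d1 E; have [fs2 [C2 [C20 W2 H2]]] := d2 E.
exists (fs1 ++ fs2), (C1 + C2); split; first exact: addr_ge0.
  by move=> f ffs; case: (List.in_app_or _ _ _ ffs) => ?; [exact: W1|exact: W2].
move=> phi cphi bphi M M0 HM i x b Ux [] gb.
  apply: (@le_trans _ _ (C1 * M)); last by rewrite ler_wpM2r ?(ltW M0)// lerDl.
  apply: (H1 phi cphi bphi M M0) => // f ffs; apply: HM.
  by apply/List.in_or_app; left.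
apply: (@le_trans _ _ (C2 * M)); last by rewrite ler_wpM2r ?(ltW M0)// lerDr.
apply: (H2 phi cphi bphi M M0) => // f ffs; apply: HM.
by apply/List.in_or_app; right.
Qed.

Lemma dominatedZ g c : 0 <= c -> dominated g ->
  dominated (fun i x b => exists2 b', g i x b' & b = c * b').
Proof.
move=> c0 d E; have [fs [C [C0 Wfs H]]] := d E.
exists fs, (c * C); split=> //; first exact: mulr_ge0.
move=> phi cphi bphi M M0 HM i x _ Ux [b gb ->].
by rewrite -!mulrA ler_wpM2l//; exact: (H phi cphi bphi M M0 HM).
Qed.

(** The continuous seminorm q given by g is below 1 on a ball of some radius e for finitely many
    weights. Multiplication by e / (2 M) moves phi into this ball, strictly because of the 2, and
    homogeneity of q gives the constant 2 / e. *)
Lemma Wmax_dominated g : Wmax U W g -> dominated (fun i x => lowf (g i x)).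
Proof.
move=> [_ gE] E; have [q [qE qD qZ cq]] := gE E.
have q0 : q 0 = 0.
  by rewrite -(scale0r (0 : wprod U W (Some 0%N) E)) qZ normr0 sreal0 mul0r.
have : nbhs (0 : wprod U W (Some 0%N) E) [set phi | q phi < 1].
  apply: (cq 0 [set r : R | r < 1]) => /=; rewrite q0.
  by apply: open_nbhs_nbhs; split; [exact: open_lt|exact: ltr01].
move=> [js [e [e0 eq]]].
exists (map (fun j : wprod_index W (Some 0%N) => (sval j).1) js), (2 / e).
split; first by rewrite divr_ge0// ltW.
  by move=> f /List.in_map_iff[j [<- _]]; have [] := svalP j.
move=> phi cphi bphi M M0 HM i x b Ux gb.
have [||Phi PhiE] := @wprod_exists _ _ _ _ U W (Some 0%N) E phi.
- by move=> j l; rewrite /le_order leqn0 => /eqP->.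
- by move=> f Wf l; rewrite /le_order leqn0 => /eqP->; exact: bphi.
have M2 : 0 < e / (2 * M) by rewrite divr_gt0// mulr_gt0.
have : q (ofreal K (e / (2 * M)) *: Phi) < 1.
  apply: eq => j jjs; rewrite subr0.
  have := wprod_seminorm_lin j (ofreal K (e / (2 * M))) Phi 0.
  rewrite addr0 wprod_seminorm0 addr0 (sreal_norm_ofreal _ (ltW M2)).
  move=> /le_lt_trans; apply.
  apply: (@le_lt_trans _ _ (e / (2 * M) * M)); last first.
    by rewrite invfM mulrA divfK ?gt_eqF// ltr_pdivrMr// ltr_pMr// ltr1n.
  rewrite ler_wpM2l ?(ltW M2)//.
  apply: (wprod_seminorm_le (ltW M0)) => i' y a Uy fa.
  have fj : List.In (sval j).1
    (map (fun j : wprod_index W (Some 0%N) => (sval j).1) js).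
    by apply/List.in_map_iff; exists j.
  have l0 : (sval j).2 = 0%N.
    by have [_] := svalP j; rewrite /le_order leqn0 => /eqP.
  by rewrite l0 /= PhiE//; exact: (HM _ fj).
rewrite qZ (sreal_norm_ofreal _ (ltW M2)) => qlt.
have qle : q Phi <= 2 / e * M.
  by move: qlt; rewrite mulrC -ltr_pdivlMr// div1r invf_div mulrAC => /ltW.
apply: le_trans qle; rewrite /= -PhiE//.
have Hq : (wpnorm U g 0 Phi <= (q Phi)%:E)%E by rewrite qE.
exact: (wpnorm_dn Hq Ux gb).
Qed.

End Dominated.

(** * Inclusions of the factors of a product *)

Section Pairs.
Variables (R : realType) (K : scalarField R) (X Y : normedModType K).

Definition bl_inl : bounded_linear X (X * Y)%type := mkbl (fun x => (x, 0)).
Definition bl_inr : bounded_linear Y (X * Y)%type := mkbl (fun y => (0, y)).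

Lemma bl_inlE x : bl_inl x = (x, 0).
Proof.
rewrite /bl_inl (@mkblE _ _ _ _ _ 1)// => [a u v|u].
  by apply/pair_equal_spec; rewrite /= scaler0 addr0.
by rewrite mul1r nrm_pair nrm0 max_l ?nrm_ge0.
Qed.

Lemma bl_inrE y : bl_inr y = (0, y).
Proof.
rewrite /bl_inr (@mkblE _ _ _ _ _ 1)// => [a u v|u].
  by apply/pair_equal_spec; rewrite /= scaler0 addr0.
by rewrite mul1r nrm_pair nrm0 max_r ?nrm_ge0.
Qed.

Lemma nrm_bl_inl : nrm bl_inl <= 1.
Proof.
apply: nrm_le_bound => // x.
by rewrite bl_inlE mul1r nrm_pair nrm0 max_l ?nrm_ge0.
Qed.

Lemma nrm_bl_inr : nrm bl_inr <= 1.
Proof.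
apply: nrm_le_bound => // x.
by rewrite bl_inrE mul1r nrm_pair nrm0 max_r ?nrm_ge0.
Qed.

End Pairs.

(** * Symbols *)

Lemma open_setX (S T : topologicalType) (A : set S) (B : set T) :
  open A -> open B -> open (A `*` B).
Proof.
rewrite !openE => oA oB [x y] [/= Ax By].
by exists (A, B) => //; split; [exact: oA|exact: oB].
Qed.

Section Graph.
Variables (R : realType) (K : scalarField R) (X P : normedModType K).
Variables (U : set X) (oU : open U).

Lemma FCn_inr l (eta : X -> P) : FCn U l eta -> FCn U l (fun x => ((0 : X), eta x)).
Proof.
move=> ceta; apply: FCn_eq (FCn_post (bl_inr X P) oU ceta) => // x _.
by rewrite bl_inrE.
Qed.

Lemma sn_inr l (eta : X -> P) x : FCn U l eta -> U x ->
  sn l (fun x => ((0 : X), eta x)) x <= 3 ^+ l * sn l eta x.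
Proof.
move=> ceta Ux; have c := FCn_post (bl_inr X P) oU ceta.
apply: (@le_trans _ _ (sn l (fun y => bl_inr X P (eta y)) x)).
  by apply: (sn_le_eq oU) Ux => // y _; rewrite bl_inrE.
apply: (le_trans (sn_post (bl_inr X P) oU ceta Ux)).
rewrite ler_wpM2r ?sn_ge0// ler_piMr ?exprn_ge0//.
exact: nrm_bl_inr.
Qed.

Lemma FCn_graph l (gamma : X -> P) : FCn U l gamma ->
  FCn U l (fun x => (x, gamma x)).
Proof.
move=> cg.
apply: FCn_eq (FCn_add oU (FCn_bl _ (bl_inl X P) oU) (FCn_inr cg)) => // x _.
by rewrite bl_inlE; apply/pair_equal_spec; rewrite /= addr0 add0r.
Qed.

(** The identity contributes only its derivative, of norm at most 1; 3^l is the cost of composing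
    gamma with the inclusion into the product. *)
Lemma dsn_graph l (gamma : X -> P) x (rho : R) : FCn U l gamma -> U x ->
  sn l gamma x <= rho -> dsn l (fun x => (x, gamma x)) x <= 1 + 3 ^+ l * rho.
Proof.
move=> cg Ux grho.
have uE y : U y -> (y, gamma y) = 1 *: bl_inl X P y + (0, gamma y).
  move=> _; rewrite bl_inlE scale1r; apply/pair_equal_spec.
  by rewrite /= addr0 add0r.
apply: (le_trans (dsn_lin oU uE (FCn_bl _ _ oU) (FCn_inr cg) Ux)).
rewrite normr1 -(ofreal1 K) ofrealK mul1r lerD//.
  exact: le_trans (dsn_bl _ _ _) (nrm_bl_inl _ _).
apply: (le_trans (dsn_le_sn _ _ _)).
by apply: (le_trans (sn_inr cg Ux)); rewrite ler_wpM2l ?exprn_ge0.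
Qed.

End Graph.

Section Symbols.
Variables (R : realType) (K : scalarField R) (I : Type).
Variables (X : I -> normedModType K) (U : forall i, open_domain (X i)).
Variable W : set (forall i, X i -> \bar R).

(* The first alternative of [sym_bound] is the case |g_i(x)| = oo. *)
Record symbol (P Z : I -> normedModType K) (Om : forall i, set (P i))
    (F : forall i, (X i * P i)%type -> Z i) : Prop := Symbol {
  sym_open : forall i, open (Om i);
  sym_star : forall i, star_shaped0 (Om i);
  sym_smooth : forall i l, FCn (dom (U i) `*` Om i) l (F i);
  sym_zero : forall i x, dom (U i) x -> F i (x, 0) = 0;
  sym_bound : forall f, W f -> forall l r, exists2 g, dominated U W g &
    forall i x a, dom (U i) x -> 0 < a -> lowf (f i x) a ->
      (forall b, 0 <= b -> g i x b) \/
      exists2 b, g i x b & forall p, Om i p -> nrm p <= r ->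
        a * sn l (fderiv (F i)) (x, p) <= b }.

(** Turns [sym_bound] into a real bound S along a segment, such that a S |H|_l is controlled. The
    vector v will be H x or t H x; it has to vanish with H x so that the segment is a point where
    |g| is infinite. *)
Lemma sym_dom (P Z : I -> normedModType K) (Om : forall i, set (P i))
    (F : forall i, (X i * P i)%type -> Z i) :
  symbol Om F -> forall f, W f -> forall m l r, exists fs C,
  [/\ 0 <= C, forall f', List.In f' fs -> W f' &
   forall H : forall i, X i -> P i, (forall i, FCn (U i) l (H i)) ->
   (forall f', W f' -> exists M, wle U f' l H M) ->
   forall M, 0 < M -> (forall f', List.In f' fs -> wle U f' l H M) ->
   forall i x a, dom (U i) x -> 0 < a -> lowf (f i x) a ->
   forall p v, (H i x = 0 -> v = 0) ->
   (forall s, 0 <= s <= 1 -> Om i (p + ofreal K s *: v) /\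
      nrm (p + ofreal K s *: v) <= r) ->
   exists2 S, forall s, 0 <= s <= 1 ->
      sn m (fderiv (F i)) (x, p + ofreal K s *: v) <= S &
     a * S * sn l (H i) x <= C * M].
Proof.
move=> sF f Wf m l r; have [g gd gF] := sym_bound sF Wf m r.
have [fs [C [C0 Wfs HC]]] := dominated_sn gd l P.
exists fs, C; split=> // H cH bH M M0 HM i x a Ux a0 fa p v v0 seg.
have CM0 : 0 <= C * M by rewrite mulr_ge0// ltW.
have [full|[b gb bF]] := gF i x a Ux a0 fa; last first.
  exists (b / a).
    by move=> s /seg[]; rewrite ler_pdivlMr// mulrC; exact: bF.
  rewrite mulrCA divff ?gt_eqF// mulr1.
  exact: (HC H cH bH M M0 HM i x b Ux gb).
(* Every b >= 0 is admissible here, so b |H|_l <= C M for arbitrarily large b. *)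
have H0 : sn l (H i) x = 0.
  apply/eqP/negPn/negP => N0.
  have sn0 : 0 < sn l (H i) x by rewrite lt_neqAle eq_sym N0 sn_ge0.
  have b0 : 0 <= (C * M + 1) / sn l (H i) x.
    by rewrite divr_ge0 ?sn_ge0// addr_ge0.
  have := HC H cH bH M M0 HM i x _ Ux (full _ b0).
  by rewrite divfK// gerDl leNgt ltr01.
have Hx0 : H i x = 0.
  apply: (@nrm0_eq0 _ _ (P i)); apply/le_anti; rewrite nrm_ge0 andbT -H0.
  exact: nrm_le_sn.
exists (sn m (fderiv (F i)) (x, p)); last by rewrite H0 mulr0.
by move=> s _; rewrite (v0 Hx0) scaler0 addr0.
Qed.

(** The weights fs and the constant C are chosen before gamma and gamma0 and depend on them only
    through rho. With gamma0 = 0 this shows that the operator is defined, with gamma close to gamma0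
    that it is continuous. *)
Lemma symbol_sub (P Z : I -> normedModType K) (Om : forall i, set (P i))
    (F : forall i, (X i * P i)%type -> Z i) :
  symbol Om F -> forall f, W f -> forall l rho, 1 <= rho -> exists fs C,
  [/\ 0 <= C, forall f', List.In f' fs -> W f' &
   forall gamma gamma0 : forall i, X i -> P i,
   (forall i, FCn (U i) l (gamma i)) -> (forall i, FCn (U i) l (gamma0 i)) ->
   (forall i x, dom (U i) x -> forall s, 0 <= s <= 1 ->
      Om i (gamma0 i x + ofreal K s *: (gamma i x - gamma0 i x))) ->
   (forall i x, dom (U i) x -> sn l (gamma i) x <= rho) ->
   (forall i x, dom (U i) x -> sn l (gamma0 i) x <= rho) ->
   (forall f', W f' -> exists M,
     wle U f' l (fun i x => gamma i x - gamma0 i x) M) ->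
   forall M, 0 < M ->
   (forall f', List.In f' fs ->
     wle U f' l (fun i x => gamma i x - gamma0 i x) M) ->
   wle U f l (fun i x => F i (x, gamma i x) - F i (x, gamma0 i x)) (C * M)].
Proof.
move=> sF f Wf l rho rho1.
(* The points gamma0 + s (gamma - gamma0) have norm at most rho + 2 rho. *)
have [fs [C0 [C00 Wfs HC]]] := sym_dom sF Wf l l (3 * rho).
have rho0 : 0 <= rho := le_trans ler01 rho1.
pose rho' := 1 + 3 ^+ l * rho.
have rho'1 : 1 <= rho' by rewrite lerDl mulr_ge0 ?exprn_ge0.
have rho'0 : 0 <= rho' := le_trans ler01 rho'1.
(* The last factor 3^l comes from replacing (0, gamma - gamma0) by gamma - gamma0. *)
pose D := sub_const R l * rho' ^+ l * 3 ^+ l.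
have D0 : 0 <= D by rewrite !mulr_ge0 ?exprn_ge0 ?sub_const_ge0.
exists fs, (D * C0); split=> //; first exact: mulr_ge0.
move=> ga ga0 cga cga0 seg gar ga0r bH M M0 HM i x a Ux fa.
have [a0 _] := fa; move: a0; rewrite le_eqVlt => /predU1P[<-|a0].
  by rewrite mul0r (mulr_ge0 (mulr_ge0 D0 C00) (ltW M0)).
have [Oga Oga0] : (forall y, dom (U i) y -> Om i (ga i y)) /\
    (forall y, dom (U i) y -> Om i (ga0 i y)).
  split=> y Uy.
    have h01 : 0 <= (1 : R) <= 1 by rewrite ler01 lexx.
    by have := seg i y Uy 1 h01; rewrite ofreal1 scale1r addrC subrK.
  have h01 : 0 <= (0 : R) <= 1 by rewrite ler01 lexx.
  by have := seg i y Uy 0 h01; rewrite ofreal0 scale0r addr0.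
have oO := open_setX (dom_open (U i)) (sym_open sF i).
have [|s s01|S SF aS] := HC _ (fun j => FCn_sub (dom_open (U j)) (cga j) (cga0 j))
  bH M M0 HM i x a Ux a0 fa (ga0 i x) (ga i x - ga0 i x).
- by [].
- split; first exact: seg.
  have n0 := le_trans (nrm_le_sn l (ga0 i) x) (ga0r i x Ux).
  have n1 := le_trans (nrm_le_sn l (ga i) x) (gar i x Ux).
  rewrite (le_trans (nrmD _ _))// (_ : 3 * rho = rho + 2 * rho); last by ring.
  rewrite lerD// nrmZr; have /andP[s0 s1] := s01.
  rewrite ger0_norm// (le_trans (ler_piMl (nrm_ge0 _) s1))//.
  by rewrite (le_trans (nrmB _ _))// mulr_natl mulr2n lerD.
have S0 : 0 <= S.
  have h01 : 0 <= (0 : R) <= 1 by rewrite ler01 lexx.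
  exact: le_trans (sn_ge0 _ _ _) (SF 0 h01).
have pE s : (x, ga0 i x) + ofreal K s *: ((x, ga i x) - (x, ga0 i x)) =
    (x, ga0 i x + ofreal K s *: (ga i x - ga0 i x)).
  by apply/pair_equal_spec; rewrite /= subrr scaler0 addr0.
have cH := FCn_sub (dom_open (U i)) (cga i) (cga0 i).
have key := @sn_comp_sub _ _ _ _ _ _ (dom_open (U i)) oO l _ (F i)
  (fun y => (y, ga i y)) (fun y => (y, ga0 i y)) x rho' S
  (fun y Uy => conj Uy (Oga y Uy)) (fun y Uy => conj Uy (Oga0 y Uy))
  (sym_smooth sF i l.+1) (FCn_graph (dom_open _) (cga i))
  (FCn_graph (dom_open _) (cga0 i)) Ux rho'1
  (dsn_graph (dom_open _) (cga i) Ux (gar i x Ux))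
  (dsn_graph (dom_open _) (cga0 i) Ux (ga0r i x Ux)).
apply: (@le_trans _ _ (a * (sub_const R l * S * rho' ^+ l *
    (3 ^+ l * sn l (fun y => ga i y - ga0 i y) x)))).
  rewrite ler_wpM2l ?(ltW a0)//; apply: le_trans; first apply: key.
  - by move=> s s01; rewrite pE; split=> //; exact: seg.
  - by move=> s s01; rewrite pE; exact: SF.
  apply: ler_wpM2l; first by rewrite !mulr_ge0 ?exprn_ge0 ?sub_const_ge0.
  apply: le_trans (sn_inr (dom_open (U i)) cH Ux).
  apply: (sn_le_eq (dom_open (U i))) Ux; last exact: (FCn_inr (dom_open (U i)) cH).
  by move=> y _; apply/pair_equal_spec; rewrite /= subrr.
rewrite [leLHS](_ : _ = D * (a * S * sn l (fun y => ga i y - ga0 i y) x)).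
  by rewrite -(mulrA D C0 M); apply: ler_wpM2l.
rewrite /D; move: (sn _ _ _) (3 ^+ l) (rho' ^+ l) (sub_const R l) => p q r' r''.
ring.
Qed.

(** The constant C is independent of t, so the remainder of the operator is O(t^2) uniformly in the
    index and the point. *)
Lemma symbol_taylor (P Z : I -> normedModType K) (Om : forall i, set (P i))
    (F : forall i, (X i * P i)%type -> Z i) :
  symbol Om F -> forall f, W f -> forall l rho, 1 <= rho -> exists fs C,
  [/\ 0 <= C, forall f', List.In f' fs -> W f' &
   forall (gamma eta : forall i, X i -> P i) (t : K), sreal `|t| <= 1 ->
   (forall i, FCn (U i) l (gamma i)) -> (forall i, FCn (U i) l (eta i)) ->
   (forall i x, dom (U i) x -> forall s, 0 <= s <= 1 ->
      Om i (gamma i x + ofreal K s *: (t *: eta i x))) ->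
   (forall i x, dom (U i) x -> sn l (gamma i) x <= rho) ->
   (forall i x, dom (U i) x -> sn l (eta i) x <= rho) ->
   (forall f', W f' -> exists M, wle U f' l eta M) ->
   forall M, 0 < M -> (forall f', List.In f' fs -> wle U f' l eta M) ->
   wle U f l (fun i x => F i (x, gamma i x + t *: eta i x) - F i (x, gamma i x)
     - t *: fderiv (F i) (x, gamma i x) (0, eta i x)) (C * M * sreal `|t| ^+ 2)].
Proof.
move=> sF f Wf l rho rho1.
(* The remainder involves derivatives of F up to order l + 2, but eta only up to order l. The radius
   bounds gamma + s t eta for |t| <= 1. *)
have [fs [C0 [C00 Wfs HC]]] := sym_dom sF Wf l.+1 l (2 * rho).
have rho0 : 0 <= rho := le_trans ler01 rho1.
pose rho' := 1 + 3 ^+ l * rho.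
have rho'1 : 1 <= rho' by rewrite lerDl mulr_ge0 ?exprn_ge0.
have rho'0 : 0 <= rho' := le_trans ler01 rho'1.
pose D := taylor_const R l * rho' ^+ l.+1 * 3 ^+ l.
have D0 : 0 <= D by rewrite !mulr_ge0 ?exprn_ge0 ?taylor_const_ge0.
exists fs, (D * C0); split=> //; first exact: mulr_ge0.
move=> ga eta t t1 cga ceta seg gar etar bH M M0 HM i x a Ux fa.
have t0 : 0 <= sreal `|t| := sreal_norm_ge0 t.
have [a0 _] := fa; move: a0; rewrite le_eqVlt => /predU1P[<-|a0].
  rewrite mul0r; apply: mulr_ge0 (exprn_ge0 2 t0).
  exact: mulr_ge0 (mulr_ge0 D0 C00) (ltW M0).
have [Oga Ogat] : (forall y, dom (U i) y -> Om i (ga i y)) /\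
    (forall y, dom (U i) y -> Om i (ga i y + t *: eta i y)).
  split=> y Uy.
    have h01 : 0 <= (0 : R) <= 1 by rewrite ler01 lexx.
    by have := seg i y Uy 0 h01; rewrite ofreal0 scale0r addr0.
  have h01 : 0 <= (1 : R) <= 1 by rewrite ler01 lexx.
  by have := seg i y Uy 1 h01; rewrite ofreal1 scale1r.
have oO := open_setX (dom_open (U i)) (sym_open sF i).
have [H0|s s01|S SF aS] := HC eta ceta bH M M0 HM i x a Ux a0 fa (ga i x)
  (t *: eta i x).
- by rewrite H0 scaler0.
- split; first exact: seg.
  have n0 := le_trans (nrm_le_sn l (ga i) x) (gar i x Ux).
  have n1 := le_trans (nrm_le_sn l (eta i) x) (etar i x Ux).
  rewrite (le_trans (nrmD _ _))// mulr_natl mulr2n lerD// nrmZr nrmZ.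
  have /andP[s0 s1] := s01; rewrite ger0_norm//.
  rewrite (le_trans (ler_piMl _ s1)) ?mulr_ge0 ?nrm_ge0//.
  by rewrite (le_trans (ler_piMl (nrm_ge0 _) t1)).
have S0 : 0 <= S.
  have h01 : 0 <= (0 : R) <= 1 by rewrite ler01 lexx.
  exact: le_trans (sn_ge0 _ _ _) (SF 0 h01).
have pE (y : X i) u w : (y, u) + (0, w) = (y, u + w) :> (X i * P i)%type.
  by apply/pair_equal_spec; rewrite /= addr0.
have tE c w : c *: (0, w) = (0, c *: w) :> (X i * P i)%type.
  by apply/pair_equal_spec; rewrite /= scaler0.
have etar' : sn l (fun y => ((0 : X i), eta i y)) x <= rho'.
  apply: (le_trans (sn_inr (dom_open (U i)) (ceta i) Ux)).
  apply: (@le_trans _ _ (3 ^+ l * rho)); last by rewrite lerDr.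
  by rewrite ler_wpM2l ?exprn_ge0 ?etar.
have key := @sn_comp_taylor _ _ _ _ _ _ (dom_open (U i)) oO l _ (F i)
  (fun y => (y, ga i y)) (fun y => (0, eta i y)) x t rho' S
  (fun y Uy => conj Uy (Oga y Uy)).
apply: (@le_trans _ _ (a * (taylor_const R l * S * sreal `|t| ^+ 2 * rho' ^+ l.+1 *
    (3 ^+ l * sn l (eta i) x)))).
  rewrite ler_wpM2l ?(ltW a0)//.
  rewrite [X in sn l X](_ : _ = (fun y => F i ((y, ga i y) + t *: (0, eta i y))
    - F i (y, ga i y) - t *: fderiv (F i) (y, ga i y) (0, eta i y))); last first.
    by apply/funext => y; rewrite tE pE.
  apply: le_trans; first apply: key.
  - by move=> y Uy; rewrite tE pE; split=> //; exact: Ogat.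
  - exact: (sym_smooth sF i l.+2).
  - exact: (FCn_graph (dom_open _) (cga i)).
  - exact: (FCn_inr (dom_open _) (ceta i)).
  - exact: Ux.
  - exact: rho'1.
  - exact: (dsn_graph (dom_open _) (cga i) Ux (gar i x Ux)).
  - exact: etar'.
  - exact: t1.
  - by move=> s s01; rewrite !tE pE; split=> //; exact: seg.
  - by move=> s s01; rewrite !tE pE; exact: SF.
  apply: ler_wpM2l; first by rewrite !mulr_ge0 ?exprn_ge0 ?taylor_const_ge0.
  exact: (sn_inr (dom_open (U i)) (ceta i) Ux).
rewrite [leLHS](_ : _ = D * (a * S * sn l (eta i) x) * sreal `|t| ^+ 2).
  by rewrite ler_wpM2r ?exprn_ge0// -(mulrA D C0 M); apply: ler_wpM2l.
rewrite /D; move: (sn _ _ _) (3 ^+ l) (rho' ^+ l.+1) (taylor_const R l).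
move=> p q r' r''.
ring.
Qed.

End Symbols.

(** * The symbol of the derivative *)

Section DerivedSymbol.
Variables (R : realType) (K : scalarField R) (X P Z : normedModType K).

Definition dsym (F : (X * P)%type -> Z) (z : (X * (P * P))%type) : Z :=
  fderiv F (z.1, z.2.1) (0, z.2.2).

Definition bl_pr : bounded_linear (X * (P * P))%type (X * P)%type :=
  mkbl (fun z => (z.1, z.2.1)).
Definition bl_sh : bounded_linear (X * (P * P))%type (X * P)%type :=
  mkbl (fun z => (0, z.2.2)).

Let nrm_pr (z : (X * (P * P))%type) :
  nrm ((z.1, z.2.1) : (X * P)%type) <= 1 * nrm z.
Proof.
case: z => x [y y1]; rewrite mul1r !nrm_pair ge_max !le_max lexx /=.
by rewrite lexx orbT.
Qed.

Let nrm_sh (z : (X * (P * P))%type) :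
  nrm ((0, z.2.2) : (X * P)%type) <= 1 * nrm z.
Proof.
case: z => x [y y1]; rewrite mul1r !nrm_pair nrm0 ge_max !le_max nrm_ge0 /=.
by rewrite lexx !orbT.
Qed.

Lemma bl_prE z : bl_pr z = (z.1, z.2.1).
Proof. by rewrite /bl_pr (mkblE _ nrm_pr). Qed.

Lemma bl_shE z : bl_sh z = (0, z.2.2).
Proof.
rewrite /bl_sh (mkblE _ nrm_sh)// => a u v.
by apply/pair_equal_spec; rewrite /= scaler0 addr0.
Qed.

Lemma nrm_bl_pr : nrm bl_pr <= 1.
Proof. by apply: nrm_le_bound => // z; rewrite bl_prE; exact: nrm_pr. Qed.

Lemma nrm_bl_sh : nrm bl_sh <= 1.
Proof. by apply: nrm_le_bound => // z; rewrite bl_shE; exact: nrm_sh. Qed.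

Variables (U : set X) (Om : set P).
Hypotheses (oU : open U) (oOm : open Om).

Let O := U `*` Om.
Let O' := U `*` (Om `*` [set: P]).
Let oO : open O. Proof. exact: open_setX. Qed.
Let oO' : open O'.
Proof. by apply: open_setX => //; apply: open_setX => //; exact: openT. Qed.

Let prO z : O' z -> O (bl_pr z).
Proof. by move=> [Uz [Oz _]]; rewrite bl_prE. Qed.

Lemma FCn_dsym l (F : (X * P)%type -> Z) : FCn O l.+1 F -> FCn O' l (dsym F).
Proof.
move=> cF; have cdF : FCn O l (fderiv F) by case: cF.
have cpr := FCn_bl l bl_pr oO'.
apply: (FCn_eq (f := fun z => blapp (fderiv F (bl_pr z)) (bl_sh z))) => //.
  by move=> z _; rewrite /blapp bl_prE bl_shE.
exact: (FCn_bilin (bilin_app _ _) oO' (FCn_comp oO' oO prO cdF cpr)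
  (FCn_bl l bl_sh oO')).
Qed.

(** [dsym F] is the evaluation of DF(x, y) at (0, y1), hence a bilinear expression in a composition
    with the linear map [bl_pr] and the linear map [bl_sh]. The jet of the latter is at most |y1| +
    1, hence the factor r + 1. *)
Lemma sn_dsym l (F : (X * P)%type -> Z) x y y1 (r : R) : FCn O l.+2 F ->
  U x -> Om y -> nrm y1 <= r ->
  sn l (fderiv (dsym F)) (x, (y, y1)) <=
    3 ^+ l.+1 * comp_const R l.+1 * (r + 1) * sn l.+1 (fderiv F) (x, y).
Proof.
move=> cF Ux Oy y1r; have Oz : O' (x, (y, y1)) by [].
have cd := FCn_dsym cF; have cdF : FCn O l.+1 (fderiv F) by case: cF.
have cpr := FCn_bl l.+1 bl_pr oO'.
apply: (le_trans (sn_le_deriv _ _ _)).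
pose G z := blapp (fderiv F (bl_pr z)) (bl_sh z).
have cA : FCn O' l.+1 (fun z => fderiv F (bl_pr z)).
  exact: (FCn_comp oO' oO prO cdF cpr).
have cB : FCn O' l.+1 bl_sh by exact: FCn_bl.
have cG : FCn O' l.+1 G := FCn_bilin (bilin_app _ _) oO' cA cB.
apply: (@le_trans _ _ (sn l.+1 G (x, (y, y1)))).
  apply: (sn_le_eq oO' _ cG Oz) => z _.
  by rewrite /G /blapp bl_prE bl_shE.
apply: (le_trans (sn_bilin (bilin_app _ _) oO' cA cB Oz)); rewrite mul1r.
rewrite -!mulrA; apply: ler_wpM2l; first exact: exprn_ge0.
rewrite (mulrC (r + 1)) mulrA; apply: ler_pM; [exact: sn_ge0|exact: sn_ge0| |].
  have := sn_comp oO' oO prO cdF cpr Oz (lexx 1)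
    (le_trans (dsn_bl _ _ _) nrm_bl_pr).
  by rewrite expr1n mulr1 bl_prE.
rewrite sn_dsn; apply: lerD.
  by rewrite bl_shE nrm_pair nrm0 max_r// nrm_ge0.
exact: (le_trans (dsn_bl _ _ _) nrm_bl_sh).
Qed.

End DerivedSymbol.

(** * Symbols from symbols, and from the given maps *)

Section SymbolInstances.
Variables (R : realType) (K : scalarField R) (I : Type).
Hypothesis I_nonempty : inhabited I.
Variables (X : I -> normedModType K) (U : forall i, open_domain (X i)).
Variable W : set (forall i, X i -> \bar R).

(** The derived symbol is linear in y1, so in general its derivatives are bounded only for bounded
    y1; this is why [sym_bound] is restricted to balls. The weight for order l + 1 of F, enlarged by
    a constant, serves for order l. *)
Lemma symbol_dsym (P Z : I -> normedModType K) (Om : forall i, set (P i))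
    (F : forall i, (X i * P i)%type -> Z i) : symbol U W Om F ->
  symbol U W (P := fun i => (P i * P i)%type) (fun i => Om i `*` setT)
    (fun i => dsym (F i)).
Proof.
move=> [oOm sOm cF F0 bF]; split.
- by move=> i; apply: open_setX => //; exact: openT.
- move=> i; have [Om0 Omt] := sOm i; split=> // -[y y1] t [/= Oy _] t01.
  by split=> //; exact: Omt.
- by move=> i l; apply: FCn_dsym => //; exact: dom_open.
- move=> i x Ux; rewrite /dsym /= (_ : (0, 0) = 0)//.
  exact: (linear0 (fderiv (F i) (x, 0))).
move=> f Wf l r; have [g gd gF] := bF f Wf l.+1 r.
(* The absolute value keeps c positive for every real r, so that it can be divided by. *)
pose c := 3 ^+ l.+1 * comp_const R l.+1 * (`|r| + 1).
have c0 : 0 < c.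
  apply: mulr_gt0; last by rewrite ltr_wpDl.
  by rewrite mulr_gt0 ?exprn_gt0// (lt_le_trans _ (comp_const_ge1 R l.+1)).
exists (fun i x b => exists2 b', g i x b' & b = c * b').
  exact: dominatedZ (ltW c0) gd.
move=> i x a Ux a0 fa; have [full|[b gb bF']] := gF i x a Ux a0 fa.
  left=> b b0; exists (b / c); first by apply: full; rewrite divr_ge0// ltW.
  by rewrite mulrCA divff ?mulr1// gt_eqF.
right; exists (c * b); first by exists b.
move=> [y y1] [/= Oy _]; rewrite nrm_pair ge_max => /andP[yr y1r].
apply: (@le_trans _ _ (a * (c * sn l.+1 (fderiv (F i)) (x, y)))).
  rewrite ler_wpM2l ?(ltW a0)//.
  apply: (sn_dsym (dom_open (U i)) (oOm i) (cF i l.+2) Ux Oy).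
  by rewrite (le_trans y1r)// ler_norm.
by rewrite mulrCA ler_wpM2l ?(ltW c0)//; exact: bF'.
Qed.

Lemma sn_recr (E F : normedModType K) l (f : E -> F) x :
  sn l.+1 f x = sn l f x + dn l.+1 f x.
Proof. by rewrite !sn_sum big_ord_recr. Qed.

(** Each order of derivative comes with its own weight g; the jet of order l needs a common one,
    which is assembled order by order from maxima and factors 2. *)
Lemma symbol_of_bounds (Y Z : I -> normedModType K) (V : forall i, set (Y i))
    (beta : forall i, (X i * Y i)%type -> Z i) :
  (forall i, open (V i)) -> (forall i, star_shaped0 (V i)) ->
  (forall i, FC (dom (U i) `*` V i) None (beta i)) ->
  (forall i x, dom (U i) x -> beta i (x, 0) = 0) ->
  (forall f, W f -> forall l : nat, (0 < l)%N ->
    exists2 g, Wmax U W g & forall i x, dom (U i) x ->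
      (wnorm (dom (U i) `*` V i) (cst 1%E) l (beta i) * `|f i x|
        <= `|g i x|)%E) ->
  symbol U W V beta.
Proof.
move=> oV sV cb b0 bb; split=> //; first by move=> i l; exact: cb.
have dn_bound f : W f -> forall l, exists2 g, dominated U W g &
    forall i x a, dom (U i) x -> 0 < a -> lowf (f i x) a ->
      (forall b, 0 <= b -> g i x b) \/
      exists2 b, g i x b & forall p, V i p ->
        a * dn l (fderiv (beta i)) (x, p) <= b.
  move=> Wf l; have [g gmax gb] := bb f Wf l.+1 isT.
  exists (fun i x => lowf (g i x)); first exact: Wmax_dominated.
  move=> i x a Ux a0 [_ fa]; have := gb i x Ux; rewrite /lowf.
  (* A finite |g_i(x)| is itself the required b; an infinite one admits every b >= 0. *)
  have := abse_ge0 (g i x); case: `|g i x|%E => [s| |]// s0 gs; last first.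
    by left=> b; rewrite leey.
  right; exists s; first by rewrite lexx -lee_fin.
  move=> p Vp; rewrite -lee_fin (le_trans _ gs)// EFinM muleC.
  apply: lee_pmul; rewrite ?lee_fin ?dn_ge0 ?(ltW a0)//.
  apply: ereal_sup_ubound; exists (x, p) => //.
  by rewrite opnorm_dn gee0_abs ?lee_fin// mul1e.
move=> f Wf l r; elim: l => [|l [g1 g1d g1b]].
  have [g gd gb] := dn_bound f Wf 0%N; exists g => // i x a Ux a0 fa.
  have [|[b gb' H]] := gb i x a Ux a0 fa; first by left.
  by right; exists b => // p Vp _; exact: H.
have [g2 g2d g2b] := dn_bound f Wf l.+1.
exists (fun i x b => exists2 b', g1 i x b' \/ g2 i x b' & b = 2 * b').
  exact: dominatedZ (dominatedU g1d g2d).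
move=> i x a Ux a0 fa.
have full : (forall b, 0 <= b -> g1 i x b) \/ (forall b, 0 <= b -> g2 i x b) ->
    forall b, 0 <= b -> exists2 b', g1 i x b' \/ g2 i x b' & b = 2 * b'.
  move=> H b b_ge0; exists (b / 2); last by rewrite mulrCA divff ?mulr1.
  have b2 : 0 <= b / 2 by rewrite divr_ge0.
  by case: H => H; [left|right]; exact: H.
have [H|[b1 gb1 H1]] := g1b i x a Ux a0 fa; first by left; apply: full; left.
have [H|[b2 gb2 H2]] := g2b i x a Ux a0 fa; first by left; apply: full; right.
right; exists (2 * Num.max b1 b2).
  by exists (Num.max b1 b2) => //; case: leP => _; [right|left].
move=> p Vp pr; rewrite sn_recr mulrDr mulr_natl mulr2n lerD//.
  by rewrite le_max H1.
by rewrite le_max H2 ?orbT.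
Qed.

End SymbolInstances.

(** * Superposition operators *)

Lemma near_list (T J : Type) (F : set_system T) (Q : J -> T -> Prop) (js : seq J) :
  Filter F -> (forall j, List.In j js -> \forall u \near F, Q j u) ->
  \forall u \near F, forall j, List.In j js -> Q j u.
Proof.
move=> FF; elim: js => [|j js IHjs] H; first by near=> u.
have Hj := H j (or_introl erefl).
have Hjs := IHjs (fun i ijs => H i (or_intror ijs)).
by apply: filterS2 Hj Hjs => u ju jsu i [<-|/jsu].
Unshelve. all: by end_near. Qed.

Section Superposition.
Variables (R : realType) (K : scalarField R) (I : Type).
Hypothesis I_nonempty : inhabited I.
Variables (X : I -> normedModType K) (U : forall i, open_domain (X i)).
Variable W : set (forall i, X i -> \bar R).
Variable omega : forall i, X i -> R.
Arguments omega : clear implicits.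
Hypothesis omega_W : W (fun i x => (omega i x)%:E).
Hypothesis omega_ge1 : forall i x, dom (U i) x -> 1 <= `|omega i x|.
Variable k : option nat.

Lemma le_order_S l : le_order l.+1 k -> le_order l k.
Proof. by rewrite /le_order; case: k => // m; exact: ltnW. Qed.

Lemma sn_le_omega (E : I -> normedModType K) l (phi : forall i, X i -> E i) M :
  wle U (fun i x => (omega i x)%:E) l phi M ->
  forall i x, dom (U i) x -> sn l (phi i) x <= M.
Proof.
move=> H i x Ux; rewrite -[leLHS]mul1r; apply: H => //.
by split=> //; rewrite lee_fin omega_ge1.
Qed.

Lemma nrm_le_omega (E : I -> normedModType K) (phi : forall i, X i -> E i) M :
  wle U (fun i x => (omega i x)%:E) 0 phi M ->
  forall i x, dom (U i) x -> nrm (phi i x) <= M / `|omega i x|.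
Proof.
move=> H i x Ux; have o0 : 0 < `|omega i x|.
  exact: lt_le_trans (omega_ge1 Ux).
by rewrite ler_pdivlMr// mulrC; apply: H.
Qed.

(* A continuous linear map from E to the weighted product, without its codomain
   being a single space: this allows products of such maps. *)
Record continuous_family (E : tvsType K) (P : I -> normedModType K)
    (L : E -> forall i, X i -> P i) : Prop := ContinuousFamily {
  cfam_lin : forall (a : K) u v i x, L (a *: u + v) i x = a *: L u i x + L v i x;
  cfam_FCn : forall u i l, le_order l k -> FCn (U i) l (L u i);
  cfam_bounded : forall u f, W f -> forall l, le_order l k ->
    exists M, wle U f l (L u) M;
  cfam_continuous : forall u0 f, W f -> forall l, le_order l k ->
    forall e, 0 < e -> \forall u \near u0,
      wle U f l (fun i x => L u i x - L u0 i x) e }.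

(** A seminorm sees one order of derivative, [wle] a whole jet; orders are added one at a time,
    halving e at each step. *)
Lemma continuous_family_wprod (Y : I -> normedModType K) :
  continuous_family (fun (gamma : wprod U W k Y) i x => gamma i x).
Proof.
split=> //.
- by move=> u i l; exact: ((wprodP u).1 i).1.
- move=> u f Wf; elim=> [|l IHl] lk.
    exists (wprod_seminorm (exist _ (f, 0%N) (conj Wf lk) : wprod_index W k) u).
    move=> i x a Ux fa.
    exact: (wprod_seminorm_dn I_nonempty u (conj Wf lk) Ux fa).
  have [M HM] := IHl (le_order_S lk).
  exists (M + wprod_seminorm (exist _ (f, l.+1) (conj Wf lk) : wprod_index W k) u).
  move=> i x a Ux fa; rewrite sn_recr mulrDr lerD//; first exact: HM.
  exact: (wprod_seminorm_dn I_nonempty u (conj Wf lk) Ux fa).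
move=> u0 f Wf; elim=> [|l IHl] lk e e0.
  exists [:: exist _ (f, 0%N) (conj Wf lk) : wprod_index W k], e; split=> //.
  move=> u /(_ _ (or_introl erefl)) ue i x a Ux fa.
  apply: le_trans (ltW ue).
  exact: (wprod_seminorm_dn I_nonempty (u - u0) (conj Wf lk) Ux fa).
have e20 : 0 < e / 2 by rewrite divr_gt0.
pose j : wprod_index W k := exist _ (f, l.+1) (conj Wf lk).
have H2 : \forall u \near u0, wprod_seminorm j (u - u0) < e / 2.
  by exists [:: j], (e / 2); split=> // u; apply; left.
apply: filterS2 (IHl (le_order_S lk) _ e20) H2.
move=> u H1 ue i x a Ux fa.
rewrite sn_recr mulrDr [leRHS]splitr lerD//; first exact: H1.
apply: le_trans (ltW ue).
exact: (wprod_seminorm_dn I_nonempty (u - u0) (conj Wf lk) Ux fa).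
Qed.

Lemma sn_pair (E E1 E2 : normedModType K) (A : set E) l (f : E -> E1)
    (g : E -> E2) : open A -> FCn A l f -> FCn A l g ->
  FCn A l (fun x => (f x, g x)) /\ forall x, A x ->
  sn l (fun x => (f x, g x)) x <= 3 ^+ l * (sn l f x + sn l g x).
Proof.
move=> oA cf cg.
have c1 := FCn_post (bl_inl E1 E2) oA cf; have c2 := FCn_post (bl_inr E1 E2) oA cg.
have fgE x : A x -> (f x, g x) = bl_inl E1 E2 (f x) + bl_inr E1 E2 (g x).
  move=> _; rewrite bl_inlE bl_inrE; apply/pair_equal_spec.
  by rewrite /= addr0 add0r.
split; first exact: FCn_eq fgE (FCn_add oA c1 c2).
move=> x Ax; apply: (le_trans (sn_le_eq oA fgE (FCn_add oA c1 c2) Ax)).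
apply: (le_trans (sn_add oA c1 c2 Ax)); rewrite mulrDr lerD//.
  apply: (le_trans (sn_post (bl_inl E1 E2) oA cf Ax)).
  by rewrite ler_wpM2r ?sn_ge0// ler_piMr ?exprn_ge0// nrm_bl_inl.
apply: (le_trans (sn_post (bl_inr E1 E2) oA cg Ax)).
by rewrite ler_wpM2r ?sn_ge0// ler_piMr ?exprn_ge0// nrm_bl_inr.
Qed.

Lemma wle_pair (P Q : I -> normedModType K) (f : forall i, X i -> \bar R) l
    (phi : forall i, X i -> P i) (psi : forall i, X i -> Q i) M N :
  (forall i, FCn (U i) l (phi i)) -> (forall i, FCn (U i) l (psi i)) ->
  wle U f l phi M -> wle U f l psi N ->
  wle U f l (E := fun i => (P i * Q i)%type) (fun i x => (phi i x, psi i x))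
    (3 ^+ l * (M + N)).
Proof.
move=> c1 c2 HM HN i x a Ux fa.
have [_ H] := sn_pair (dom_open (U i)) (c1 i) (c2 i).
apply: (@le_trans _ _ (a * (3 ^+ l * (sn l (phi i) x + sn l (psi i) x)))).
  by rewrite ler_wpM2l ?(proj1 fa)// H.
rewrite mulrCA ler_wpM2l ?exprn_ge0// mulrDr lerD//.
  exact: HM.
exact: HN.
Qed.

Lemma continuous_family_pair (E : tvsType K) (P : I -> normedModType K)
    (L : E -> forall i, X i -> P i) : continuous_family L ->
  continuous_family (E := (E * E)%type) (P := fun i => (P i * P i)%type)
    (fun z i x => (L z.1 i x, L z.2 i x)).
Proof.
move=> [Llin LF Lb Lc]; split.
- by move=> a [u u'] [v v'] i x; apply/pair_equal_spec; rewrite /= !Llin.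
- move=> [u v] i l lk.
  exact: (sn_pair (dom_open (U i)) (LF u i l lk) (LF v i l lk)).1.
- move=> [u v] f Wf l lk; have [M HM] := Lb u f Wf l lk.
  have [N HN] := Lb v f Wf l lk; exists (3 ^+ l * (M + N)).
  by apply: wle_pair => // i; exact: LF.
move=> [u0 v0] f Wf l lk e e0.
pose d := e / (2 * 3 ^+ l).
have q0 : 0 < 3 ^+ l :> R by exact: exprn_gt0.
have d0 : 0 < d by rewrite divr_gt0// mulr_gt0.
have dE : 3 ^+ l * (d + d) = e by rewrite /d; field; rewrite gt_eqF.
exists ([set u | wle U f l (fun i x => L u i x - L u0 i x) d],
        [set v | wle U f l (fun i x => L v i x - L v0 i x) d]).
  by split; exact: Lc.
move=> [u v] [/= Hu Hv]; rewrite -dE.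
have := wle_pair (fun i => FCn_sub (dom_open (U i)) (LF u i l lk) (LF u0 i l lk))
  (fun i => FCn_sub (dom_open (U i)) (LF v i l lk) (LF v0 i l lk)) Hu Hv.
exact.
Qed.

(** The condition of [wprod_boundary], for families of maps instead of points of a weighted product,
    so that it also applies to pairs. *)
Definition inside (P : I -> normedModType K) (Om : forall i, set (P i))
    (gamma : forall i, X i -> P i) : Prop :=
  exists2 r : R, 0 < r & forall i x, dom (U i) x -> forall y : P i,
    nrm y < r / `|omega i x| -> Om i (gamma i x + y).

(** [Om i] is star-shaped about 0 but perhaps not convex. The segment from gamma0 to gamma lies in
    it because it stays within r / |omega| of gamma0; half of this radius remains around gamma. *)
Lemma inside_near (P : I -> normedModType K) (Om : forall i, set (P i))
    (gamma0 gamma : forall i, X i -> P i) (r : R) : 0 < r ->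
  (forall i x, dom (U i) x -> forall y : P i,
    nrm y < r / `|omega i x| -> Om i (gamma0 i x + y)) ->
  wle U (fun i x => (omega i x)%:E) 0
    (fun i x => gamma i x - gamma0 i x) (r / 2) ->
  inside Om gamma /\ forall i x, dom (U i) x -> forall s, 0 <= s <= 1 ->
    Om i (gamma0 i x + ofreal K s *: (gamma i x - gamma0 i x)).
Proof.
move=> r0 rOm H; have r20 : 0 < r / 2 by rewrite divr_gt0.
split.
  exists (r / 2) => // i x Ux y yr.
  rewrite -(subrK (gamma0 i x) (gamma i x)) (addrC _ (gamma0 i x)) -addrA.
  apply: rOm => //; rewrite (le_lt_trans (nrmD _ _))// [r]splitr mulrDl.
  by rewrite ler_ltD// (nrm_le_omega H).
move=> i x Ux s /andP[s0 s1]; apply: rOm => //.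
rewrite nrmZr ger0_norm// (le_lt_trans (ler_piMl (nrm_ge0 _) s1))//.
rewrite (le_lt_trans (nrm_le_omega H Ux))// ltr_pM2r; last first.
  by rewrite invr_gt0 (lt_le_trans _ (omega_ge1 Ux)).
by rewrite ltr_pdivrMr// ltr_pMr// ltr1n.
Qed.

Lemma inside_dom (P : I -> normedModType K) (Om : forall i, set (P i))
    (gamma : forall i, X i -> P i) : inside Om gamma ->
  forall i x, dom (U i) x -> Om i (gamma i x).
Proof.
move=> [r r0 H] i x Ux; rewrite -(addr0 (gamma i x)); apply: H => //.
by rewrite nrm0 divr_gt0// (lt_le_trans _ (omega_ge1 Ux)).
Qed.

Lemma wle_mono (P : I -> normedModType K) f l (phi : forall i, X i -> P i) M N :
  M <= N -> wle U f l phi M -> wle U f l phi N.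
Proof. by move=> MN H i x a Ux fa; exact: le_trans (H i x a Ux fa) MN. Qed.

Lemma wle_list (P : I -> normedModType K) l (phi : forall i, X i -> P i)
    (fs : seq (forall i, X i -> \bar R)) :
  (forall f, List.In f fs -> exists M, wle U f l phi M) ->
  exists2 M, 0 < M & forall f, List.In f fs -> wle U f l phi M.
Proof.
elim: fs => [|f fs IHfs] H; first by exists 1.
have [N HN] := H f (or_introl erefl).
have [|M M0 HM] := IHfs; first by move=> g gfs; apply: H; right.
exists (Num.max M N); first by rewrite lt_max M0.
move=> g [<-|gfs]; first by apply: wle_mono HN; rewrite le_max lexx orbT.
by apply: wle_mono (HM g gfs); rewrite le_max lexx.
Qed.

Lemma FCn_nemytskii (P Z : I -> normedModType K) (Om : forall i, set (P i))
    (F : forall i, (X i * P i)%type -> Z i) (gamma : forall i, X i -> P i) i l :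
  symbol U W Om F -> (forall x, dom (U i) x -> Om i (gamma i x)) ->
  FCn (U i) l (gamma i) -> FCn (U i) l (fun x => F i (x, gamma i x)).
Proof.
move=> sF gOm cg; have oO := open_setX (dom_open (U i)) (sym_open sF i).
apply: (FCn_comp (dom_open (U i)) oO _ (sym_smooth sF i l)
  (FCn_graph (dom_open (U i)) cg)).
by move=> x Ux; split=> //; exact: gOm.
Qed.

Lemma nemytskii_defined (P Z : I -> normedModType K) (Om : forall i, set (P i))
    (F : forall i, (X i * P i)%type -> Z i) (gamma : forall i, X i -> P i) :
  symbol U W Om F -> (forall i x, dom (U i) x -> Om i (gamma i x)) ->
  (forall i l, le_order l k -> FCn (U i) l (gamma i)) ->
  (forall f, W f -> forall l, le_order l k -> exists M, wle U f l gamma M) ->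
  exists Phi : wprod U W k Z,
    forall i x, dom (U i) x -> Phi i x = F i (x, gamma i x).
Proof.
move=> sF gOm cg bg; apply: wprod_exists => [i l lk|f Wf l lk].
  by apply: (FCn_nemytskii sF) => //; [exact: gOm|exact: cg].
have [M HM] := bg _ omega_W l lk.
pose rho := Num.max 1 M.
have rho1 : 1 <= rho by rewrite le_max lexx.
have [fs [C [C0 Wfs HC]]] := symbol_sub sF Wf l rho1.
pose zero i (x : X i) : P i := 0.
have sn_zero i x : sn l (zero i) x = 0 := sn_cst0 _ _ _.
have subE : (fun i x => gamma i x - zero i x) = gamma.
  by apply: functional_extensionality_dep => i; apply/funext => x; rewrite subr0.
have [N N0 HN] := wle_list (fun f ffs => bg f (Wfs f ffs) l lk).
exists (C * N).
have := HC gamma zero (fun i => cg i l lk) (fun i => FCn0 _ _ _).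
rewrite subE => {}HC.
have {}HC : wle U f l (fun i x => F i (x, gamma i x) - F i (x, zero i x)) (C * N).
  apply: HC => //.
  - move=> i x Ux s s01; rewrite add0r subr0.
    by apply: (sym_star sF i).2 => //; exact: gOm.
  - move=> i x Ux; rewrite (le_trans (sn_le_omega HM Ux))//.
    by rewrite le_max lexx orbT.
  - by move=> i x Ux; rewrite sn_zero (le_trans ler01).
  - by move=> f' Wf'; exact: bg.
apply: wle_le HC => i x Ux.
apply: (sn_le_eq (dom_open (U i))) Ux.
  by move=> y Uy; rewrite (sym_zero sF)// subr0.
apply: (FCn_sub (dom_open (U i))); apply: (FCn_nemytskii sF).
- by move=> y; exact: gOm.
- exact: cg.
- by move=> y Uy; exact: (sym_star sF i).1.
- exact: FCn0.
Qed.

(** * The operator of a symbol: existence, continuity, derivative *)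

Section Operator.
Variables (E : tvsType K) (P Z : I -> normedModType K).
Variables (Om : forall i, set (P i)) (F : forall i, (X i * P i)%type -> Z i).
Variable L : E -> forall i, X i -> P i.
Arguments F : clear implicits.
Arguments L : clear implicits.
Hypotheses (sF : symbol U W Om F) (LL : continuous_family L).

(** Phi is total on E; its values are prescribed only where L u keeps its distance from the
    boundary. *)
Definition represents (Phi : E -> wprod U W k Z) : Prop :=
  forall u, inside Om (L u) -> forall i x, dom (U i) x ->
    Phi u i x = F i (x, L u i x).

Lemma nemytskii_exists : exists Phi, represents Phi.
Proof.
suff /choice[Phi HPhi] : forall u, exists Phi : wprod U W k Z,
    inside Om (L u) -> forall i x, dom (U i) x -> Phi i x = F i (x, L u i x).
  by exists Phi.
move=> u; have [uin|uout] := pselect (inside Om (L u)); last by exists 0.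
have [Phi HPhi] := nemytskii_defined sF (inside_dom uin)
  (fun i l lk => cfam_FCn LL u i lk) (cfam_bounded LL u).
by exists Phi.
Qed.

Lemma seminorm_le_wle (Phi : wprod U W k Z) (phi : forall i, X i -> Z i)
    (j : wprod_index W k) d : 0 <= d ->
  (forall i, FCn (U i) (sval j).2 (phi i)) ->
  (forall i x, dom (U i) x -> Phi i x = phi i x) ->
  wle U (sval j).1 (sval j).2 phi d -> wprod_seminorm j Phi <= d.
Proof.
move=> d0 cphi PhiE H; apply: wprod_seminorm_le => // i x a Ux fa.
apply: le_trans (H i x a Ux fa); rewrite ler_wpM2l ?(proj1 fa)//.
apply: (le_trans (dn_le_sn _ _ (leqnn _))).
exact: (sn_le_eq (dom_open (U i)) (PhiE i) (cphi i) Ux).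
Qed.

Lemma represents_continuous (Phi : E -> wprod U W k Z) u0 :
  represents Phi -> inside Om (L u0) -> {for u0, continuous Phi}.
Proof.
move=> HPhi in0 A [js [e [e0 eA]]].
suff H j : List.In j js ->
    \forall u \near u0, wprod_seminorm j (Phi u - Phi u0) < e.
  have := near_list _ H; move=> /(_ (nbhs_filter u0)).
  by apply: filterS => u Hu; exact: eA.
move=> _; case: j => -[f l] /= fl; have [/= Wf lk] := fl.
have [r r0 rOm] := in0.
have [M0 HM0] := cfam_bounded LL u0 omega_W lk.
(* Valid for all u near u0: the jet of L u differs from that of L u0 by at most 1. It is fixed
   before u because fs and C depend on it. *)
pose rho := Num.max 1 (1 + M0).
have rho1 : 1 <= rho by rewrite le_max lexx.
have [fs [C [C0 Wfs HC]]] := symbol_sub sF Wf l rho1.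
pose M := e / (C + 1).
have C1 : 0 < C + 1 by rewrite ltr_wpDl.
have M_gt0 : 0 < M by rewrite divr_gt0.
have r20 : 0 < r / 2 by rewrite divr_gt0.
have l0 : le_order 0 k by case: (k).
have nfs := near_list (nbhs_filter u0)
  (fun f ffs => cfam_continuous LL u0 (Wfs f ffs) lk M_gt0).
near=> u.
have uo : wle U (fun i x => (omega i x)%:E) 0
    (fun i x => L u i x - L u0 i x) (r / 2).
  by near: u; exact: cfam_continuous.
have ul : wle U (fun i x => (omega i x)%:E) l (fun i x => L u i x - L u0 i x) 1.
  by near: u; exact: cfam_continuous.
have ufs : forall f, List.In f fs -> wle U f l (fun i x => L u i x - L u0 i x) M.
  by near: u.
have [inu seg] := inside_near r0 rOm uo.
have cu i : FCn (U i) l (L u i) by exact: cfam_FCn LL _ _ _ lk.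
have cu0 i : FCn (U i) l (L u0 i) by exact: cfam_FCn LL _ _ _ lk.
apply: (@le_lt_trans _ _ (C * M)); last first.
  by rewrite /M mulrCA -[ltRHS]mulr1 ltr_pM2l// ltr_pdivrMr// mul1r ltrDl.
apply: (seminorm_le_wle (phi := fun i x => F i (x, L u i x) - F i (x, L u0 i x))).
- by rewrite mulr_ge0// ltW.
- move=> i /=.
  have n1 := FCn_nemytskii sF (inside_dom inu (i := i)) (cu i).
  have n2 := FCn_nemytskii sF (inside_dom in0 (i := i)) (cu0 i).
  exact: (FCn_sub (dom_open (U i)) n1 n2).
- by move=> i x Ux; rewrite -(HPhi u inu i x Ux) -(HPhi u0 in0 i x Ux).
apply: (HC _ _ cu cu0 seg) => //.
- move=> i x Ux.
  have uE y : dom (U i) y -> L u i y = 1 *: (L u i y - L u0 i y) + L u0 i y.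
    by rewrite scale1r subrK.
  have cS := FCn_sub (dom_open (U i)) (cu i) (cu0 i).
  have := sn_lin (dom_open (U i)) uE cS (cu0 i) Ux.
  rewrite normr1 -(ofreal1 K) ofrealK mul1r => /le_trans; apply.
  rewrite le_max; apply/orP; right; apply: lerD.
    exact: (sn_le_omega ul).
  exact: (sn_le_omega HM0).
- move=> i x Ux; apply: (le_trans (sn_le_omega HM0 Ux)).
  by rewrite le_max; apply/orP; right; rewrite lerDr.
move=> f' Wf'; have [N1 HN1] := cfam_bounded LL u Wf' lk.
have [N2 HN2] := cfam_bounded LL u0 Wf' lk.
exists (N1 + N2) => i x a Ux fa.
apply: (@le_trans _ _ (a * (sn l (L u i) x + sn l (L u0 i) x))).
  by rewrite ler_wpM2l ?(proj1 fa)//; exact: (sn_sub (dom_open (U i))).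
by rewrite mulrDr lerD ?HN1 ?HN2.
Unshelve. all: by end_near. Qed.

(** The difference quotient minus D is t^-1 times the Taylor remainder, hence at most C M |t| in the
    given seminorm. *)
Lemma represents_derivative (Phi : E -> wprod U W k Z) (D : wprod U W k Z) u v :
  represents Phi -> inside Om (L u) ->
  (forall i x, dom (U i) x -> D i x = fderiv (F i) (x, L u i x) (0, L v i x)) ->
  (fun t : K => t^-1 *: (Phi (u + t *: v) - Phi u)) @ 0^' --> D.
Proof.
move=> HPhi inu DE A [js [e [e0 eA]]].
suff H j : List.In j js -> \forall t \near (0 : K)^',
    wprod_seminorm j (t^-1 *: (Phi (u + t *: v) - Phi u) - D) < e.
  have := near_list _ H; move=> /(_ (dnbhs_filter _)).
  by apply: filterS => t Ht; exact: eA.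
move=> _; case: j => -[f l] /= fl; have [/= Wf lk] := fl.
have [r r0 rOm] := inu.
have l0 : le_order 0 k by case: (k).
have [M1 HM1] := cfam_bounded LL u omega_W lk.
have [M2 HM2] := cfam_bounded LL v omega_W lk.
have [M3 HM3] := cfam_bounded LL v omega_W l0.
pose rho := Num.max 1 (Num.max M1 M2).
have rho1 : 1 <= rho by rewrite le_max lexx.
have [fs [C [C0 Wfs HC]]] := symbol_taylor sF Wf l rho1.
have [M M_gt0 HM] := wle_list (fun f ffs => cfam_bounded LL v (Wfs f ffs) lk).
pose N := `|M3| + 1.
have N0 : 0 < N by rewrite ltr_wpDl.
pose N' := C * M + 1.
have CM0 : 0 <= C * M by rewrite mulr_ge0// ltW.
have N'0 : 0 < N' by rewrite ltr_wpDl.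
(* In this order: |t| <= 1 for the Taylor estimate, u + t v stays inside, and C M |t| < e. *)
pose d := Num.min 1 (Num.min (r / 2 / N) (e / N')).
have d0 : 0 < d by rewrite !lt_min ltr01 !divr_gt0.
have od0 : 0 < ofreal K d by rewrite -(ofreal0 K) lt_ofreal.
have cu i : FCn (U i) l (L u i) by exact: cfam_FCn LL _ _ _ lk.
have cv i : FCn (U i) l (L v i) by exact: cfam_FCn LL _ _ _ lk.
near=> t.
have t_neq0 : t != 0 by near: t; exact: nbhs_dnbhs_neq.
have : `|t| < ofreal K d by near: t; exact: dnbhs0_lt.
rewrite -[`|t|]srealK// lt_ofreal !lt_min => /and3P[t1 tr te].
set tau := sreal `|t| in t1 tr te.
have tau0 : 0 <= tau := sreal_norm_ge0 t.
have tauV : sreal `|t^-1| * tau = 1.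
  apply: (@ofreal_inj _ K); rewrite ofrealM !srealK// -normrM mulVf//.
  by rewrite normr1 ofreal1.
have utE i x : L (u + t *: v) i x = L u i x + t *: L v i x.
  by rewrite addrC (cfam_lin LL) addrC.
have utD i x : L (u + t *: v) i x - L u i x = t *: L v i x.
  by rewrite utE addrC addKr.
have uo : wle U (fun i x => (omega i x)%:E) 0
    (fun i x => L (u + t *: v) i x - L u i x) (r / 2).
  move=> i x a Ux fa; rewrite /= utD nrmZ -/tau mulrCA.
  have h := HM3 i x a Ux fa; rewrite /= in h.
  apply: (@le_trans _ _ (tau * N)).
    rewrite ler_wpM2l// (le_trans h)// (le_trans (ler_norm _))//.
    by rewrite /N lerDl.
  by rewrite -ler_pdivlMr// ltW.
have [inut seg] := inside_near r0 rOm uo.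
have rest : wle U f l (fun i x => F i (x, L u i x + t *: L v i x) - F i (x, L u i x)
     - t *: fderiv (F i) (x, L u i x) (0, L v i x)) (C * M * tau ^+ 2).
  apply: HC => //.
  - exact: ltW.
  - move=> i x Ux s s01.
    by have := seg i x Ux s s01; rewrite utD.
  - move=> i x Ux; apply: (le_trans (sn_le_omega HM1 Ux)).
    by rewrite !le_max lexx orbT.
  - move=> i x Ux; apply: (le_trans (sn_le_omega HM2 Ux)).
    by rewrite !le_max lexx !orbT.
  - by move=> f' Wf'; exact: cfam_bounded.
pose rem i x := F i (x, L u i x + t *: L v i x) - F i (x, L u i x)
     - t *: fderiv (F i) (x, L u i x) (0, L v i x).
have crem i : FCn (U i) l (rem i).
  have oO := open_setX (dom_open (U i)) (sym_open sF i).
  have ueq x : dom (U i) x -> rem i x =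
      F i ((x, L u i x) + t *: (0, L v i x)) - F i (x, L u i x) -
      t *: fderiv (F i) (x, L u i x) (0, L v i x).
    move=> _; congr (F i _ - _ - _).
    by apply/pair_equal_spec; rewrite /= scaler0 addr0.
  apply: (FCn_eq (dom_open (U i)) ueq).
  apply: (FCn_taylor (dom_open (U i)) oO _ _ (sym_smooth sF i l.+1)
    (FCn_graph (dom_open (U i)) (cu i)) (FCn_inr (dom_open (U i)) (cv i))).
    by move=> x Ux; split=> //; exact: (inside_dom inu).
  move=> x Ux; split; rewrite /= ?scaler0 ?addr0//.
  by rewrite -utE; exact: (inside_dom inut).
apply: (@le_lt_trans _ _ (C * M * tau)); last first.
  apply: (@le_lt_trans _ _ (N' * tau)).
    by rewrite ler_wpM2r// /N' lerDl.
  by rewrite mulrC -ltr_pdivlMr.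
apply: (seminorm_le_wle (phi := fun i x => t^-1 *: rem i x)).
- exact: mulr_ge0.
- by move=> i; exact: (FCn_scale _ (dom_open (U i)) (crem i)).
- move=> i x Ux.
  transitivity (t^-1 *: (Phi (u + t *: v) i x - Phi u i x) - D i x); first by [].
  rewrite (HPhi _ inut i x Ux) (HPhi _ inu i x Ux) (DE i x Ux) utE /rem.
  by rewrite (scalerBr t^-1 (_ - _)) scalerA mulVf// scale1r.
move=> i x a Ux fa.
apply: (@le_trans _ _ (a * (sreal `|t^-1| * sn l (rem i) x))).
  rewrite ler_wpM2l ?(proj1 fa)//.
  exact: (sn_scale (dom_open (U i)) _ (crem i) Ux).
rewrite mulrCA; apply: (@le_trans _ _ (sreal `|t^-1| * (C * M * tau ^+ 2))).
  by rewrite ler_wpM2l ?sreal_norm_ge0//; exact: rest.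
by rewrite expr2 (mulrA (C * M)) mulrCA mulrA -mulrA -/tau mulrC tauV mul1r.
Unshelve. all: by end_near. Qed.

End Operator.

(** The derivative is again an operator of a symbol, [dsym F], over the parameter space E x E with
    the pair of L with itself. The induction therefore ranges over all parameter spaces, symbols and
    families at once. *)
Lemma represents_Cn n : forall (E : tvsType K) (P Z : I -> normedModType K)
    (Om : forall i, set (P i)) (F : forall i, (X i * P i)%type -> Z i)
    (L : E -> forall i, X i -> P i) (O : set E) (Phi : E -> wprod U W k Z),
  symbol U W Om F -> continuous_family L ->
  (forall u, O u -> inside Om (L u)) -> represents Om F L Phi -> Cn_on n O Phi.
Proof.
have cont (E : tvsType K) (P Z : I -> normedModType K)
    (Om : forall i, set (P i)) (F : forall i, (X i * P i)%type -> Z i)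
    (L : E -> forall i, X i -> P i) (O : set E) (Phi : E -> wprod U W k Z) :
    symbol U W Om F -> continuous_family L ->
    (forall u, O u -> inside Om (L u)) -> represents Om F L Phi ->
    {within O, continuous Phi}.
  move=> sF LL OL HPhi; apply: continuous_in_subspaceT => u /[!inE] Ou.
  exact: (represents_continuous sF LL HPhi (OL u Ou)).
elim: n => [|n IHn] E P Z Om F L O Phi sF LL OL HPhi.
  exact: (cont _ _ _ _ _ _ _ _ sF LL OL HPhi).
have sF' := symbol_dsym sF; have LL' := continuous_family_pair LL.
have [D HD] := nemytskii_exists sF' LL'.
(* Only the first component is constrained, and the maximum norm on pairs lets the same r serve. *)
have OL' z : (O `*` [set: E]) z -> inside (P := fun i => (P i * P i)%type)
    (fun i => Om i `*` setT) (fun i x => (L z.1 i x, L z.2 i x)).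
  move=> [Oz _]; have [r r0 H] := OL _ Oz; exists r => // i x Ux [y y1].
  by rewrite nrm_pair gt_max => /andP[yr _]; split=> //; exact: H.
exists D; split.
- move=> u v Ou; apply: (represents_derivative sF LL HPhi (OL u Ou)).
  by move=> i x Ux; rewrite (HD (u, v) (OL' (u, v) (conj Ou Logic.I)) i x Ux).
- exact: (cont _ _ _ _ _ _ _ _ sF' LL' OL' HD).
- exact: (IHn _ _ _ _ _ _ _ _ sF' LL' OL' HD).
Qed.

Lemma open_wprod_boundary (Y : I -> normedModType K) (V : forall i, set (Y i)) :
  open (wprod_boundary V omega : set (wprod U W k Y)).
Proof.
rewrite openE => gamma [r r0 rV].
have l0 : le_order 0 k by case: (k).
have r20 : 0 < r / 2 by rewrite divr_gt0.
apply: filterS (cfam_continuous (continuous_family_wprod Y) gamma omega_W l0 r20).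
by move=> ga H; have [] := inside_near r0 rV H.
Qed.

End Superposition.

Theorem proposition4p21
  (R : realType) (K : scalarField R)
  (K_real_or_complex : K = real_scalars R \/ K = complex_scalars R)
  (I : Type) (I_nonempty : inhabited I)
  (X Y Z : I -> normedModType K)
  (U : forall i, open_domain (X i))
  (V : forall i, set (Y i))
  (V_open : forall i, open (V i))
  (V_star : forall i, star_shaped0 (V i))
  (W : set (forall i, X i -> \bar R))
  (W_weights : forall f, W f -> is_weight U f)
  (omega : forall i, X i -> R)
  (omega_adjusting : adjusting_weight U V omega)
  (omega_W : W (fun i x => (omega i x)%:E))
  (beta : forall i, (X i * Y i)%type -> Z i)
  (beta_smooth : forall i, FC (dom (U i) `*` V i) None (beta i))
  (beta0 : forall i x, dom (U i) x -> beta i (x, 0) = 0)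
  (beta_bounded : forall f, W f -> forall l : nat, (0 < l)%N ->
    exists2 g, Wmax U W g & forall i x, dom (U i) x ->
      (wnorm (dom (U i) `*` V i) (cst 1%E) l (beta i) * `|f i x|
        <= `|g i x|)%E)
  (k : option nat) :
  exists beta_star : wprod U W k Y -> wprod U W k Z,
    (forall gamma, wprod_boundary V omega gamma ->
      forall i x, dom (U i) x -> beta_star gamma i x = beta i (x, gamma i x)) /\
    smooth_on (wprod_boundary V omega) beta_star.
Proof.
have omega_ge1 i x : dom (U i) x -> 1 <= `|omega i x|.
  move=> Ux; have [_ oge] := omega_adjusting i.
  rewrite -lee_fin (le_trans _ (le_trans oge _))//.
    by rewrite le_max lexx orbT.
  by apply: ereal_inf_lbound; exists x.
have sbeta : symbol U W V beta by exact: symbol_of_bounds.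
(* With the weighted product itself as parameter space, [inside] is [wprod_boundary]. *)
have Lid := continuous_family_wprod I_nonempty U W k Y.
have [beta_star Hbeta] := nemytskii_exists omega_W omega_ge1 sbeta Lid.
exists beta_star; split; first exact: Hbeta.
split; first exact: open_wprod_boundary.
move=> n; exact: (represents_Cn omega_W omega_ge1 n sbeta Lid).
Qed.
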